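(* Let $n\ge 1$ and let $\Omega\subset\mathbb R^{n+1}$ be a domain with nonempty $C^2$ boundary which is weakly mean convex, i.e. $H_0:=\inf_{y\in\partial\Omega}H(y)\ge 0$. Set $$\lambda(n,\Omega)=\inf_{x\in G}\frac{-\Delta\delta(x)}{2\delta(x)} .$$ Then $\lambda(n,\Omega)\ge \frac{2}{n}H_0^2$, and for every $f\in C_0^\infty(\Omega)$, $$\int_\Omega|\nabla f|^2\,dx\ \ge\ \frac14\int_\Omega\frac{|f|^2}{\delta^2}\,dx+\lambda(n,\Omega)\int_\Omega|f|^2\,dx .$$
   Context: A domain is an open connected subset of Euclidean space; its boundary is $C^2$ if near each boundary point the domain is, after a rotation, the region on one side of the graph of a $C^2$ function. $\delta(x)=\inf_{y\in\mathbb R^{n+1}\setminus\Omega}|x-y|$. For $y\in\partial\Omega$, $\kappa_1(y),\dots,\kappa_n(y)$ are the principal curvatures of $\partial\Omega$ at $y$ with respect to the outward unit normal, with the sign convention that they all equal $1$ when $\Omega$ is the unit ball, and $H(y)=\sum_{i=1}^n\kappa_i(y)$ is the mean curvature (so the unit sphere has $H=n$). The good set $G\subset\Omega$ is the largest open subset of $\Omega$ such that every $x\in G$ has a unique nearest point on $\partial\Omega$; $S=\Omega\setminus G$ is the singular set (it has Lebesgue measure zero). One has $\delta\in C^2(G)$, so $\Delta\delta$ is defined classically on $G$. *)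

(* Defs.v *)
From HB Require Import structures.
From mathcomp Require Import all_boot all_order all_algebra.
From mathcomp Require Import all_classical all_reals all_analysis.
From mathcomp Require Import measurable_realfun.

Set Implicit Arguments.
Unset Strict Implicit.
Unset Printing Implicit Defensive.

Import Order.TTheory GRing.Theory Num.Theory.
Import numFieldNormedType.Exports.

Local Open Scope classical_set_scope.
Local Open Scope ring_scope.

Definition rV_display (R : realType) (n : nat) : measure_display :=
  sigma_display (@open 'rV[R]_n).

Section borel_rV.
Context {R : realType} {n : nat}.

HB.instance Definition _ := @isMeasurable.Build (rV_display R n) 'rV[R]_n
  <<s @open 'rV[R]_n >> (@sigma_algebra0 _ setT (@open 'rV[R]_n))
  (@sigma_algebraC _ (@open 'rV[R]_n))
  (@sigma_algebra_bigcup _ setT (@open 'rV[R]_n)).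

Lemma open_measurable_rV (U : set 'rV[R]_n) : open U -> measurable U.
Proof. exact: sub_sigma_algebra. Qed.

Lemma measurable_coord_rV (i : 'I_n) :
  measurable_fun [set: 'rV[R]_n] (fun v : 'rV[R]_n => v 0 i : measurableTypeR R).
Proof.
apply: (measurability _ (RGenOpens.measurableE R)).
move=> _ [_ [a [b ->] <-]]; rewrite setTI; apply: open_measurable_rV.
apply: (@open_comp _ _ (fun v : 'rV[R]_n => v 0 i)) => [x _|].
  exact: coord_continuous.
exact: interval_open.
Qed.

Lemma measurable_fun_rV d (T : measurableType d) (f : T -> 'rV[R]_n) :
  (forall i, measurable_fun [set: T] (fun t => f t 0 i : measurableTypeR R)) ->
  measurable_fun [set: T] f.
Proof.
move=> mf; apply: (measurability (@open 'rV[R]_n)) => //.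
move=> _ [U oU <-]; rewrite setTI.
pose q2r (q : 'rV[rat]_n) : 'rV[R]_n := map_mx ratr q.
pose B (p : 'rV[rat]_n * nat) := ball (q2r p.1) p.2.+1%:R^-1.
pose F p := if pselect (B p `<=` U) then f @^-1` B p else set0.
have -> : f @^-1` U = \bigcup_p F p.
  apply/seteqP; split => [t /= Ut|t [p _]]; last first.
    by rewrite /F; case: pselect => /= [BU tB|_ []]; exact: BU.
  have /nbhs_ballP[e/= e0 eU] : nbhs (f t) U by exact: open_nbhs_nbhs.
  have [k ke] : exists k, k.+1%:R^-1 < e / 2.
    have e20 : 0 < e / 2 by rewrite divr_gt0.
    near \oo => k; exists k; near: k.
    exact: (near_infty_natSinv_lt (PosNum e20)).
  pose r : R := k.+1%:R^-1.
  have r0 : 0 < r by rewrite invr_gt0.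
  have /choice[q qP] : forall i, exists q : rat,
      ratr q \in `](f t 0 i - r), (f t 0 i + r)[.
    by move=> i; apply: rat_in_itvoo; rewrite ltrBlDr -addrA ltrDl addr_gt0.
  have tB : B (\row_i q i, k) (f t).
    split => // i j; rewrite (ord1 i) !mxE/= /ball/=.
    by have := qP j; rewrite in_itv/= -ltr_distl.
  exists (\row_i q i, k) => //; rewrite /F; case: pselect => //; case.
  move=> y yB; apply: eU; rewrite (splitr e).
  apply: (@ball_triangle _ _ (q2r (\row_i q i))).
    by apply: ball_sym; apply: le_ball tB => /=; exact: ltW.
  by apply: le_ball yB; exact: ltW.
apply: countable_bigcupT_measurable => [|p]; first exact: countableP.
rewrite /F; case: pselect => /= [_|_]; last exact: measurable0.
rewrite (_ : _ @^-1` _ = \bigcap_(i in [set: 'I_n])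
    ((fun t => f t 0 i) @^-1` ball (q2r p.1 0 i) p.2.+1%:R^-1)); last first.
  apply/seteqP; split => [t [_ tB] i _|t tB]; first exact: tB.
  by split=> [|i j]; [rewrite invr_gt0|rewrite (ord1 i); exact: tB].
apply: fin_bigcap_measurable => // i _.
rewrite -[X in measurable X]setTI; apply: mf => //.
by rewrite ball_itv.
Unshelve. all: by end_near. Qed.

End borel_rV.

(* [rV_cons (x, v)] is the vector (x, v_0, ..., v_(n-1)); note that
   [1 + n] and [n.+1] are convertible. *)
Definition rV_cons (R : realType) (n : nat) (p : measurableTypeR R * 'rV[R]_n) :
  'rV[R]_n.+1 := row_mx (p.1 : R)%:M p.2 : 'rV[R]_(1 + n).

Lemma measurable_rV_cons (R : realType) (n : nat) :
  measurable_fun [set: measurableTypeR R * 'rV[R]_n] (@rV_cons R n).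
Proof.
apply: measurable_fun_rV => i.
have [j ->|j ->] := @split_ordP 1 n i.
  rewrite [X in measurable_fun _ X](_ : _ = fst)//.
  apply/funext => -[x v]; apply: etrans (row_mxEl _ _ _ _) _.
  by rewrite (ord1 j) mxE eqxx.
rewrite [X in measurable_fun _ X](_ : _ = (fun v : 'rV[R]_n => v 0 j) \o snd).
  by apply: measurableT_comp => //; exact: measurable_coord_rV.
by apply/funext => -[x v]; exact: (row_mxEr _ _ _ _).
Qed.

Definition box (R : realType) (n : nat) (a b : 'I_n -> R) : set 'rV[R]_n :=
  [set v : 'rV[R]_n | forall i, v 0 i \in `[a i, b i]].

Lemma measurable_box (R : realType) (n : nat) (a b : 'I_n -> R) :
  measurable (box a b).
Proof.
rewrite (_ : box a b = \bigcap_(i in [set: 'I_n])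
    ((fun v : 'rV[R]_n => v 0 i : measurableTypeR R) @^-1` [set` `[a i, b i]])).
  apply: fin_bigcap_measurable => // i _; rewrite -[X in measurable X]setTI.
  exact: measurable_coord_rV.
by apply/seteqP; split => [v vab i _|v vab i]; exact: vab.
Qed.

Lemma rV_cons0 (R : realType) (n : nat) (x : R) (v : 'rV[R]_n) :
  rV_cons (x, v) 0 ord0 = x.
Proof.
transitivity (rV_cons (x, v) 0 (lshift n (ord0 : 'I_1) : 'I_n.+1)).
  by congr (rV_cons _ _ _); exact/val_inj.
by apply: etrans (row_mxEl _ _ _ _) _; rewrite mxE eqxx.
Qed.

Lemma rV_consS (R : realType) (n : nat) (x : R) (v : 'rV[R]_n) i :
  rV_cons (x, v) 0 (lift ord0 i) = v 0 i.
Proof.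
transitivity (rV_cons (x, v) 0 (rshift 1 i : 'I_n.+1)).
  by congr (rV_cons _ _ _); exact/val_inj.
exact: (row_mxEr _ _ _ _).
Qed.

Lemma rV_cons_box (R : realType) (n : nat) (a b : 'I_n.+1 -> R) :
  @rV_cons R n @^-1` box a b =
  ([set` `[a ord0, b ord0]] : set (measurableTypeR R)) `*`
  box (a \o lift ord0) (b \o lift ord0).
Proof.
apply/seteqP; split => -[x v] /=.
  move=> H; split=> [|i] /=; first by have := H ord0; rewrite rV_cons0.
  by have := H (lift ord0 i); rewrite rV_consS.
move=> [/= xab vab] i.
by have [j ->|->] := unliftP ord0 i; rewrite ?rV_consS ?rV_cons0//; exact: vab.
Qed.

Section lebesgue_rV.
Context {R : realType}.

(* n-fold product of the one-dimensional Lebesgue measure, along [rV_cons];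
   see [lebesgue_rV_box] for its value on boxes. *)
Fixpoint lebesgue_rV (n : nat) : set 'rV[R]_n -> \bar R :=
  match n with
  | 0 => \d_(0 : 'rV[R]_0)
  | m.+1 => pushforward (@lebesgue_measure R \x @lebesgue_rV m)%E (@rV_cons R m)
  end.

Let cube n (k : nat) : set 'rV[R]_n := box (fun=> - k%:R) (fun=> k%:R).

Let bigcup_cube n : \bigcup_k @cube n k = setT.
Proof.
apply/seteqP; split => // v _.
exists (\sum_i (Num.truncn `|v ord0 i|).+1)%N => // i.
rewrite in_itv/= -ler_norml (le_trans (ltW (truncnS_gt _)))//.
by rewrite ler_nat (bigD1 i)//= leq_addr.
Qed.

Let lebesgue_rV_measure_exists n :
  exists mu : {sigma_finite_measure set 'rV[R]_n -> \bar R},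
  @lebesgue_rV n = mu /\ forall k, (mu (@cube n k) < +oo)%E.
Proof.
elim: n => [|n [mu [muE muc]]].
  by exists (\d_(0 : 'rV[R]_0)); split => // k; rewrite /= diracE ltry.
pose m0 : {measure set 'rV[R]_n.+1 -> \bar R} :=
  @measure_function_pushforward__canonical__measure_function_Measure _ _ _ _ _
    (@lebesgue_measure R \x mu)%E _ (@measurable_rV_cons R n).
have mc k : (m0 (@cube n.+1 k) < +oo)%E.
  rewrite /m0/= /pushforward rV_cons_box product_measure1E//; last first.
    exact: measurable_box.
  rewrite lte_mul_pinfty//; last exact: muc.
  by rewrite /= lebesgue_measure_itv/=; case: ifP.
have sf : sigma_finite setT m0.
  exists (@cube n.+1); first by rewrite bigcup_cube.
  by move=> k; split => //; exact: measurable_box.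
have sfin : sfinite_measure m0 by exact: sfinite_measure_sigma_finite.
pose m0S := isSFinite.Build _ _ _ m0 sfin.
pose m0F := isSigmaFinite.Build _ _ _ m0 sf.
pose m : {sigma_finite_measure set 'rV[R]_n.+1 -> \bar R} :=
  HB.pack (Measure.sort m0) (Measure.class m0) m0S m0F.
by exists m; rewrite /= muE.
Qed.

Section instances.
Variable n : nat.

Let lebesgue_rV0 : @lebesgue_rV n set0 = 0%E.
Proof. by have [mu [-> _]] := lebesgue_rV_measure_exists n. Qed.

Let lebesgue_rV_ge0 A : (0 <= @lebesgue_rV n A)%E.
Proof. by have [mu [-> _]] := lebesgue_rV_measure_exists n. Qed.

Let lebesgue_rV_sigma_additive : semi_sigma_additive (@lebesgue_rV n).
Proof.
have [mu [-> _]] := lebesgue_rV_measure_exists n.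
exact: measure_semi_sigma_additive.
Qed.

HB.instance Definition _ := isMeasure.Build _ _ _ (@lebesgue_rV n)
  lebesgue_rV0 lebesgue_rV_ge0 lebesgue_rV_sigma_additive.

Let lebesgue_rV_sigma_finite : sigma_finite setT (@lebesgue_rV n).
Proof.
have [mu [-> _]] := lebesgue_rV_measure_exists n; exact: sigma_finiteT.
Qed.

HB.instance Definition _ := Measure_isSigmaFinite.Build _ _ _ (@lebesgue_rV n)
  lebesgue_rV_sigma_finite.

End instances.

Lemma lebesgue_rV_box n (a b : 'I_n -> R) : (forall i, a i <= b i) ->
  @lebesgue_rV n (box a b) = (\prod_(i < n) (b i - a i))%:E.
Proof.
elim: n a b => [|n IHn] a b ab.
  by rewrite big_ord0 /= diracE mem_set// => -[].
rewrite big_ord_recl /= /pushforward rV_cons_box product_measure1E//; last first.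
  exact: measurable_box.
rewrite /= IHn => [|i]; last exact: ab.
rewrite lebesgue_measure_itv/= lte_fin -EFinD.
case: ltP => // ba; have /eqP -> : a ord0 == b ord0 by rewrite eq_le ab.
by rewrite subrr !mul0r mul0e.
Qed.

End lebesgue_rV.
Arguments lebesgue_rV R n : clear implicits.

Section calculus.
Context {R : realType} {n : nat}.
Implicit Types (f : 'rV[R]_n -> R) (x : 'rV[R]_n).

(* The norm of the normed module 'rV[R]_n is the sup norm, hence this
   definition; both induce the same topology. *)
Definition enorm x : R := Num.sqrt (\sum_i x 0 i ^+ 2).

Definition partial f (i : 'I_n) : 'rV[R]_n -> R := 'D_(delta_mx 0 i) f.

Definition gradient f x : 'rV[R]_n := \row_i partial f i x.

Definition hessian f x : 'M[R]_n := \matrix_(i, j) partial (partial f i) j x.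

Definition laplacian f x : R := \sum_i partial (partial f i) i x.

Fixpoint Ck (k : nat) f : Prop :=
  match k with
  | 0 => continuous f
  | k'.+1 => continuous f /\
      forall i, (forall x, derivable f x (delta_mx 0 i)) /\ Ck k' (partial f i)
  end.

Definition smooth f : Prop := forall k, Ck k f.

Definition test_function (Omega : set 'rV[R]_n) f : Prop :=
  let supp := closure [set x | f x != 0] in
  [/\ smooth f, compact supp & supp `<=` Omega].

Definition frontier (Omega : set 'rV[R]_n) : set 'rV[R]_n :=
  closure Omega `\` Omega°.

Definition domain (Omega : set 'rV[R]_n) : Prop := open Omega /\ connected Omega.

Definition rotation (Q : 'M[R]_n) : Prop := Q *m Q^T = 1%:M /\ \det Q = 1.

(* delta(x) *)
Definition bdist (Omega : set 'rV[R]_n) x : R :=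
  inf [set enorm (x - y) | y in ~` Omega].

Definition nearest_point (Omega : set 'rV[R]_n) x y : Prop :=
  frontier Omega y /\
  forall z, frontier Omega z -> enorm (x - y) <= enorm (x - z).

(* The interior of a set is its largest open subset. *)
Definition good_set (Omega : set 'rV[R]_n) : set 'rV[R]_n :=
  [set x | Omega x /\ exists! y, nearest_point Omega x y]°.

Definition hardy_lambda (Omega : set 'rV[R]_n) : \bar R :=
  ereal_inf [set (- laplacian (bdist Omega) x / (2 * bdist Omega x))%:E
            | x in good_set Omega].

End calculus.

Section boundary_geometry.
Context {R : realType} {n : nat}.
Implicit Types (Omega : set 'rV[R]_n.+1) (y : 'rV[R]_n.+1) (Q : 'M[R]_n.+1).
Implicit Types (phi : 'rV[R]_n -> R) (z : 'rV[R]_n).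

Definition horizontal y : 'rV[R]_n := col' ord_max y.
Definition vertical y : R := y 0 ord_max.

(* Near y, in the rotated coordinates x *m Q, Omega is the region lying
   strictly above the graph of the C^2 function phi. *)
Definition graph_chart Omega y Q phi : Prop :=
  [/\ rotation Q, Ck 2 phi &
    \forall x \near y, Omega x <-> phi (horizontal (x *m Q)) < vertical (x *m Q)].

Definition C2_boundary Omega : Prop :=
  forall y, frontier Omega y -> exists Q phi, graph_chart Omega y Q phi.

(* Fundamental forms of the graph of phi at the point above z, in the basis
   (e_i, d_i phi(z)), for the unit normal (grad phi, -1) / sqrt(1 + |grad phi|^2),
   which points outward from the region above the graph. The second fundamental
   form is <d_i nu, e_j>, so that it is positive for the unit ball. *)
Definition first_form phi z : 'M[R]_n :=
  1%:M + (gradient phi z)^T *m gradient phi z.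

Definition second_form phi z : 'M[R]_n :=
  (Num.sqrt (1 + enorm (gradient phi z) ^+ 2))^-1 *: hessian phi z.

Definition shape_operator phi z : 'M[R]_n :=
  invmx (first_form phi z) *m second_form phi z.

(* kappa lists the principal curvatures of the boundary of Omega at y, i.e.,
   the eigenvalues of the shape operator repeated according to multiplicity;
   they do not depend on the chart. *)
Definition principal_curvatures Omega y (kappa : 'I_n -> R) : Prop :=
  exists Q phi, graph_chart Omega y Q phi /\
    char_poly (shape_operator phi (horizontal (y *m Q))) =
    \prod_i ('X - (kappa i)%:P).

Definition mean_curvature Omega y (H : R) : Prop :=
  exists2 kappa, principal_curvatures Omega y kappa & H = \sum_i kappa i.

Definition inf_mean_curvature Omega : \bar R :=
  ereal_inf [set H%:E | H in [set H | exists2 y, frontier Omega y &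
                                                 mean_curvature Omega y H]].

End boundary_geometry.

(* Main.v *)
From HB Require Import structures.
Require Import Defs.
From mathcomp Require Import all_boot all_order all_algebra.
From mathcomp Require Import all_classical all_reals all_analysis.
From mathcomp Require Import measurable_realfun complex.
From mathcomp Require Import ring lra.

Set Implicit Arguments.
Unset Strict Implicit.
Unset Printing Implicit Defensive.

Import Order.TTheory GRing.Theory Num.Theory.
Import numFieldNormedType.Exports.

Local Open Scope classical_set_scope.
Local Open Scope ring_scope.

(* Write delta for the distance to the complement.

   The bound on lambda. Let x be in G and y its nearest point. Moving a
   competitor for the nearest point along the boundary shows that delta^2 is
   touched from above at x by smooth functions. Comparing their second order
   terms gives, for all s, delta Lap(delta) <= n (1 - s)^2 - s^2 delta H(y), and
   s = 1 / (1 - delta H(y) / n) yields -Lap(delta) / (2 delta) >= (2 / n) H^2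
   when delta H(y) < n; otherwise large s would give a contradiction.
   That delta is twice differentiable on G follows from the implicit function
   theorem in a boundary chart: x is interior to a segment [y, x'] with y
   nearest to x' as well, and on such a segment the critical point equation of
   the foot is nondegenerate.

   The integral inequality. With w = sqrt(delta), the discrete ground state
   inequality
     (f(a) - f(b))^2 >= (w(a) - w(b)) (f(a)^2 / w(a) - f(b)^2 / w(b))
   with b = a + h e_i, integrated by means of translation invariance only, gives
     int sum_i ((f(x + h e_i) - f(x)) / h)^2 dx >= int (f^2 / w) (- Lap_h w) dx
   where Lap_h is the discrete Laplacian. As h tends to 0, the lower limit of
   - Lap_h w / w is at least 1 / (4 delta^2) + lambda at every point of Omega,
   singular or not: near x, delta is at most tau + delta(. + z - x), where z
   lies on the segment from x to its foot y, is in G, and tau = |x - z| is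
   arbitrarily small. So neither the measure of S nor the distributional
   Laplacian of delta is needed. *)

(** * Euclidean geometry of row vectors *)

(** [derive] takes a default value where its limit diverges, so [laplacian] carries information only
    where second derivatives are shown to exist; this is why twice differentiability on the whole of
    G has to be proved. The obstacle is that minimality of a foot y of x only gives a nonstrict
    second order inequality, and x could be a focal point of the boundary. If z = y + s (x' - y)
    with s < 1 and y is also a foot of x', the inequality at x' improves at z to a form bounded
    below by 1 - s; this is why x is first placed strictly inside a longer segment.

    The function w is the ground state because, where delta is twice differentiable, - Lap(w) / w =
    |grad delta|^2 / (4 delta^2) - Lap(delta) / (2 delta), and |grad delta| = 1. The constant 1/4
    and the definition of lambda are the two terms of this identity.

    The limit h -> 0 is one-sided. Semiconcavity of delta bounds - Lap_h w from below by an amount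
    independent of h, but at singular points - Lap_h w may tend to infinity. The integrand is
    therefore cut off from above at its expected limit, which the pointwise lower bound on the lower
    limit allows. *)

Section euclid.
Context {R : realType} {n : nat}.
Implicit Types (u v w : 'rV[R]_n) (a : R).

Definition dot u v : R := \sum_i u 0 i * v 0 i.

Lemma dotE u v : dot u v = (u *m v^T) 0 0.
Proof. by rewrite mxE; apply: eq_bigr => i _; rewrite mxE. Qed.

Lemma dotC u v : dot u v = dot v u.
Proof. by apply: eq_bigr => i _; rewrite mulrC. Qed.

Lemma dotDl u v w : dot (u + v) w = dot u w + dot v w.
Proof. by rewrite !dotE mulmxDl mxE. Qed.

Lemma dotDr u v w : dot w (u + v) = dot w u + dot w v.
Proof. by rewrite dotC dotDl !(dotC w). Qed.

Lemma dotZl a u w : dot (a *: u) w = a * dot u w.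
Proof. by rewrite !dotE -scalemxAl mxE. Qed.

Lemma dotZr a u w : dot w (a *: u) = a * dot w u.
Proof. by rewrite dotC dotZl (dotC w). Qed.

Lemma dotNl u w : dot (- u) w = - dot u w.
Proof. by rewrite -scaleN1r dotZl mulN1r. Qed.

Lemma dotNr u w : dot w (- u) = - dot w u.
Proof. by rewrite dotC dotNl (dotC w). Qed.

Lemma dotBl u v w : dot (u - v) w = dot u w - dot v w.
Proof. by rewrite dotDl dotNl. Qed.

Lemma dotBr u v w : dot w (u - v) = dot w u - dot w v.
Proof. by rewrite dotDr dotNr. Qed.

Lemma dot0l u : dot 0 u = 0.
Proof. by rewrite -(scale0r u) dotZl mul0r. Qed.

Lemma dot0r u : dot u 0 = 0.
Proof. by rewrite dotC dot0l. Qed.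

Lemma dot_delta u i : dot u (delta_mx 0 i) = u 0 i.
Proof.
rewrite /dot (bigD1 i)//= mxE !eqxx mulr1 big1 ?addr0// => j ji.
by rewrite mxE eqxx/= (negbTE ji) mulr0.
Qed.

Lemma dot_ge0 u : 0 <= dot u u.
Proof. by apply: sumr_ge0 => i _; rewrite -expr2 sqr_ge0. Qed.

Lemma dot_eq0 u : (dot u u == 0) = (u == 0).
Proof.
apply/eqP/eqP => [u0|->]; last exact: dot0l.
apply/rowP => i; rewrite mxE; apply/eqP; suff: u 0 i * u 0 i == 0 by rewrite mulf_eq0 orbb.
have /psumr_eq0P : forall j : 'I_n, true -> 0 <= u 0 j * u 0 j.
  by move=> j _; rewrite -expr2 sqr_ge0.
by move=> /(_ u0) /(_ i isT) ->.
Qed.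

Lemma enorm_sqr u : enorm u ^+ 2 = dot u u.
Proof.
rewrite sqr_sqrtr; first by apply: eq_bigr => i _; rewrite expr2.
by apply: sumr_ge0 => i _; exact: sqr_ge0.
Qed.

Lemma enormE u : enorm u = Num.sqrt (dot u u).
Proof. by rewrite -enorm_sqr sqrtr_sqr ger0_norm// sqrtr_ge0. Qed.

Lemma enorm_ge0 u : 0 <= enorm u.
Proof. exact: sqrtr_ge0. Qed.

Lemma enorm_eq0 u : (enorm u == 0) = (u == 0).
Proof. by rewrite -dot_eq0 -enorm_sqr expf_eq0. Qed.

Lemma enorm0 : enorm (0 : 'rV[R]_n) = 0.
Proof. by apply/eqP; rewrite enorm_eq0. Qed.

Lemma enormZ a u : enorm (a *: u) = `|a| * enorm u.
Proof.
by rewrite enormE dotZl dotZr mulrA -expr2 sqrtrM ?sqr_ge0// sqrtr_sqr -enormE.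
Qed.

Lemma enormN u : enorm (- u) = enorm u.
Proof. by rewrite -scaleN1r enormZ normrN1 mul1r. Qed.

Lemma enormBC u v : enorm (u - v) = enorm (v - u).
Proof. by rewrite -enormN opprB. Qed.

Lemma cauchy_schwarz u v : `|dot u v| <= enorm u * enorm v.
Proof.
have [->|v0] := eqVneq v 0; first by rewrite dot0r normr0 enorm0 mulr0.
have vv : 0 < dot v v by rewrite lt_def dot_eq0 v0 dot_ge0.
rewrite -ler_sqr ?nnegrE ?mulr_ge0 ?enorm_ge0// real_normK ?num_real//.
rewrite exprMn !enorm_sqr.
have := dot_ge0 (dot v v *: u - dot u v *: v).
rewrite !(dotBl, dotBr, dotZl, dotZr) (dotC v u).
rewrite [X in 0 <= X](_ : _ =
  dot v v * (dot u u * dot v v - dot u v ^+ 2)); last by ring.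
by rewrite pmulr_rge0// subr_ge0.
Qed.

Lemma dot_le u v : dot u v <= enorm u * enorm v.
Proof. exact: le_trans (ler_norm _) (cauchy_schwarz u v). Qed.

Lemma ler_enormD u v : enorm (u + v) <= enorm u + enorm v.
Proof.
rewrite -ler_sqr ?nnegrE ?addr_ge0 ?enorm_ge0// enorm_sqr sqrrD !enorm_sqr.
rewrite dotDl !dotDr (dotC v u).
have := dot_le u v; lra.
Qed.

Lemma ler_enormB u v : enorm u - enorm v <= enorm (u - v).
Proof. by have := ler_enormD (u - v) v; rewrite subrK lerBlDr. Qed.

Lemma ler_enorm_sub w u v : enorm (u - v) <= enorm (u - w) + enorm (w - v).
Proof. by rewrite (le_trans _ (ler_enormD _ _))// addrA subrK. Qed.

Lemma coord_enorm u i : `|u 0 i| <= enorm u.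
Proof.
rewrite -ler_sqr ?nnegrE ?enorm_ge0// real_normK ?num_real// enorm_sqr /dot.
rewrite (bigD1 i)//= -expr2 lerDl; apply: sumr_ge0 => j _.
by rewrite -expr2 sqr_ge0.
Qed.

Lemma enorm_le_sum u : enorm u <= \sum_i `|u 0 i|.
Proof.
rewrite -ler_sqr ?nnegrE ?enorm_ge0 ?sumr_ge0// enorm_sqr expr2 big_distrl/=.
apply: ler_sum => i _; rewrite big_distrr/= (bigD1 i)//= -normrM.
rewrite (le_trans (ler_norm _))// lerDl sumr_ge0// => j _; rewrite mulr_ge0.
Qed.

Lemma coord_norm u i : `|u 0 i| <= `|u|.
Proof.
rewrite {2}/Num.norm/= mx_normrE.
by rewrite (le_trans _ (le_bigmax _ _ (ord0, i))).
Qed.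

Lemma norm_le_enorm u : `|u| <= enorm u.
Proof.
rewrite {1}/Num.norm/= mx_normrE; apply: bigmax_le; first exact: enorm_ge0.
by move=> [i j] _; rewrite (ord1 i) coord_enorm.
Qed.

Lemma enorm_le_norm u : enorm u <= n%:R * `|u|.
Proof.
rewrite (le_trans (enorm_le_sum u))//.
rewrite (le_trans (ler_sum _ (fun i _ => coord_norm u i)))//.
by rewrite sumr_const card_ord mulr_natl.
Qed.

Lemma nbhs_enormP u (P : set 'rV[R]_n) :
  nbhs u P <-> exists2 r, 0 < r & forall v, enorm (v - u) < r -> P v.
Proof.
split=> [/nbhs_normP[r /= r0 rP]|[r r0 rP]].
  exists r => // v vr; apply: rP => /=; rewrite -normrN opprB.
  exact: le_lt_trans (norm_le_enorm _) vr.
apply/nbhs_ballP; exists (r / n.+1%:R) => /=; first by rewrite divr_gt0.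
move=> v; rewrite -ball_normE /= => vr; apply: rP; rewrite enormBC.
rewrite (le_lt_trans (enorm_le_norm _))//.
rewrite (@le_lt_trans _ _ (n.+1%:R * `|u - v|))//.
  by rewrite ler_wpM2r// ler_nat.
by rewrite mulrC -ltr_pdivlMr.
Qed.

Lemma lipschitz_continuous (f : 'rV[R]_n -> R) (C : R) :
  (forall u v, `|f u - f v| <= C * enorm (u - v)) -> continuous f.
Proof.
move=> fC u; apply/(@cvgrPdist_le _ _ _ (nbhs u)) => e e0.
have D0 : 0 < `|C| + 1 by rewrite ltr_wpDl.
near=> v; rewrite (le_trans (fC _ _))//.
rewrite (@le_trans _ _ ((`|C| + 1) * enorm (u - v)))//.
  by rewrite ler_wpM2r ?enorm_ge0// (le_trans (ler_norm _))// lerDl.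
rewrite mulrC -ler_pdivlMr//; near: v.
apply/nbhs_enormP; exists (e / (`|C| + 1)); first by rewrite divr_gt0.
by move=> v; rewrite enormBC => /ltW.
Unshelve. all: by end_near. Qed.

Lemma continuous_enormB w : continuous (fun u => enorm (u - w)).
Proof.
apply: (@lipschitz_continuous _ 1) => u v; rewrite mul1r ler_norml.
rewrite lerNl opprB; apply/andP; split.
  by have := ler_enormB (v - w) (u - w); rewrite opprB addrA subrK (enormBC v u).
by have := ler_enormB (u - w) (v - w); rewrite opprB addrA subrK.
Qed.

Lemma compact_eball (x : 'rV[R]_n) r : compact [set v | enorm (v - x) <= r].
Proof.
apply: bounded_closed_compact; last first.
  rewrite (_ : mkset _ = (fun v => enorm (v - x)) @^-1` [set t | t <= r])//.
  by apply: closed_comp (@closed_le _ r) => v _; exact: continuous_enormB.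
exists (r + enorm x); split; first exact: num_real.
move=> M Mr v /= vr; apply: le_trans (norm_le_enorm _) _.
rewrite (le_trans _ (ltW Mr))//.
by have := ler_enormD (v - x) x; rewrite subrK => /le_trans; apply; rewrite lerD2r.
Qed.

Lemma compact_esphere (x : 'rV[R]_n) r : compact [set v | enorm (v - x) = r].
Proof.
apply: subclosed_compact (@compact_eball x r) _ => [|v /= ->//].
rewrite (_ : mkset _ = (fun v => enorm (v - x)) @^-1` [set t | t = r])//.
by apply: closed_comp (@closed_eq _ r) => v _; exact: continuous_enormB.
Qed.

Lemma enorm_rot (Q : 'M[R]_n) u : Q *m Q^T = 1%:M -> enorm (u *m Q) = enorm u.
Proof.
move=> QQ; rewrite !enormE !dotE trmx_mul mulmxA -(mulmxA u) QQ mulmx1//.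
Qed.

Lemma enorm_delta i : enorm (delta_mx 0 i : 'rV[R]_n) = 1.
Proof. by rewrite enormE dot_delta mxE !eqxx sqrtr1. Qed.

End euclid.

(** Cyclicity of the trace. For the matrix of tangent vectors, [M^T *m M] is the first fundamental
    form, so inequalities summed over the coordinate directions become traces on the tangent
    space. *)
Lemma sum_dot_mulmx {R : realType} {m n : nat} (M : 'M[R]_(m, n)) (A : 'M[R]_n) :
  \sum_i dot (row i M *m A) (row i M) = \tr (M^T *m M *m A).
Proof.
rewrite -mulmxA mxtrace_mulC /mxtrace; apply: eq_bigr => i _.
rewrite dotE [in RHS]mxE mxE; apply: eq_bigr => j _.
by rewrite !mxE; congr (_ * _); apply: eq_bigr => k _; rewrite mxE.
Qed.

(** * Second order expansions *)

Lemma is_derive_cvgP {R : realType} {V : normedModType R} (f : V -> R) (x v : V) l :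
  is_derive x v f l <-> (fun h => h^-1 * (f (h *: v + x) - f x)) @ 0^' --> l.
Proof.
split=> [[fd <-]|fl]; first exact: fd.
by split; [apply/cvg_ex; exists l|apply/cvg_lim].
Qed.
Lemma is_derive1_cvgP {R : realType} (f : R -> R) (x l : R) :
  is_derive x 1 f l <-> (fun h => (f (x + h) - f x) / h) @ 0^' --> l.
Proof.
rewrite (_ : (fun h => (f (x + h) - f x) / h) =
    (fun h => h^-1 * (f (h *: (1 : R) + x) - f x))).
  exact: is_derive_cvgP.
by apply/funext => h; rewrite mulrC /GRing.scale/= mulr1 (addrC x).
Qed.

Lemma is_derive_line {R : realType} {V : normedModType R} (f : V -> R) x v (t l : R) :
  is_derive (x + t *: v) v f l <-> is_derive t 1 (fun s => f (x + s *: v)) l.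
Proof.
rewrite is_derive1_cvgP is_derive_cvgP.
rewrite (_ : (fun h => (f (x + (t + h) *: v) - f (x + t *: v)) / h) =
    (fun h => h^-1 * (f (h *: v + (x + t *: v)) - f (x + t *: v))))//.
by apply/funext => h; rewrite mulrC scalerDl addrA [in LHS]addrC (addrC (h *: v)).
Qed.

(** Mean value theorem between 0 and [t] for either sign of [t], which is what two-sided limits at 0
    require. *)
Lemma is_derive_mvt {R : realType} (k dk : R -> R) (t : R) :
  (forall s : R, `|s| <= `|t| -> is_derive s 1 k (dk s)) ->
  exists2 s, `|s| <= `|t| & k t - k 0 = dk s * t.
Proof.
move=> kd; have kc (a b : R) : (forall s, s \in `[a, b] -> `|s| <= `|t|) ->
    {within `[a, b], continuous k}.
  by move=> ab; apply: derivable_within_continuous => s /ab /kd[].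
have [t0|t0|->] := ltgtP t 0; last first.
- by exists 0 => //; rewrite subrr mulr0.
- have st s : s \in `[0, t] -> `|s| <= `|t|.
    by rewrite in_itv/= => /andP[s0 st]; rewrite !ger0_norm// ltW.
  have [||c ct ->] := @MVT _ k dk 0 t t0.
  + by move=> s s0t; apply/kd/st; exact: subset_itv_oo_cc.
  + exact: kc.
  + by exists c; [apply/st; exact: subset_itv_oo_cc|rewrite subr0].
- have st s : s \in `[t, 0] -> `|s| <= `|t|.
    by rewrite in_itv/= => /andP[s0 st]; rewrite !ler0_norm ?lerN2// ltW.
  have [||c ct H] := @MVT _ k dk t 0 t0.
  + by move=> s s0t; apply/kd/st; exact: subset_itv_oo_cc.
  + exact: kc.
  + exists c; first by apply/st; exact: subset_itv_oo_cc.
    by rewrite -opprB H sub0r mulrN opprK.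
Qed.

Section peano.
Context {R : realType}.
Implicit Types (g h : R -> R) (d c e : R).

(* g(t) = g(0) + d t + c t^2 / 2 + o(t^2) as t tends to 0; unlike second
   derivatives, such expansions can be compared along one-sided barriers. *)
Definition peano2 g d c : Prop :=
  (fun t => (g t - g 0 - d * t) / t ^+ 2) @ 0^' --> c / 2.

Lemma near0N0 : \forall t \near (0 : R)^', t != 0.
Proof. exact: nbhs_dnbhs_neq. Qed.

Lemma cvg_dnbhs0 : (fun t : R => t) @ 0^' --> (0 : R).
Proof. exact/cvg_within. Qed.

Lemma eq_near_cvg g h l : (\forall t \near 0^', g t = h t) ->
  g @ 0^' --> l -> h @ (0 : R)^' --> (l : R).
Proof. by move=> gh gl; apply: cvg_trans gl; exact: near_eq_cvg. Qed.

Lemma cvgD0 g h l l' : g @ (0 : R)^' --> (l : R) -> h @ (0 : R)^' --> (l' : R) ->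
  (fun t => g t + h t) @ (0 : R)^' --> l + l'.
Proof. by move=> gl hl; apply: cvgD. Qed.

Lemma cvg_dnbhs0_sum (I : finType) (f : I -> R -> R) (l : I -> R) :
  (forall i, f i @ (0 : R)^' --> l i) ->
  (fun t => \sum_i f i t) @ (0 : R)^' --> \sum_i l i.
Proof.
move=> fl; elim: (index_enum I) => [|i s IHs].
  by rewrite big_nil; under eq_fun do rewrite big_nil; exact: cvg_cst.
by rewrite big_cons; under eq_fun do rewrite big_cons; exact: cvgD0.
Qed.

Lemma peano2_slope g d c : peano2 g d c ->
  (fun t => (g t - g 0) / t) @ 0^' --> d.
Proof.
move=> gp; have : (fun t => d + t * ((g t - g 0 - d * t) / t ^+ 2)) @ 0^' -->
    d + 0 * (c / 2).
  by apply: cvgD; [exact: cvg_cst|apply: cvgM => //; exact: cvg_dnbhs0].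
rewrite mul0r addr0; apply: eq_near_cvg.
near=> t; have t0 : t != 0 by near: t; exact: near0N0.
by field.
Unshelve. all: by end_near. Qed.

Lemma peano2_cst a : peano2 (cst a) 0 0.
Proof.
rewrite /peano2 mul0r; under eq_fun do rewrite subrr mul0r subrr mul0r.
exact: cvg_cst.
Qed.

Lemma peano2_id : peano2 id 1 0.
Proof.
rewrite /peano2 mul0r; under eq_fun do rewrite subr0 mul1r subrr mul0r.
exact: cvg_cst.
Qed.

Lemma eq_peano2 g h d c : g =1 h -> peano2 g d c -> peano2 h d c.
Proof. by move=> /funext ->. Qed.

Lemma eq_peano2_coef g d c d' c' : d = d' -> c = c' ->
  peano2 g d c -> peano2 g d' c'.
Proof. by move=> -> ->. Qed.

Lemma peano2D g h d c d' c' : peano2 g d c -> peano2 h d' c' ->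
  peano2 (fun t => g t + h t) (d + d') (c + c').
Proof.
move=> gp hp; rewrite /peano2 mulrDl; have := cvgD0 gp hp.
by apply: eq_near_cvg; apply: nearW => t /=; rewrite -mulrDl; congr (_ / _); ring.
Qed.

Lemma peano2M g h d c d' c' : peano2 g d c -> peano2 h d' c' ->
  peano2 (fun t => g t * h t) (g 0 * d' + d * h 0)
    (g 0 * c' + 2 * d * d' + c * h 0).
Proof.
move=> gp hp; rewrite /peano2.
rewrite (_ : _ / 2 = g 0 * (c' / 2) + h 0 * (c / 2) + d * d'); last by field.
have : (fun t => g 0 * ((h t - h 0 - d' * t) / t ^+ 2) +
    h 0 * ((g t - g 0 - d * t) / t ^+ 2) + ((g t - g 0) / t) * ((h t - h 0) / t))
    @ 0^' --> g 0 * (c' / 2) + h 0 * (c / 2) + d * d'.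
  apply: cvgD; last by apply: cvgM; [exact: peano2_slope gp|exact: peano2_slope hp].
  by apply: cvgD; apply: cvgM => //; exact: cvg_cst.
apply: eq_near_cvg; near=> t; have t0 : t != 0 by near: t; exact: near0N0.
by field.
Unshelve. all: by end_near. Qed.

Lemma peano2Z a g d c : peano2 g d c -> peano2 (fun t => a * g t) (a * d) (a * c).
Proof.
move=> gp; have := peano2M (peano2_cst a) gp.
by apply: eq_peano2_coef; rewrite /=; ring.
Qed.

Lemma peano2N g d c : peano2 g d c -> peano2 (fun t => - g t) (- d) (- c).
Proof.
move=> gp; have {}gp := peano2Z (a := -1) gp; rewrite -(mulN1r d) -(mulN1r c).
by apply: eq_peano2 gp => t; rewrite mulN1r.
Qed.

Lemma peano2B g h d c d' c' : peano2 g d c -> peano2 h d' c' ->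
  peano2 (fun t => g t - h t) (d - d') (c - c').
Proof. by move=> gp /peano2N; exact: peano2D. Qed.

Lemma peano2_sqr g d c : peano2 g d c ->
  peano2 (fun t => g t ^+ 2) (2 * g 0 * d) (2 * d ^+ 2 + 2 * g 0 * c).
Proof.
move=> gp; have := peano2M gp gp; under [X in peano2 X]eq_fun do rewrite -expr2.
by apply: eq_peano2_coef; ring.
Qed.

Lemma peano2_cvg g d c : peano2 g d c -> g @ 0^' --> g 0.
Proof.
move=> /peano2_slope gp.
have : (fun t => g 0 + t * ((g t - g 0) / t)) @ 0^' --> g 0 + 0 * d.
  by apply: cvgD; [exact: cvg_cst|apply: cvgM => //; exact: cvg_dnbhs0].
rewrite mul0r addr0; apply: eq_near_cvg; near=> t.
have t0 : t != 0 by near: t; exact: near0N0.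
by field.
Unshelve. all: by end_near. Qed.

Lemma peano2_sqrt g d c : 0 < g 0 -> peano2 g d c ->
  peano2 (fun t => Num.sqrt (g t)) (d / (2 * Num.sqrt (g 0)))
    (c / (2 * Num.sqrt (g 0)) - d ^+ 2 / (4 * Num.sqrt (g 0) ^+ 3)).
Proof.
move=> g0 gp; set s := Num.sqrt (g 0).
have s0 : 0 < s by rewrite sqrtr_gt0.
have s0' : s != 0 by rewrite gt_eqF.
have sg : (fun t => Num.sqrt (g t)) @ 0^' --> s.
  apply: continuous_cvg; last exact: peano2_cvg gp.
  exact: sqrt_continuous.
rewrite /peano2 -/s.
(* With [r = Num.sqrt (g t)], [r - s] equals [(g t - g 0) / (2 s) - (g t - g 0)^2 / (2 s (r +
   s)^2)]; only the expansion of [g] and its slope remain. *)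
have : (fun t => (g t - g 0 - d * t) / t ^+ 2 / (2 * s) -
    ((g t - g 0) / t) ^+ 2 / (2 * s * (Num.sqrt (g t) + s) ^+ 2)) @ 0^' -->
    c / 2 / (2 * s) - d ^+ 2 / (2 * s * (s + s) ^+ 2).
  apply: cvgB; first by apply: cvgM => //; exact: cvg_cst.
  apply: cvgM.
    by rewrite expr2; under eq_fun do rewrite expr2; apply: cvgM; exact: peano2_slope gp.
  apply: cvgV; first by rewrite mulf_neq0 ?expf_neq0 ?mulf_neq0// gt_eqF// addr_gt0.
  apply: cvgM; first exact: cvg_cst.
  rewrite expr2; under eq_fun do rewrite expr2.
  by apply: cvgM; apply: cvgD => //; exact: cvg_cst.
rewrite (_ : _ / _ / _ - _ = (c / (2 * s) - d ^+ 2 / (4 * s ^+ 3)) / 2); last first.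
  have ss : s + s != 0 by rewrite gt_eqF// addr_gt0.
  by field; rewrite s0' ss.
apply: eq_near_cvg; near=> t.
have t0 : t != 0 by near: t; exact: near0N0.
have gt0 : 0 < g t by near: t; apply: (cvgr_gt (g 0)) g0; exact: peano2_cvg gp.
have st : Num.sqrt (g t) + s != 0 by rewrite gt_eqF// addr_gt0// sqrtr_gt0.
have gtE := sqr_sqrtr (ltW gt0); have g0E := sqr_sqrtr (ltW g0).
rewrite -/s in g0E; rewrite -g0E; move: st gtE; set r := Num.sqrt (g t) => rs <-.
by field; rewrite s0' t0 rs.
Unshelve. all: by end_near. Qed.

Lemma near_dnbhs0_pos (P : set R) : (\forall t \near 0^', P t) ->
  exists2 t, 0 < t & P t.
Proof.
move=> /= /nbhs_normP[r /= r0 rP]; exists (r / 2); first by rewrite divr_gt0.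
apply: rP => /=; last by rewrite gt_eqF// divr_gt0.
rewrite sub0r normrN gtr0_norm ?divr_gt0//; lra.
Qed.

Lemma near_dnbhs0N (P : set R) : (\forall t \near 0^', P t) ->
  \forall t \near (0 : R)^', P (- t).
Proof.
move=> /= /nbhs_normP[r /= r0 rP]; apply/nbhs_normP; exists r => //= t.
by rewrite /= !sub0r normrN => tr t0; apply: rP; rewrite /= ?oppr_eq0// sub0r opprK.
Qed.

Lemma cvg_dnbhs0N g l : g @ 0^' --> l -> (fun t => g (- t)) @ 0^' --> (l : R).
Proof. by move=> gl A /gl; exact: near_dnbhs0N. Qed.

Lemma peano2_ge0 k d c : k 0 = 0 -> (\forall t \near 0, 0 <= k t) ->
  peano2 k d c -> d = 0 /\ 0 <= c.
Proof.
move=> k0 kge kp.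
have {}kge : \forall t \near 0^', 0 <= k t by exact: nbhs_dnbhs.
have sl := peano2_slope kp; rewrite k0 in sl.
have d0 : d = 0.
  have [d0|d0|//] := ltgtP d 0.
    have : \forall t \near 0^', (k t - 0) / t < 0 by exact: (cvgr_lt d).
    move=> /(filterI kge) /near_dnbhs0_pos[t t0 [kt]]; rewrite subr0.
    by rewrite pmulr_llt0 ?invr_gt0// ltNge kt.
  have : \forall t \near 0^', 0 < (k t - 0) / t by exact: (cvgr_gt d).
  move=> /(filterI kge) /near_dnbhs0N /near_dnbhs0_pos[t t0 [kt]]; rewrite subr0.
  by rewrite invrN mulrN oppr_gt0 pmulr_llt0 ?invr_gt0// ltNge kt.
split=> //; rewrite leNgt; apply/negP => c0.
have c20 : c / 2 < 0 by rewrite pmulr_llt0.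
have H : \forall t \near 0^', (k t - k 0 - d * t) / t ^+ 2 < 0.
  exact: (cvgr_lt (c / 2)).
rewrite k0 d0 in H.
have [t t0 [kt]] := near_dnbhs0_pos (filterI kge H).
by rewrite mul0r !subr0 pmulr_llt0 ?invr_gt0 ?exprn_gt0// ltNge kt.
Qed.

(** First and second derivative tests at a touching point: [g] will be the squared distance along a
    line and [h] a barrier above it. *)
Lemma peano2_le g h d c d' c' : g 0 = h 0 -> (\forall t \near 0, g t <= h t) ->
  peano2 g d c -> peano2 h d' c' -> d = d' /\ c <= c'.
Proof.
move=> gh0 gh gp hp.
have [|||d0 c0] := @peano2_ge0 (fun t => h t - g t) (d' - d) (c' - c).
- by rewrite gh0 subrr.
- by apply: filterS gh => t; rewrite subr_ge0.
- exact: peano2B.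
- by split; [apply/esym/eqP; rewrite -subr_eq0 d0|rewrite -subr_ge0].
Qed.

Lemma peano2_second_difference g d c : peano2 g d c ->
  (fun t => (g t + g (- t) - 2 * g 0) / t ^+ 2) @ 0^' --> c.
Proof.
move=> gp; have := cvgD0 gp (cvg_dnbhs0N gp).
rewrite (_ : c / 2 + c / 2 = c); last by field.
apply: eq_near_cvg; near=> t.
have t0 : t != 0 by near: t; exact: near0N0.
by rewrite /=; field.
Unshelve. all: by end_near. Qed.

(** Taylor's formula with Peano remainder, by the mean value theorem for [g] minus its quadratic
    part. Differentiability of [dg] at 0 is the form available for the distance, whose second
    derivatives are obtained point by point. *)
Lemma peano2_derive g (dg : R -> R) c :
  (\forall t \near (0 : R), is_derive (t : R) 1 g (dg t)) ->
  is_derive (0 : R) 1 dg c -> peano2 g (dg 0) c.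
Proof.
move=> gd /is_derive1_cvgP dgc; apply/cvgrPdist_le => e e0.
have : \forall t \near 0^', `|c - (dg (0 + t) - dg 0) / t| <= e.
  by move/cvgrPdist_le : dgc => /(_ e e0).
move=> /= /nbhs_normP[r /= r0 rP].
move/nbhs_normP : gd => [r' /= r'0 r'P].
near=> t.
have t0 : t != 0 by near: t; exact: near0N0.
have tr : `|t| < r.
  near: t; apply: nbhs_dnbhs; apply/nbhs_normP; exists r => //= s.
  by rewrite /= sub0r normrN.
have tr' : `|t| < r'.
  near: t; apply: nbhs_dnbhs; apply/nbhs_normP; exists r' => //= s.
  by rewrite /= sub0r normrN.
pose k s := g s - dg 0 * s - c / 2 * s ^+ 2.
have [|s st] := @is_derive_mvt _ k (fun s => dg s - dg 0 - c * s) t.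
  move=> s st.
  have gs : is_derive s 1 g (dg s).
    by apply: r'P; rewrite /= sub0r normrN (le_lt_trans st).
  by apply: is_derive_eq; rewrite /GRing.scale/=; field.
rewrite /k expr0n /= !mulr0 !subr0 => H.
rewrite [X in `|X|](_ : _ = - ((dg s - dg 0 - c * s) / t)); last first.
  by rewrite -[dg s - _ - _](mulfK t0) -H; field.
rewrite normrN normrM normfV ler_pdivrMr ?normr_gt0//.
have [->|s0] := eqVneq s 0.
  by rewrite subrr mulr0 subrr normr0 mulr_ge0// ltW.
have /rP : ball_ Num.norm 0 r s by rewrite /= sub0r normrN (le_lt_trans st).
move=> /(_ s0); rewrite add0r => H2.
rewrite (_ : _ - c * s = - s * (c - (dg s - dg 0) / s)); last by field.
rewrite normrM normrN mulrC ler_pM//.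
Unshelve. all: by end_near. Qed.

End peano.

(** * Strict differentiability of C^1 functions and symmetry of the hessian *)

Section strict_differentiability.
Context {R : realType} {n : nat}.
Implicit Types (f : 'rV[R]_n -> R) (x p q w : 'rV[R]_n).

Lemma Ck2W f : Ck 2 f -> Ck 1 f.
Proof. by move=> [cf df]; split=> // i; have [? []] := df i. Qed.

Lemma Ck2_partial f i : Ck 2 f -> Ck 1 (partial f i).
Proof. by move=> [_ /(_ i)[]]. Qed.

Lemma Ck1_is_derive f x i : Ck 1 f -> is_derive x (delta_mx 0 i) f (partial f i x).
Proof. by move=> [_ /(_ i)[df _]]; apply: DeriveDef => //; exact: df. Qed.

(** Going from [p] to [q] one coordinate at a time, each step is a mean value along an axis, and
    continuity of the partial derivatives controls the error. *)
Lemma Ck1_strict f x e : Ck 1 f -> 0 < e ->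
  exists2 r, 0 < r & forall p q, enorm (p - x) < r -> enorm (q - x) < r ->
    `|f q - f p - dot (gradient f x) (q - p)| <= e * enorm (q - p).
Proof.
move=> f1 e0; pose e' := e / n.+1%:R.
have e'0 : 0 < e' by rewrite divr_gt0.
have [r r0 rP] : exists2 r, 0 < r & forall y, `|y - x| < r ->
    forall i, `|partial f i y - partial f i x| <= e'.
  have : \forall y \near x, forall i, `|partial f i y - partial f i x| <= e'.
    apply: (@filter_forall _ _ (fun i y => `|partial f i y - partial f i x| <= e') (nbhs x)) => i; have [_ /(_ i)[_ /(_ x)]] := f1.
    move=> /cvgrPdist_le /(_ _ e'0).
    by apply: filterS => y; rewrite distrC.
  move=> /nbhs_ballP[r /= r0 rP]; exists r => // y yr; apply: rP.
  by rewrite -ball_normE /= distrC.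
(* In the coordinate being changed, an intermediate point is off by at most
   [|p_i - x_i| + |q_i - p_i|], that is, by less than three times this radius. *)
exists (r / 3); first by rewrite divr_gt0.
move=> p q pr qr.
pose P (s : seq 'I_n) : 'rV[R]_n := \row_j (if j \in s then q 0 j else p 0 j).
have close (y : 'rV[R]_n) : (forall j, `|y 0 j - x 0 j| < r) -> `|y - x| < r.
  move=> yx; rewrite {1}/Num.norm/= mx_normrE; apply: bigmax_lt => //=.
  by move=> [i j] _; rewrite (ord1 i) !mxE yx.
have pj j : `|p 0 j - x 0 j| < r / 3.
  by apply: le_lt_trans pr; have := coord_enorm (p - x) j; rewrite !mxE.
have qj j : `|q 0 j - x 0 j| < r / 3.
  by apply: le_lt_trans qr; have := coord_enorm (q - x) j; rewrite !mxE.
have H s : uniq s ->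
    `|f (P s) - f p - \sum_(j <- s) partial f j x * (q 0 j - p 0 j)|
    <= e' * \sum_(j <- s) `|q 0 j - p 0 j|.
  elim: s => [_|i s IHs].
    rewrite !big_nil (_ : P _ = p) ?subrr ?subr0 ?normr0 ?mulr0//.
    by apply/rowP => j; rewrite mxE.
  move=> /= /andP[si us]; rewrite !big_cons.
  pose t := q 0 i - p 0 i.
  have PE : P (i :: s) = P s + t *: delta_mx 0 i.
    apply/rowP => j; rewrite !mxE eqxx/= in_cons.
    have [->|ji] := eqVneq j i; last by rewrite mulr0 addr0.
    by rewrite (negbTE si) mulr1 addrC subrK.
  have [|u ut] := @is_derive_mvt R (fun s' => f (P s + s' *: delta_mx 0 i))
      (fun s' => partial f i (P s + s' *: delta_mx 0 i)) t.
    move=> s' _; apply: (proj1 (is_derive_line f (P s) (delta_mx 0 i) s' _)).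
    exact: Ck1_is_derive.
  rewrite -PE scale0r addr0 => fE.
  have ux : `|P s + u *: delta_mx 0 i - x| < r.
    apply: close => j; rewrite !mxE eqxx/=.
    move: (pj j) (qj j) ut; rewrite /t.
    have [<-{i t PE fE si} pr' qr' ut|ji pr' qr' _] := eqVneq j i; last first.
      by rewrite mulr0 addr0; case: ifP; lra.
    rewrite mulr1; have := ler_normD (q 0 j - x 0 j) (x 0 j - p 0 j).
    rewrite addrA subrK (distrC (x 0 j)) => H.
    case: ifP => _; rewrite addrAC.
      have := ler_normD (q 0 j - x 0 j) u; lra.
    have := ler_normD (p 0 j - x 0 j) u; lra.
  rewrite (_ : _ - _ - _ = (f (P s) - f p -
      \sum_(j <- s) partial f j x * (q 0 j - p 0 j)) +
      (partial f i (P s + u *: delta_mx 0 i) - partial f i x) * t); last first.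
    by rewrite mulrBl -fE /t; ring.
  rewrite (le_trans (ler_normD _ _))// [leRHS]mulrDr [leRHS]addrC lerD ?IHs//.
  by rewrite normrM ler_wpM2r// rP.
have := H (enum 'I_n) (enum_uniq _).
rewrite (_ : P _ = q); last by apply/rowP => j; rewrite mxE mem_enum.
rewrite !big_enum/= (_ : \sum_(i < n) partial f i x * _ =
    dot (gradient f x) (q - p)); last first.
  by apply: eq_bigr => i _; rewrite !mxE.
move=> /le_trans; apply; rewrite /e' mulrAC ler_pdivrMr// -mulrA ler_pM2l//.
apply: (@le_trans _ _ (\sum_(j < n) enorm (q - p))).
  by apply: ler_sum => j _; have := coord_enorm (q - p) j; rewrite !mxE.
rewrite sumr_const card_ord mulr_natr.
by rewrite mulrSr lerDl enorm_ge0.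
Qed.

Lemma Ck1_is_derive_dir f x w : Ck 1 f ->
  is_derive x w f (dot (gradient f x) w).
Proof.
move=> f1; apply/is_derive_cvgP/cvgrPdist_le => e e0.
pose D := enorm w + 1.
have D0 : 0 < D by rewrite ltr_wpDl ?enorm_ge0.
have [r r0 rP] := Ck1_strict x f1 (divr_gt0 e0 D0).
near=> t.
have t0 : t != 0 by near: t; exact: near0N0.
have tr : `|t| * D < r.
  rewrite -ltr_pdivlMr//; near: t; apply: nbhs_dnbhs; apply/nbhs_normP.
  exists (r / D) => /=; first by rewrite divr_gt0.
  by move=> s; rewrite /= sub0r normrN.
have xr : enorm (t *: w + x - x) < r.
  by rewrite addrK enormZ (le_lt_trans _ tr)// ler_wpM2l// lerDl.
have := rP x (t *: w + x) _ xr; rewrite subrr enorm0 => /(_ r0).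
rewrite addrK dotZr enormZ distrC => H.
rewrite (_ : _ - _ = t^-1 * (t * dot (gradient f x) w - (f (t *: w + x) - f x))); last first.
  by field.
rewrite normrM normfV mulrC ler_pdivrMr ?normr_gt0//.
rewrite (le_trans H)// mulrAC ler_pdivrMr// -mulrA ler_pM2l// ler_wpM2l//.
by rewrite lerDl.
Unshelve. all: by end_near. Qed.

Lemma Ck2_peano2 f x w : Ck 2 f ->
  peano2 (fun t => f (x + t *: w)) (dot (gradient f x) w)
    (dot (w *m hessian f x) w).
Proof.
move=> f2; have f1 := Ck2W f2.
have := @peano2_derive R (fun t => f (x + t *: w))
  (fun t => dot (gradient f (x + t *: w)) w) (dot (w *m hessian f x) w).
rewrite scale0r addr0; apply.
  apply: filterE => t; apply: (proj1 (is_derive_line f x w t _)).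
  exact: Ck1_is_derive_dir.
have : is_derive (0 : R) 1
    (\sum_(i < n) (fun t : R => w 0 i * partial f i (x + t *: w)))
    (\sum_i w 0 i * dot (gradient (partial f i) x) w).
  apply: is_derive_sum => i; apply: is_deriveZ; apply: (proj1 (is_derive_line (partial f i) x w 0 _)).
  by rewrite scale0r addr0; apply/Ck1_is_derive_dir/Ck2_partial.
congr (is_derive _ _ _ _).
  apply/funext => t; rewrite fct_sumE; apply: eq_bigr => i _.
  by rewrite mxE mulrC.
rewrite /dot; under eq_bigr do rewrite big_distrr/=.
rewrite exchange_big; apply: eq_bigr => i _ /=.
rewrite mxE big_distrl/=; apply: eq_bigr => j _.
by rewrite !mxE mulrA.
Qed.

(** The mixed second difference is symmetric in the two directions. Divided by [t ^+ 2] it is close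
    to either mixed derivative: one mean value in the direction [k], then strict differentiability
    of [partial f k]. *)
Lemma hessian_sym f x : Ck 2 f -> (hessian f x)^T = hessian f x.
Proof.
move=> f2; have f1 := Ck2W f2.
suff H i j e : 0 < e -> partial (partial f i) j x - partial (partial f j) i x <= e.
  apply/matrixP => i j; rewrite !mxE; apply/eqP; rewrite eq_le.
  have {}H i' j' : partial (partial f i') j' x <= partial (partial f j') i' x.
    by apply/ler_addgt0Pr => e e0; rewrite -lerBlDl; exact: H.
  by apply/andP; split; exact: H.
move=> e0.
pose ei k : 'rV[R]_n := delta_mx 0 k.
have Dd k l : exists2 r, 0 < r & forall t, 0 < t < r -> 
   `|(f (x + t *: ei k + t *: ei l) - f (x + t *: ei k) - f (x + t *: ei l) + f x)
    / t ^+ 2 - partial (partial f k) l x| <= e / 2.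
  have [r r0 rP] := Ck1_strict x (Ck2_partial k f2) (divr_gt0 e0 (ltr0Sn _ 1)).
  exists (r / 2) => [|t /andP[t0 tr]]; first by rewrite divr_gt0.
  have [|s st] := @is_derive_mvt R
     (fun s => f (x + t *: ei l + s *: ei k) - f (x + s *: ei k))
     (fun s => partial f k (x + t *: ei l + s *: ei k) - partial f k (x + s *: ei k)) t.
    move=> s _; apply: is_deriveB.
      exact/(proj1 (is_derive_line f _ (ei k) s _))/Ck1_is_derive.
    exact/(proj1 (is_derive_line f x (ei k) s _))/Ck1_is_derive.
  rewrite !scale0r !addr0 => H.
  rewrite (addrAC x (t *: ei k)) (_ : _ - _ - _ + _ =
     (partial f k (x + t *: ei l + s *: ei k) - partial f k (x + s *: ei k)) * t); last first.
    by rewrite -H; ring.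
  have sE : enorm (s *: ei k) <= t by rewrite enormZ enorm_delta mulr1 -(gtr0_norm t0).
  have tE : enorm (t *: ei l) = t by rewrite enormZ enorm_delta mulr1 gtr0_norm.
  have := rP (x + s *: ei k) (x + t *: ei l + s *: ei k).
  have -> : x + t *: ei l + s *: ei k - (x + s *: ei k) = t *: ei l.
    by rewrite (addrAC x (t *: ei l)) [LHS]addrC addKr.
  rewrite tE dotZr dot_delta mxE => H2.
  rewrite (_ : _ / t ^+ 2 - _ = (partial f k (x + t *: ei l + s *: ei k) -
    partial f k (x + s *: ei k) - t * partial (partial f k) l x) / t); last first.
    by field; rewrite gt_eqF.
  rewrite normrM normfV (gtr0_norm t0) ler_pdivrMr//.
  apply: H2 => //.
  - by rewrite addrC addKr (le_lt_trans sE)//; lra.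
  - rewrite -(addrA x) [_ - x]addrC addKr (le_lt_trans (ler_enormD _ _))// tE.
    by move: sE tr; lra.
have [r r0 rP] := Dd i j; have [r' r'0 r'P] := Dd j i.
pose t := Num.min r r' / 2.
have m0 : 0 < Num.min r r' by rewrite lt_min r0.
have t0 : 0 < t by rewrite divr_gt0.
have tm : t < Num.min r r' by rewrite /t; lra.
move: tm; rewrite lt_min => /andP[tr tr'].
have := rP t; have := r'P t; rewrite t0 tr tr' => /(_ isT) + /(_ isT).
rewrite (addrAC x (t *: ei j)) (addrAC (f _) (- f (x + t *: ei j))).
move: (_ / t ^+ 2) (partial (partial f i) j x) (partial (partial f j) i x).
by move=> a b c; rewrite !ler_norml => /andP[? ?] /andP[? ?]; lra.
Qed.

End strict_differentiability.

(** * The distance to the complement *)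

Lemma enorm_sqrD {R : realType} {n : nat} (u v : 'rV[R]_n) :
  enorm (u + v) ^+ 2 = enorm u ^+ 2 + 2 * dot u v + enorm v ^+ 2.
Proof. by rewrite !enorm_sqr dotDl !dotDr (dotC v u); ring. Qed.

(** Equality case of the triangle inequality: squaring gives [|a| |b| <= dot a b], hence
    [| |b| a - |a| b |^2 <= 0]. It is the source of all alignment statements about feet. *)
Lemma triangle_eq {R : realType} {n : nat} (a b : 'rV[R]_n) :
  enorm a + enorm b <= enorm (a + b) -> enorm b *: a = enorm a *: b.
Proof.
move=> ab; apply/eqP; rewrite -subr_eq0 -dot_eq0 eq_le dot_ge0 andbT.
rewrite !(dotBl, dotBr, dotZl, dotZr) (dotC b a) -!enorm_sqr.
have : (enorm a + enorm b) ^+ 2 <= enorm (a + b) ^+ 2.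
  by rewrite ler_sqr ?nnegrE ?addr_ge0 ?enorm_ge0.
rewrite enorm_sqr dotDl !dotDr (dotC b a) -!enorm_sqr sqrrD => H.
have {}H : enorm a * enorm b <= dot a b by move: H; lra.
have := ler_wpM2l (mulr_ge0 (enorm_ge0 a) (enorm_ge0 b)) H.
lra.
Qed.

Section boundary_distance.
Context {R : realType} {n : nat} {Omega : set 'rV[R]_n}.
Hypothesis openO : open Omega.
Hypothesis compl0 : ~` Omega !=set0.
Implicit Types (x y z v : 'rV[R]_n).
Local Notation delta := (bdist Omega).

(** Nearest points are sought in the complement, as in [bdist], which makes sense at every [x];
    inside [Omega] they are the nearest points of the frontier. *)
Definition foot x y : Prop := ~ Omega y /\ enorm (x - y) = delta x.

Lemma bdist_le x y : ~ Omega y -> delta x <= enorm (x - y).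
Proof.
move=> Oy; apply: ge_inf; last by exists y.
by exists 0 => _ [z _ <-]; exact: enorm_ge0.
Qed.

Lemma foot_exists x : exists y, foot x y.
Proof.
have [y0 Oy0] := compl0.
pose A := ~` Omega `&` [set y | enorm (y - x) <= enorm (y0 - x)].
have cA : compact A.
  apply: subclosed_compact (@compact_eball _ _ x (enorm (y0 - x))) _; last first.
    by move=> ? [].
  apply: closedI; first exact: open_closedC.
  exact: compact_closed (@compact_eball _ _ _ _).
have [||y Ay ymin] := @EVT_min_rV R n (fun y => enorm (y - x)) A _ cA.
- by exists y0; split => //=.
- exact/continuous_subspaceT/continuous_enormB.
have [Oy yy0] := set_mem Ay.
exists y; split => //; apply/eqP; rewrite eq_le bdist_le// andbT.
apply: lb_le_inf; first by exists (enorm (x - y0)), y0.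
move=> _ [z Oz <-]; rewrite enormBC (enormBC x).
have [zy0|/ltW zy0] := leP (enorm (z - x)) (enorm (y0 - x)).
  by apply: ymin; rewrite inE.
exact: le_trans zy0.
Qed.

Lemma bdist_ge0 x : 0 <= delta x.
Proof. by have [y [_ <-]] := foot_exists x; exact: enorm_ge0. Qed.

Lemma bdist_lipschitz x x' : delta x <= delta x' + enorm (x - x').
Proof.
have [y [Oy <-]] := foot_exists x'; rewrite (le_trans (bdist_le x Oy))// [leRHS]addrC.
exact: ler_enorm_sub.
Qed.

Lemma bdist_lipschitzN x x' : `|delta x - delta x'| <= enorm (x - x').
Proof.
have := bdist_lipschitz x x'; have := bdist_lipschitz x' x.
by rewrite (enormBC x' x) ler_norml; lra.
Qed.

Lemma bdist_continuous : continuous delta.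
Proof.
by apply: (@lipschitz_continuous _ _ _ 1) => x x'; rewrite mul1r bdist_lipschitzN.
Qed.

Lemma bdist_gt0 x : Omega x -> 0 < delta x.
Proof.
move=> Ox; rewrite lt_def bdist_ge0 andbT; have [y [Oy <-]] := foot_exists x.
by rewrite enorm_eq0 subr_eq0; apply/eqP => xy; rewrite -xy in Oy.
Qed.

Lemma bdist0 x : ~ Omega x -> delta x = 0.
Proof.
move=> Ox; apply/eqP; rewrite eq_le bdist_ge0 andbT.
by rewrite (le_trans (bdist_le x Ox))// subrr enorm0.
Qed.

Lemma frontierP y : frontier Omega y <-> closure Omega y /\ ~ Omega y.
Proof.
have -> : frontier Omega = closure Omega `\` Omega; last by [].
by rewrite /frontier; congr (_ `\` _); apply/interior_id.
Qed.

Lemma foot_segment x y (t : R) : foot x y -> 0 <= t <= 1 ->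
  foot (y + t *: (x - y)) y /\ delta (y + t *: (x - y)) = t * delta x.
Proof.
move=> [Oy xy] /andP[t0 t1].
suff E : delta (y + t *: (x - y)) = t * delta x.
  by split=> //; split=> //; rewrite addrC addKr enormZ xy ger0_norm// E.
apply/eqP; rewrite eq_le; apply/andP; split.
  by rewrite (le_trans (bdist_le _ Oy))// addrC addKr enormZ xy ger0_norm.
have := bdist_lipschitz x (y + t *: (x - y)).
rewrite opprD addrA -{2}[x - y]scale1r -scalerBl enormZ xy ger0_norm ?subr_ge0//.
lra.
Qed.

Lemma bdist_pos x : 0 < delta x -> Omega x.
Proof. by move=> d0; apply: contrapT => /bdist0 d1; rewrite d1 ltxx in d0. Qed.

Lemma foot_frontier x y : Omega x -> foot x y -> frontier Omega y.
Proof.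
move=> Ox xy; apply/frontierP; split; last by have [] := xy.
move=> B /nbhs_enormP[r r0 rB].
have d0 := bdist_gt0 Ox.
pose t := Num.min 1 (r / (2 * delta x)).
have t0 : 0 < t by rewrite lt_min ltr01 divr_gt0// mulr_gt0.
have t1 : t <= 1 by rewrite ge_min lexx.
have tr : t <= r / (2 * delta x) by rewrite ge_min lexx orbT.
exists (y + t *: (x - y)); split.
  apply: bdist_pos; have [] := foot_segment xy (t := t); first by rewrite ltW.
  by move=> _ ->; rewrite mulr_gt0.
apply: rB; rewrite addrC addKr enormZ (ger0_norm (ltW t0)) xy.2.
rewrite -ltr_pdivlMr// (le_lt_trans tr)// invfM mulrA ltr_pM2r ?invr_gt0//.
by rewrite ltr_pdivrMr// mulr_natr mulr2n ltrDl.
Qed.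

Lemma nearest_pointP x y : Omega x -> nearest_point Omega x y <-> foot x y.
Proof.
move=> Ox; split=> [[/frontierP[_ Oy] ymin]|xy].
  split=> //; apply/eqP; rewrite eq_le bdist_le// andbT.
  have [y' xy'] := foot_exists x; rewrite -xy'.2; apply: ymin.
  exact: foot_frontier xy'.
split; first exact: foot_frontier xy.
by move=> z /frontierP[_ Oz]; rewrite xy.2 bdist_le.
Qed.

(** A second foot [y'] of the inner point [z] could be reached from [x] through [z] within
    [delta x]. Hence [x], [z], [y'] are aligned, and [y'] sits on the ray where [y] does. *)
Lemma foot_segment_unique x y (t : R) y' : foot x y -> 0 <= t < 1 ->
  foot (y + t *: (x - y)) y' -> y' = y.
Proof.
move=> xy /andP[t0 t1].
have [|_] := foot_segment xy (t := t); first by rewrite t0 ltW.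
set z := y + _ => zt [Oy' zy'].
have xz : x - z = (1 - t) *: (x - y).
  by rewrite /z opprD addrA scalerBl scale1r.
have t1' : 0 < 1 - t by rewrite subr_gt0.
have exz : enorm (x - z) = (1 - t) * delta x.
  by rewrite xz enormZ xy.2 ger0_norm// ltW.
have := @triangle_eq _ _ (x - z) (z - y'); rewrite addrA subrK.
rewrite exz zy' zt xz scalerA => /(_ _).
have [d0|d0] := eqVneq (delta x) 0.
  move=> _; have /eqP := zy'; rewrite zt d0 mulr0 enorm_eq0 subr_eq0 => /eqP <-.
  have /eqP := xy.2; rewrite d0 enorm_eq0 /z => /eqP ->.
  by rewrite scaler0 addr0.
rewrite (_ : _ + _ = delta x) => [/(_ (bdist_le x Oy')) H|]; last by ring.
have {}H : t *: (x - y) = z - y'.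
  apply: (@scalerI _ _ ((1 - t) * delta x)); first by rewrite mulf_neq0// gt_eqF.
  by rewrite -H scalerA; congr (_ *: _); ring.
have := congr1 (fun u => z - u) H; rewrite opprB [RHS]addrC subrK => <-.
by rewrite /z addrK.
Qed.

(** Compactness: among complement points at distance at least [e] from [y], the least distance to
    [x] exceeds [delta x], and half of that gap absorbs a displacement of [x]. *)
Lemma foot_close x y e : (forall y', foot x y' -> y' = y) -> 0 < e ->
  exists2 r, 0 < r & forall x' y', enorm (x' - x) < r -> foot x' y' ->
    enorm (y' - y) < e.
Proof.
move=> xy e0.
(* Feet of points within 1 of [x] lie within [delta x + 2] of [x]; this bound makes [A] compact. *)
pose A := (~` Omega `&` [set y' | enorm (y' - x) <= delta x + 2]) `&`
  [set y' | e <= enorm (y' - y)].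
have cA : compact A.
  apply: subclosed_compact (@compact_eball _ _ x (delta x + 2)) _; last first.
    by move=> ? [[]].
  apply: closedI; last first.
    apply: closed_comp (@closed_ge _ e) => v _; exact: continuous_enormB.
  apply: closedI; first exact: open_closedC.
  exact: compact_closed (@compact_eball _ _ _ _).
have inA x' y' : enorm (x' - x) < 1 -> foot x' y' -> e <= enorm (y' - y) -> A y'.
  move=> xx' [Oy' x'y'] ey; split=> //; split=> //=.
  have := bdist_lipschitz x' x; have := ler_enorm_sub x' y' x.
  rewrite (enormBC y' x') x'y'; lra.
have [A0|A0] := pselect (A !=set0); last first.
  exists 1 => // x' y' xx' x'y'; rewrite ltNge; apply/negP => ey.
  by apply: A0; exists y'; exact: inA x'y' ey.
have [|y0 Ay0 ymin] := EVT_min_rV A0 cA (f := fun y' => enorm (y' - x)).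
  exact/continuous_subspaceT/continuous_enormB.
have [[Oy0 _] ey0] := set_mem Ay0.
have m0 : delta x < enorm (y0 - x).
  rewrite lt_def enormBC bdist_le// andbT; apply/eqP => E.
  move: ey0; rewrite /= (xy y0)// subrr enorm0 leNgt e0//.
exists (Num.min 1 ((enorm (y0 - x) - delta x) / 2)).
  by rewrite lt_min ltr01 divr_gt0// subr_gt0.
move=> x' y'; rewrite lt_min => /andP[xx'1 xx'] x'y'.
rewrite ltNge; apply/negP => ey.
have := ymin y'; rewrite inE => /(_ (inA _ _ xx'1 x'y' ey)).
have := bdist_lipschitz x' x; have := ler_enorm_sub x' y' x.
rewrite (enormBC y' x') x'y'.2; lra.
Qed.

(** A sandwich: [y] competes at the moved point, and the foot [y'] of the moved point competes at
    [x]. The two bounds differ to first order by [dot (y - y') v], and [y'] tends to [y] by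
    uniqueness. *)
Lemma is_derive_sqr_bdist x y v : foot x y -> (forall y', foot x y' -> y' = y) ->
  is_derive x v (fun x => delta x ^+ 2) (2 * dot (x - y) v).
Proof.
move=> xy xyU; apply/is_derive_cvgP/cvgrPdist_le => e e0.
pose N := enorm v + 1.
have N0 : 0 < N by rewrite ltr_wpDl ?enorm_ge0.
have vN : enorm v <= N by rewrite lerDl.
pose e' := e / (4 * N).
have e'0 : 0 < e' by rewrite divr_gt0// mulr_gt0.
have [r r0 rP] := foot_close xyU e'0.
near=> t.
have t0 : t != 0 by near: t; exact: near0N0.
have tr : `|t| < r / N.
  near: t; apply: nbhs_dnbhs; apply/nbhs_normP; exists (r / N) => /=.
    by rewrite divr_gt0.
  by move=> s; rewrite /= sub0r normrN.
have tr' : `|t| < e / (2 * N ^+ 2).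
  near: t; apply: nbhs_dnbhs; apply/nbhs_normP; exists (e / (2 * N ^+ 2)) => /=.
    by rewrite divr_gt0// mulr_gt0 ?exprn_gt0.
  by move=> s; rewrite /= sub0r normrN.
have [y' xty'] := foot_exists (t *: v + x).
have yy' : enorm (y' - y) < e'.
  apply: rP xty'; rewrite addrK enormZ.
  rewrite (@le_lt_trans _ _ (`|t| * N))// ?ler_wpM2l//.
  by rewrite -ltr_pdivlMr.
have upper : delta (t *: v + x) ^+ 2 <=
    delta x ^+ 2 + 2 * t * dot (x - y) v + t ^+ 2 * enorm v ^+ 2.
  have := bdist_le (t *: v + x) xy.1.
  rewrite -ler_sqr ?nnegrE ?bdist_ge0 ?enorm_ge0// => /le_trans; apply.
  rewrite -addrA addrC enorm_sqrD xy.2 dotZr enormZ exprMn real_normK ?num_real//.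
  by rewrite lerD2r lerD2l mulrA (mulrC 2).
have lower : delta x ^+ 2 + 2 * t * dot (x - y') v + t ^+ 2 * enorm v ^+ 2 <=
    delta (t *: v + x) ^+ 2.
  have := bdist_le x xty'.1.
  rewrite -ler_sqr ?nnegrE ?bdist_ge0 ?enorm_ge0// => H.
  rewrite -xty'.2 -(addrA (t *: v)) [t *: v + _]addrC enorm_sqrD dotZr enormZ exprMn.
  rewrite real_normK ?num_real//; move: H; move: (enorm _ ^+ 2) (_ ^+ 2 * _ ^+ 2) => a b.
  by move: (dot _ _) => c; lra.
have bnd : `|dot (y - y') v| <= e / 4.
  rewrite (le_trans (cauchy_schwarz _ _))// enormBC.
  rewrite (@le_trans _ _ (e' * N))//.
    by rewrite ler_pM ?enorm_ge0// ltW.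
  by rewrite /e' invfM mulrA mulfVK// gt_eqF.
have tv : `|t| * enorm v ^+ 2 <= e / 2.
  rewrite (@le_trans _ _ (`|t| * N ^+ 2))//.
    by rewrite ler_wpM2l// ler_sqr ?nnegrE ?enorm_ge0// ltW.
  rewrite -ler_pdivlMr ?exprn_gt0//; apply: ltW; apply: lt_le_trans tr' _.
  by rewrite invfM mulrA.
have dd : dot (x - y') v = dot (x - y) v + dot (y - y') v.
  by rewrite -dotDl addrA subrK.
rewrite dd in lower.
set D := delta (t *: v + x) ^+ 2 in upper lower *.
rewrite -(@ler_pM2r _ `|t|) ?normr_gt0// -normrM mulrBl.
rewrite (mulrC t^-1) mulfVK//.
have t2 : t ^+ 2 * enorm v ^+ 2 = `|t| * (`|t| * enorm v ^+ 2).
  by rewrite mulrA -expr2 real_normK ?num_real.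
rewrite t2 in upper lower.
have H1 := ler_wpM2l (normr_ge0 t) tv.
have H2 : `|t * dot (y - y') v| <= `|t| * (e / 4).
  by rewrite normrM ler_wpM2l.
have H3 : 0 <= `|t| * (`|t| * enorm v ^+ 2).
  by rewrite !mulr_ge0 ?exprn_ge0 ?enorm_ge0.
have H4 : 0 <= e * `|t| by rewrite mulr_ge0// ltW.
move: upper lower H1 H2 H3 H4 {bnd dd tv t2 tr tr' rP yy' xty'}.
move: (dot (x - y) v) (dot (y - y') v) (`|t| * enorm v ^+ 2) => a b c.
move: (delta x ^+ 2) D => d D; rewrite !ler_norml => ? ? ? /andP[? ?] ? ?.
by apply/andP; split; lra.
Unshelve. all: by end_near. Qed.

Lemma is_derive_bdist x y v : Omega x -> foot x y ->
  (forall y', foot x y' -> y' = y) ->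
  is_derive x v delta (dot (x - y) v / delta x).
Proof.
move=> Ox xy xyU; have d0 := bdist_gt0 Ox.
have /is_derive_cvgP H := is_derive_sqr_bdist v xy xyU.
apply/is_derive_cvgP.
have lc : (fun t => delta (t *: v + x)) @ 0^' --> delta x.
  apply/cvgrPdist_le => e e0; near=> t.
  rewrite (le_trans (bdist_lipschitzN _ _))// opprD addrCA subrr addr0.
  rewrite enormN enormZ.
  rewrite (@le_trans _ _ (`|t| * (enorm v + 1)))// ?ler_wpM2l ?lerDl//.
  rewrite -ler_pdivlMr ?ltr_wpDl ?enorm_ge0//; apply: ltW.
  near: t; apply: nbhs_dnbhs; apply/nbhs_normP.
  exists (e / (enorm v + 1)) => /=; first by rewrite divr_gt0 ?ltr_wpDl ?enorm_ge0.
  by move=> s; rewrite /= sub0r normrN.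
have : (fun t => (t^-1 * (delta (t *: v + x) ^+ 2 - delta x ^+ 2)) /
    (delta (t *: v + x) + delta x)) @ 0^' --> 2 * dot (x - y) v / (delta x + delta x).
  apply: cvgM => //; apply: cvgV; first by rewrite gt_eqF// addr_gt0.
  by apply: cvgD => //; exact: cvg_cst.
rewrite (_ : _ / (_ + _) = dot (x - y) v / delta x); last first.
  by rewrite -mulr2n -(mulr_natl (delta x)) -mulf_div divff// mul1r.
apply: eq_near_cvg; near=> t.
have : delta (t *: v + x) + delta x != 0.
  by rewrite gt_eqF// ltr_wpDl// bdist_ge0.
have t0 : t != 0 by near: t; exact: near0N0.
by move: (delta (t *: v + x)) => D D0; field; rewrite D0 t0.
Unshelve. all: by end_near. Qed.

(** Semiconcavity, at singular points too: one foot [y] of [x] competes at both [x + v] and [x - v],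
    and the first order terms cancel. *)
Lemma bdist_second_difference_le x v : Omega x ->
  delta (x + v) + delta (x - v) - 2 * delta x <= enorm v ^+ 2 / delta x.
Proof.
move=> Ox; have d0 := bdist_gt0 Ox; have [y xy] := foot_exists x.
have H w : delta (x + w) <= delta x + (2 * dot (x - y) w + enorm w ^+ 2) / (2 * delta x).
  have := bdist_le (x + w) xy.1; rewrite -ler_sqr ?nnegrE ?bdist_ge0 ?enorm_ge0//.
  rewrite addrAC enorm_sqrD xy.2.
  move=> H; rewrite -lerBlDl ler_pdivlMr ?mulr_gt0//.
  by have := sqr_ge0 (delta (x + w) - delta x); nra.
have := H v; have := H (- v); rewrite enormN dotNr.
rewrite (_ : enorm v ^+ 2 / delta x = (2 * dot (x - y) v + enorm v ^+ 2) / (2 * delta x) +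
  (2 * - dot (x - y) v + enorm v ^+ 2) / (2 * delta x)); last first.
  by field; rewrite gt_eqF.
move: (_ / (2 * delta x)) ((2 * dot _ _ + _) / _) => a b; lra.
Qed.

Lemma good_setP x : good_set Omega x <->
  exists2 r, 0 < r & forall x', enorm (x' - x) < r ->
    Omega x' /\ exists y, foot x' y /\ forall y', foot x' y' -> y' = y.
Proof.
rewrite /good_set /interior /=; split=> [/nbhs_enormP[r r0 rP]|[r r0 rP]].
  exists r => // x' /rP /= [Ox' [y [yn yu]]]; split=> //; exists y; split.
    exact/nearest_pointP.
  by move=> y' x'y'; apply/esym/yu/nearest_pointP.
apply/nbhs_enormP; exists r => // x' /rP[Ox' [y [x'y yU]]]; split=> //.
exists y; split; first exact/nearest_pointP.
by move=> y' /(nearest_pointP _ Ox') x'y'; apply/esym/yU.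
Qed.

(* If delta(z) < delta(x) + |z - x| on a small sphere around x, then for some
   k < 1 the maximum of delta on {delta(z) - delta(x) >= k |z - x|} is attained
   inside the ball, which contradicts |grad delta| = 1 > k there. *)
Lemma foot_extension x y : good_set Omega x -> foot x y ->
  exists z t, [/\ foot z y, 0 < t < 1 & x = y + t *: (z - y)].
Proof.
move=> /good_setP[r r0 rP] xy.
have [Ox _] : Omega x /\ True by have [] := rP x; rewrite ?subrr ?enorm0.
have d0 := bdist_gt0 Ox.
pose rho := r / 2.
have rho0 : 0 < rho by rewrite divr_gt0.
have rhor : rho < r by rewrite /rho; lra.
have [||z0 z0S z0max] := @EVT_max_rV R n delta [set z | enorm (z - x) = rho] _ (@compact_esphere _ _ x rho).
- exists (x + (rho / delta x) *: (x - y)) => /=.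
  by rewrite addrC addKr enormZ xy.2 ger0_norm ?divr_ge0 ?ltW// mulfVK// gt_eqF.
- exact/continuous_subspaceT/bdist_continuous.
have {z0S} z0x : enorm (z0 - x) = rho by exact: (set_mem z0S).
have Hmax : delta x + rho <= delta z0.
  rewrite leNgt; apply/negP => lt.
  (* The second entry is the midpoint between the largest slope on the sphere and 1; the first keeps
     [k] positive. *)
  pose k := Num.max (1 / 2) ((1 + (delta z0 - delta x) / rho) / 2).
  have q1 : (delta z0 - delta x) / rho < 1.
    by rewrite ltr_pdivrMr// mul1r ltrBlDl.
  have k0 : 0 < k by rewrite lt_max divr_gt0.
  have k1 : k < 1 by rewrite gt_max; apply/andP; split; lra.
  have kq : (delta z0 - delta x) / rho < k.
    by rewrite lt_max; apply/orP; right; lra.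
  pose A := [set z | enorm (z - x) <= rho] `&`
    [set z | 0 <= delta z - delta x - k * enorm (z - x)].
  have cA : compact A.
    apply: subclosed_compact (@compact_eball _ _ x rho) _; last by move=> ? [].
    apply: closedI; first exact: compact_closed (@compact_eball _ _ _ _).
    apply: closed_comp (@closed_ge _ 0) => v _.
    apply: (@cvgB _ _ _ (nbhs v)); last first.
      by apply: cvgM; [exact: cvg_cst|exact: continuous_enormB].
    by apply: cvgB; [exact: bdist_continuous|exact: cvg_cst].
  have [||z1 z1A z1max] := @EVT_max_rV R n delta A _ cA.
  - by exists x; split; rewrite /= !subrr enorm0 ?mulr0 ?subrr// ltW.
  - exact/continuous_subspaceT/bdist_continuous.
  have [/= z1x z1k] := set_mem z1A.
  have [z1rho|z1rho] := eqVneq (enorm (z1 - x)) rho.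
    have := z0max z1; rewrite inE => /(_ z1rho).
    move: z1k kq; rewrite z1rho ltr_pdivrMr//; lra.
  have {}z1rho : enorm (z1 - x) < rho by rewrite lt_neqAle z1rho.
  have [Oz1 [y1 [z1y1 y1U]]] := rP z1 (lt_trans z1rho rhor).
  have d1 := bdist_gt0 Oz1.
  (* The unit vector pointing away from the foot, along which [delta] has derivative 1. *)
  pose v := (delta z1)^-1 *: (z1 - y1).
  have v1 : enorm v = 1.
    by rewrite enormZ z1y1.2 ger0_norm ?invr_ge0 ?ltW// mulVf// gt_eqF.
  have /is_derive_cvgP := is_derive_bdist v Oz1 z1y1 y1U.
  rewrite dotZr -enorm_sqr z1y1.2 expr2 mulKf ?gt_eqF// divff ?gt_eqF//.
  move=> dv.
  have H : \forall t \near (0 : R)^', k < t^-1 * (delta (t *: v + z1) - delta z1).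
    exact: (cvgr_gt 1 dv).
  have H2 : \forall t \near (0 : R)^', `|t| < rho - enorm (z1 - x).
    apply: nbhs_dnbhs; apply/nbhs_normP; exists (rho - enorm (z1 - x)) => /=.
      by rewrite subr_gt0.
    by move=> s; rewrite /= sub0r normrN.
  have [t t0 [Ht Ht2]] := near_dnbhs0_pos (filterI H H2).
  rewrite (gtr0_norm t0) in Ht2.
  rewrite mulrC ltr_pdivlMr// ltrBrDr in Ht.
  have tv : enorm (t *: v + z1 - x) <= t + enorm (z1 - x).
    by rewrite -addrA (le_trans (ler_enormD _ _))// enormZ v1 mulr1 gtr0_norm.
  have := z1max (t *: v + z1); rewrite inE => /(_ _).
  suff At : A (t *: v + z1).
    move=> /(_ At); have := mulr_gt0 k0 t0; lra.
  split=> /=; first by lra.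
  have := ler_wpM2l (ltW k0) tv; rewrite mulrDr; lra.
(* The path from [z0] through [x] to [y] is no longer than [delta z0], so [y] is a foot of [z0] too
   and the three points are aligned. *)
have z0y : enorm (z0 - y) = delta z0.
  apply/eqP; rewrite eq_le (bdist_le _ xy.1) andbT (le_trans _ Hmax)//.
  by have := ler_enorm_sub x z0 y; rewrite z0x xy.2 (addrC rho).
have := @triangle_eq _ _ (z0 - x) (x - y); rewrite addrA subrK z0x xy.2 z0y.
rewrite addrC => /(_ Hmax) E.
have dr : delta x + rho != 0 by rewrite gt_eqF// addr_gt0.
exists z0, (delta x / (delta x + rho)); split.
- by split=> //; exact: xy.1.
- by rewrite divr_gt0 ?addr_gt0//= ltr_pdivrMr ?addr_gt0// mul1r ltrDl.
apply/rowP => i; have := congr1 (fun u : 'rV[R]_n => u 0 i) E; rewrite !mxE => Ei.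
apply: (mulfI dr); rewrite mulrDr mulrA (mulrC (_ + rho) (_ / _)) mulfVK//.
lra.
Qed.

End boundary_distance.

(** * Feet in a boundary chart *)

Section strict_at.
Context {R : realType} {m n : nat}.
Implicit Types (u v : 'rV[R]_m * 'rV[R]_n) (h k : 'rV[R]_m * 'rV[R]_n -> R).

Definition pnorm u : R := enorm u.1 + enorm u.2.

Lemma pnorm_ge0 u : 0 <= pnorm u.
Proof. by rewrite addr_ge0 ?enorm_ge0. Qed.

(* Strict (Leach) differentiability of h at u0, with derivative L. *)
Definition strict_at h u0 (L : 'rV[R]_m * 'rV[R]_n -> R) : Prop :=
  (exists K, forall u, `|L u| <= K * pnorm u) /\
  forall e, 0 < e -> exists2 r, 0 < r & forall u v,
    pnorm (u - u0) < r -> pnorm (v - u0) < r ->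
    `|h v - h u - L (v - u)| <= e * pnorm (v - u).

Lemma strict_at_lipschitz h u0 L : strict_at h u0 L ->
  exists K r, [/\ 0 < K, 0 < r & forall u v, pnorm (u - u0) < r ->
    pnorm (v - u0) < r -> `|h v - h u| <= K * pnorm (v - u)].
Proof.
move=> [[K KL] /(_ 1 ltr01)[r r0 rP]].
exists (`|K| + 1), r; split=> [|//|u v ur vr]; first by rewrite ltr_wpDl.
have := rP u v ur vr; have := KL (v - u).
have := ler_wpM2r (pnorm_ge0 (v - u)) (ler_norm K).
have := ler_normD (h v - h u - L (v - u)) (L (v - u)); rewrite subrK.
rewrite mulrDl; lra.
Qed.

Lemma strict_atD h k u0 L M : strict_at h u0 L -> strict_at k u0 M ->
  strict_at (fun u => h u + k u) u0 (fun u => L u + M u).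
Proof.
move=> [[K1 K1P] hP] [[K2 K2P] kP]; split.
  exists (K1 + K2) => u; rewrite mulrDl (le_trans (ler_normD _ _))// lerD//.
move=> e e0; have e20 : 0 < e / 2 by rewrite divr_gt0.
have [r1 r10 r1P] := hP _ e20; have [r2 r20 r2P] := kP _ e20.
exists (Num.min r1 r2) => [|u v]; first by rewrite lt_min r10.
rewrite !lt_min => /andP[u1 u2] /andP[v1 v2].
rewrite (_ : _ - _ = (h v - h u - L (v - u)) + (k v - k u - M (v - u))); last by ring.
rewrite (le_trans (ler_normD _ _))// [e in leRHS]splitr mulrDl.
by rewrite lerD ?r1P ?r2P.
Qed.

Lemma strict_atM h k u0 L M : strict_at h u0 L -> strict_at k u0 M ->
  strict_at (fun u => h u * k u) u0 (fun u => h u0 * M u + k u0 * L u).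
Proof.
move=> hs ks; have [K1 [r1 [K10 r10 lip1]]] := strict_at_lipschitz hs.
have [K2 [r2 [K20 r20 lip2]]] := strict_at_lipschitz ks.
move: hs ks => [[C1 C1P] hP] [[C2 C2P] kP]; split.
  exists (`|h u0| * C2 + `|k u0| * C1) => u.
  rewrite (le_trans (ler_normD _ _))// !normrM mulrDl -!mulrA.
  by rewrite lerD// ler_wpM2l.
move=> e e0; pose C := K1 + K2 + `|h u0| + `|k u0|.
have C0 : 0 < C.
  by rewrite /C -!addrA ltr_wpDr// addr_ge0 ?addr_ge0// ltW.
pose e' := e / C.
have e'0 : 0 < e' by rewrite divr_gt0.
have [r3 r30 r3P] := hP _ e'0; have [r4 r40 r4P] := kP _ e'0.
exists (Num.min (Num.min r1 r2)
    (Num.min (Num.min r3 r4) (Num.min (e' / K1) (e' / K2)))) => [|u v].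
  by rewrite !lt_min r10 r20 r30 r40 !divr_gt0.
rewrite !lt_min => /andP[/andP[u1 u2] /andP[/andP[u3 u4] /andP[u5 u6]]].
move=> /andP[/andP[v1 v2] /andP[/andP[v3 v4] /andP[v5 v6]]].
have s0 := pnorm_ge0 (v - u); set s := pnorm (v - u) in s0 *.
have u00 : pnorm (u0 - u0) = 0 by rewrite subrr /pnorm enorm0 enorm0 addr0.
have hv : `|h v - h u0| <= e'.
  rewrite (le_trans (lip1 u0 v _ v1)) ?u00//.
  by rewrite mulrC -ler_pdivlMr// ltW.
have ku : `|k u - k u0| <= e'.
  rewrite (le_trans (lip2 u0 u _ u2)) ?u00//.
  by rewrite mulrC -ler_pdivlMr// ltW.
rewrite (_ : _ - _ = (h v - h u0) * (k v - k u) + h u0 * (k v - k u - M (v - u)) +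
  (k u - k u0) * (h v - h u) + k u0 * (h v - h u - L (v - u))); last by ring.
apply: (@le_trans _ _ (e' * (K2 * s) + `|h u0| * (e' * s) + e' * (K1 * s) +
    `|k u0| * (e' * s))); last first.
  rewrite (_ : e' * _ + _ + _ + _ = e' * C * s); last by rewrite /C; ring.
  by rewrite divfK ?gt_eqF.
rewrite (le_trans (ler_normD _ _))// lerD//; last first.
  by rewrite normrM ler_wpM2l// r3P.
rewrite (le_trans (ler_normD _ _))// lerD//; last first.
  by rewrite normrM ler_pM// lip1.
rewrite (le_trans (ler_normD _ _))// lerD// normrM.
  by rewrite ler_pM// lip2.
by rewrite ler_wpM2l// r4P.
Qed.

Lemma strict_atN h u0 L : strict_at h u0 L ->
  strict_at (fun u => - h u) u0 (fun u => - L u).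
Proof.
move=> [[K KP] hP]; split; first by exists K => u; rewrite normrN.
move=> e /hP[r r0 rP]; exists r => // u v ur vr.
by rewrite -normrN !opprD !opprK rP.
Qed.

Lemma strict_atB h k u0 L M : strict_at h u0 L -> strict_at k u0 M ->
  strict_at (fun u => h u - k u) u0 (fun u => L u - M u).
Proof. by move=> hs /strict_atN; exact: strict_atD. Qed.

Lemma strict_at_linear h u0 : (forall u v, h (u - v) = h u - h v) ->
  (exists K, forall u, `|h u| <= K * pnorm u) -> strict_at h u0 h.
Proof.
move=> hl hb; split=> // e e0; exists 1 => // u v _ _.
by rewrite hl subrr normr0 mulr_ge0 ?pnorm_ge0// ltW.
Qed.

Lemma strict_at_snd (f : 'rV[R]_n -> R) u0 : Ck 1 f ->
  strict_at (fun u => f u.2) u0 (fun u => dot (gradient f u0.2) u.2).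
Proof.
move=> f1; split.
  exists (enorm (gradient f u0.2)) => u; rewrite (le_trans (cauchy_schwarz _ _))//.
  by rewrite ler_wpM2l ?enorm_ge0// lerDr enorm_ge0.
move=> e e0; have [r r0 rP] := Ck1_strict u0.2 f1 e0.
exists r => // u v ur vr; have le2 w : enorm w.2 <= pnorm w.
  by rewrite lerDr enorm_ge0.
rewrite (le_trans (rP u.2 v.2 _ _))//.
- exact: le_lt_trans (le2 (u - u0)) ur.
- exact: le_lt_trans (le2 (v - u0)) vr.
- by rewrite ler_wpM2l ?(ltW e0)// (le2 (v - u)).
Qed.

End strict_at.

(** * Coordinates adapted to a graph *)

Section horizontal_vertical.
Context {R : realType} {n : nat}.
Implicit Types (X Z : 'rV[R]_n.+1) (p w : 'rV[R]_n).

Lemma horizontal0 : horizontal (0 : 'rV[R]_n.+1) = 0.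
Proof. by apply/rowP => i; rewrite !mxE. Qed.

Lemma vertical0 : vertical (0 : 'rV[R]_n.+1) = 0.
Proof. by rewrite /vertical mxE. Qed.

Lemma horizontalD X Z : horizontal (X + Z) = horizontal X + horizontal Z.
Proof. by apply/rowP => i; rewrite !mxE. Qed.

Lemma horizontalN X : horizontal (- X) = - horizontal X.
Proof. by apply/rowP => i; rewrite !mxE. Qed.

Lemma horizontalZ (a : R) X : horizontal (a *: X) = a *: horizontal X.
Proof. by apply/rowP => i; rewrite !mxE. Qed.

Lemma verticalD X Z : vertical (X + Z) = vertical X + vertical Z.
Proof. by rewrite /vertical !mxE. Qed.

Lemma verticalN X : vertical (- X) = - vertical X.
Proof. by rewrite /vertical !mxE. Qed.

Lemma verticalZ (a : R) X : vertical (a *: X) = a * vertical X.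
Proof. by rewrite /vertical !mxE. Qed.

Lemma dot_hv X Z : dot X Z =
  dot (horizontal X) (horizontal Z) + vertical X * vertical Z.
Proof.
rewrite /dot big_ord_recr; congr (_ + _); apply: eq_bigr => i _.
have -> : widen_ord (leqnSn n) i = lift ord_max i.
  by apply/val_inj; rewrite [RHS]lift_max.
by rewrite !mxE.
Qed.

Lemma enorm_hv X : enorm X ^+ 2 = enorm (horizontal X) ^+ 2 + vertical X ^+ 2.
Proof. by rewrite !enorm_sqr dot_hv expr2. Qed.

Lemma enorm_horizontal X : enorm (horizontal X) <= enorm X.
Proof.
by rewrite -ler_sqr ?nnegrE ?enorm_ge0// (enorm_hv X) lerDl sqr_ge0.
Qed.

Lemma abs_vertical X : `|vertical X| <= enorm X.
Proof. exact: coord_enorm. Qed.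

Definition graph_point (phi : 'rV[R]_n -> R) p : 'rV[R]_n.+1 :=
  \row_j (if unlift ord_max j is Some i then p 0 i else phi p).

Lemma horizontal_graph phi p : horizontal (graph_point phi p) = p.
Proof. by apply/rowP => i; rewrite !mxE liftK. Qed.

Lemma vertical_graph phi p : vertical (graph_point phi p) = phi p.
Proof. by rewrite /vertical !mxE unlift_none. Qed.

Lemma graph_pointP phi X : vertical X = phi (horizontal X) ->
  graph_point phi (horizontal X) = X.
Proof.
move=> XE; apply/rowP => j; rewrite mxE.
by case: unliftP => [i ->|->]; rewrite ?mxE// -XE.
Qed.

Definition graph_sqdist phi X p : R :=
  enorm (horizontal X - p) ^+ 2 + (vertical X - phi p) ^+ 2.

Lemma graph_sqdistE phi X p :
  graph_sqdist phi X p = enorm (X - graph_point phi p) ^+ 2.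
Proof.
rewrite enorm_hv horizontalD verticalD horizontalN verticalN.
by rewrite horizontal_graph vertical_graph.
Qed.

Lemma peano2_sqnorm_line p w :
  peano2 (fun t => enorm (p + t *: w) ^+ 2) (2 * dot p w) (2 * enorm w ^+ 2).
Proof.
have := peano2D (peano2_cst (enorm p ^+ 2))
  (peano2D (peano2M (peano2_cst (2 * dot p w)) (@peano2_id R))
           (peano2M (peano2_cst (enorm w ^+ 2)) (peano2_sqr (@peano2_id R)))).
rewrite /=; set c1 := (X in peano2 _ X _); set c2 := (X in peano2 _ _ X).
rewrite (_ : c1 = 2 * dot p w); last by rewrite /c1; ring.
rewrite (_ : c2 = 2 * enorm w ^+ 2); last by rewrite /c2; ring.
apply: eq_peano2 => t; rewrite enorm_sqrD dotZr enormZ exprMn real_normK ?num_real//.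
ring.
Qed.

(** Expansion of the barrier: the point moves with velocity [E] while its competitor on the graph
    moves over [p + t *: w]. The bending of the graph enters through the last term, weighted by the
    height of [X] over [p]. *)
Lemma peano2_graph_sqdist phi X E p w : Ck 2 phi ->
  peano2 (fun t => graph_sqdist phi (X + t *: E) (p + t *: w))
    (2 * (dot (horizontal X - p) (horizontal E - w) +
      (vertical X - phi p) * (vertical E - dot (gradient phi p) w)))
    (2 * (enorm (horizontal E - w) ^+ 2 +
      (vertical E - dot (gradient phi p) w) ^+ 2 -
      (vertical X - phi p) * dot (w *m hessian phi p) w)).
Proof.
move=> phi2.
have vp := peano2B (peano2D (peano2_cst (vertical X)) (peano2M (peano2_cst (vertical E)) (@peano2_id R))) (Ck2_peano2 (x := p) (w := w) phi2).
have := peano2D (peano2_sqnorm_line (horizontal X - p) (w := horizontal E - w)) (peano2_sqr vp).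
rewrite /= scale0r addr0 mulr0 addr0.
set c1 := (X in peano2 _ X _ -> _); set c2 := (X in peano2 _ _ X -> _).
move=> H; apply: eq_peano2_coef (eq_peano2 _ H).
- by rewrite /c1; ring.
- by rewrite /c2; ring.
- move=> t; rewrite /graph_sqdist horizontalD verticalD horizontalZ verticalZ.
  rewrite (mulrC t) opprD addrA; congr (enorm _ ^+ 2 + _).
  by rewrite scalerBr addrACA addrA.
Qed.

End horizontal_vertical.

(** * First and second order conditions at a foot *)

Section chart.
Context {R : realType} {n : nat} {Omega : set 'rV[R]_n.+1}.
Hypothesis openO : open Omega.
Hypothesis compl0 : ~` Omega !=set0.
Variables (Q : 'M[R]_n.+1) (phi : 'rV[R]_n -> R) (y0 : 'rV[R]_n.+1) (r0 : R).
Hypothesis QQT : Q *m Q^T = 1%:M.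
Hypothesis phi2 : Ck 2 phi.
Hypothesis r00 : 0 < r0.
Hypothesis chartP : forall x, enorm (x - y0) < r0 ->
  (Omega x <-> phi (horizontal (x *m Q)) < vertical (x *m Q)).
Implicit Types (x y z v : 'rV[R]_n.+1) (p w : 'rV[R]_n).
Local Notation delta := (bdist Omega).
Local Notation hor x := (horizontal (x *m Q)).
Local Notation ver x := (vertical (x *m Q)).
Local Notation sheet p := (graph_point phi p *m Q^T).
Local Notation grad := (gradient phi).

Let QTQ : Q^T *m Q = 1%:M.
Proof. exact: mulmx1C. Qed.

Let QTQT : Q^T *m Q^T^T = 1%:M.
Proof. by rewrite trmxK. Qed.

Lemma sheetQ p : sheet p *m Q = graph_point phi p.
Proof. by rewrite -mulmxA QTQ mulmx1. Qed.

Lemma hor_sheet p : hor (sheet p) = p.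
Proof. by rewrite sheetQ horizontal_graph. Qed.

Lemma ver_sheet p : ver (sheet p) = phi p.
Proof. by rewrite sheetQ vertical_graph. Qed.

Lemma sqdist_sheet x p : enorm (x - sheet p) ^+ 2 = graph_sqdist phi (x *m Q) p.
Proof. by rewrite graph_sqdistE -(enorm_rot _ QQT) mulmxBl sheetQ. Qed.

(** In the chart a point outside [Omega] is on or below the graph. Strictly below it, a whole
    neighbourhood misses [Omega], whereas a foot is in the closure. *)
Lemma chart_foot x y : Omega x -> foot (Omega := Omega) x y ->
  enorm (y - y0) < r0 -> y = sheet (hor y).
Proof.
move=> Ox xy yr; suff H : ver y = phi (hor y).
  by rewrite (graph_pointP H) -mulmxA QQT mulmx1.
have := xy.1; rewrite chartP// => /negP; rewrite -leNgt => H.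
apply/eqP; rewrite eq_le H/= leNgt; apply/negP => {}H.
have [clO _] := (frontierP openO y).1 (foot_frontier openO compl0 Ox xy).
pose gap x := phi (hor x) - ver x.
have cQ : continuous (fun x => x *m Q).
  move=> u; apply/(@cvgrPdist_le _ _ _ (nbhs u)) => e e0.
  apply/nbhs_enormP; exists e => // v /ltW ve.
  by rewrite -mulmxBl (le_trans (norm_le_enorm _))// (enorm_rot _ QQT) enormBC.
have ch : continuous (fun x => hor x).
  move=> u; apply/(@cvgrPdist_le _ _ _ (nbhs u)) => e e0.
  apply/nbhs_enormP; exists e => // v /ltW ve.
  rewrite -horizontalN -horizontalD -mulmxBl (le_trans (norm_le_enorm _))//.
  by rewrite (le_trans (enorm_horizontal _))// (enorm_rot _ QQT) enormBC.
have cg : continuous gap.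
  move=> u; apply: (@cvgB _ _ _ (nbhs u)).
    by apply: continuous_comp; [exact: ch|exact: phi2.1].
  by apply: (@continuous_comp _ _ _ (fun x => x *m Q)); [exact: cQ|exact: coord_continuous].
have : \forall x \near y, 0 < gap x.
  have := cg y; move=> /(@cvgr_gt _ _ _ _ _ _); apply.
  by rewrite subr_gt0.
move=> /nbhs_enormP[r r_gt0 rP].
have [x' [Ox' x'r]] : (Omega `&` [set x' | enorm (x' - y) < Num.min r (r0 - enorm (y - y0))]) !=set0.
  apply: clO; apply/nbhs_enormP.
  by exists (Num.min r (r0 - enorm (y - y0))) => //; rewrite lt_min r_gt0 subr_gt0.
move: x'r => /=; rewrite lt_min => /andP[x'r x'r0].
have /rP := x'r; rewrite subr_gt0 ltNge; apply/negP; rewrite negbK.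
apply/ltW/chartP => //; rewrite (le_lt_trans (ler_enorm_sub y x' y0))//.
by rewrite -ltrBrDr.
Qed.

Lemma sheet_notin p : enorm (sheet p - y0) < r0 -> ~ Omega (sheet p).
Proof. by move=> /chartP ->; rewrite hor_sheet ver_sheet ltxx. Qed.

(** Keeps the moving competitor inside the ball in which the chart describes [Omega]. *)
Lemma sheet_lip p w : exists2 C, 0 < C & \forall t \near (0 : R),
  enorm (sheet (p + t *: w) - sheet p) <= C * `|t|.
Proof.
have := Ck2_peano2 (x := p) (w := w) phi2 => /peano2_slope sl.
have [C C0 HC] : exists2 C, 0 < C & \forall t \near (0 : R)^',
    `|(phi (p + t *: w) - phi (p + 0 *: w)) / t| < C.
  exists (`|dot (grad p) w| + 1); first by rewrite ltr_wpDl.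
  have nl : (fun t => `|(phi (p + t *: w) - phi (p + 0 *: w)) / t|) @ (0 : R)^' -->
      `|dot (grad p) w| by apply: cvg_norm; exact: sl.
  by apply: (cvgr_lt _ nl); rewrite ltrDl.
exists (enorm w + C); first by rewrite ltr_wpDl ?enorm_ge0.
have : \forall t \near (0 : R), t != 0 -> `|(phi (p + t *: w) - phi (p + 0 *: w)) / t| < C.
  exact: HC.
apply: filterS => t Ht.
have [->|t0] := eqVneq t 0; first by rewrite scale0r addr0 subrr enorm0 normr0 mulr0.
have := Ht t0; rewrite scale0r addr0 normrM normfV ltr_pdivrMr ?normr_gt0// => {}Ht.
rewrite -mulmxBl (enorm_rot _ QTQT).
rewrite -ler_sqr ?nnegrE ?mulr_ge0 ?enorm_ge0 ?addr_ge0 ?enorm_ge0 ?(ltW C0)//.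
rewrite enorm_hv horizontalD verticalD horizontalN verticalN.
rewrite !horizontal_graph !vertical_graph (_ : p + t *: w - p = t *: w) ?enormZ; last first.
  by rewrite addrAC subrr add0r.
have : (phi (p + t *: w) - phi p) ^+ 2 <= (C * `|t|) ^+ 2.
  by rewrite -[leLHS]real_normK ?num_real// ler_sqr ?nnegrE ?mulr_ge0 ?(ltW C0)// ltW.
have : 0 <= (`|t| * enorm w) * (C * `|t|).
  by rewrite !mulr_ge0 ?enorm_ge0 ?(ltW C0).
move: (_ ^+ 2) (enorm w) => a b; nra.
Qed.

(** Points of the sheet are outside [Omega], so they compete for the distance, with equality at
    [t = 0]. *)
Lemma sheet_touch x v p w : foot (Omega := Omega) x (sheet p) ->
  enorm (sheet p - y0) < r0 ->
  \forall t \near (0 : R),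
    delta (x + t *: v) ^+ 2 <= graph_sqdist phi (x *m Q + t *: (v *m Q)) (p + t *: w).
Proof.
move=> xp pr; have [C C0 HC] := sheet_lip p w.
near=> t.
rewrite scalemxAl -mulmxDl -sqdist_sheet ler_sqr ?nnegrE ?bdist_ge0 ?enorm_ge0//.
apply: bdist_le; apply: sheet_notin.
rewrite (le_lt_trans (ler_enorm_sub (sheet p) _ _))// -ltrBrDr.
rewrite (@le_lt_trans _ _ (C * `|t|))//; first by near: t.
rewrite mulrC -ltr_pdivlMr//.
near: t; apply/nbhs_normP; exists ((r0 - enorm (sheet p - y0)) / C) => /=.
  by rewrite divr_gt0// subr_gt0.
by move=> s; rewrite /= sub0r normrN.
Unshelve. all: by end_near. Qed.

Local Notation height x p := (ver x - phi p).

Lemma foot_critical x p : foot (Omega := Omega) x (sheet p) ->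
  enorm (sheet p - y0) < r0 ->
  hor x - p = - height x p *: grad p.
Proof.
move=> xp pr.
suff H w : dot (hor x - p + height x p *: grad p) w = 0.
  apply/eqP; rewrite scaleNr -addr_eq0 -dot_eq0; exact/eqP.
have := sheet_touch 0 w xp pr.
have F := peano2_graph_sqdist (X := x *m Q) (E := 0 *m Q) (p := p) (w := w) phi2.
move=> touch; have [||] := peano2_le _ _ (peano2_cst (delta x ^+ 2)) F.
- by rewrite /= !scale0r !addr0 -sqdist_sheet xp.2.
- by apply: filterS touch => t /=; rewrite scaler0 addr0.
rewrite mul0mx horizontal0 vertical0.
rewrite !sub0r dotNr [dot (_ + _ *: _) _]dotDl dotZl => H _; move: H; lra.
Qed.

(** The same comparison at second order. The inequality is not strict, as [x] may be a focal
    point. *)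
Lemma foot_second_order x p w : foot (Omega := Omega) x (sheet p) ->
  enorm (sheet p - y0) < r0 ->
  0 <= enorm w ^+ 2 + dot (grad p) w ^+ 2 - height x p * dot (w *m hessian phi p) w.
Proof.
move=> xp pr; have := sheet_touch 0 w xp pr.
have F := peano2_graph_sqdist (X := x *m Q) (E := 0 *m Q) (p := p) (w := w) phi2.
move=> touch; have [||] := peano2_le _ _ (peano2_cst (delta x ^+ 2)) F.
- by rewrite /= !scale0r !addr0 -sqdist_sheet xp.2.
- by apply: filterS touch => t /=; rewrite scaler0 addr0.
rewrite mul0mx horizontal0 vertical0.
by rewrite !sub0r enormN sqrrN => _; rewrite pmulr_rge0.
Qed.

Lemma height_sqr x p : foot (Omega := Omega) x (sheet p) ->
  enorm (sheet p - y0) < r0 ->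
  delta x ^+ 2 = height x p ^+ 2 * (1 + enorm (grad p) ^+ 2).
Proof.
move=> xp pr; rewrite -xp.2 sqdist_sheet /graph_sqdist (foot_critical xp pr).
by rewrite enormZ exprMn real_normK ?num_real// sqrrN mulrDr mulr1 addrC.
Qed.

(** With negative height, the segment from the foot to [x] would start below the graph; yet its
    points have positive distance to the complement, so they lie in [Omega], above the graph. *)
Lemma height_gt0 x p : Omega x -> foot (Omega := Omega) x (sheet p) ->
  enorm (sheet p - y0) < r0 -> 0 < height x p.
Proof.
move=> Ox xp pr; have d0 := bdist_gt0 openO compl0 Ox.
have c0 : height x p != 0.
  apply/eqP => c0; have := height_sqr xp pr; rewrite c0 expr0n mul0r => /eqP.
  by rewrite expf_eq0/= gt_eqF.
rewrite lt_def c0 /=.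
pose c := height x p; rewrite -/c.
have K : peano2 (fun t => phi p + t * c - phi (p + t *: (hor x - p)))
   (c - dot (grad p) (hor x - p)) (0 - dot ((hor x - p) *m hessian phi p) (hor x - p)).
  have := peano2B (peano2D (peano2_cst (phi p)) (peano2M (@peano2_id R) (peano2_cst c)))
    (Ck2_peano2 (x := p) (w := hor x - p) phi2).
  by apply: eq_peano2_coef; rewrite /=; ring.
have sl := peano2_slope K; rewrite mul0r scale0r !addr0 subrr in sl.
suff H : 0 <= c - dot (grad p) (hor x - p).
  rewrite (foot_critical xp pr) -/c dotZr -enorm_sqr in H.
  rewrite -(@pmulr_lge0 _ (1 + enorm (grad p) ^+ 2)); last first.
    by rewrite ltr_wpDr// sqr_ge0.
  by move: H; rewrite mulNr opprK mulrDr mulr1.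
rewrite leNgt; apply/negP => lt0.
have H : \forall t \near (0 : R)^', (phi p + t * c - phi (p + t *: (hor x - p)) - 0) / t < 0.
  exact: (cvgr_lt _ sl).
have H2 : \forall t \near (0 : R)^', `|t| < Num.min 1 ((r0 - enorm (sheet p - y0)) / delta x).
  apply: nbhs_dnbhs; apply/nbhs_normP.
  exists (Num.min 1 ((r0 - enorm (sheet p - y0)) / delta x)) => /=.
    by rewrite lt_min ltr01 divr_gt0// subr_gt0.
  by move=> s; rewrite /= sub0r normrN.
have [t t0 [Ht]] := near_dnbhs0_pos (filterI H H2).
rewrite (gtr0_norm t0) lt_min => /andP[t1 tr].
have [|_ dt] := foot_segment openO compl0 xp (t := t); first by rewrite !ltW.
have : Omega (sheet p + t *: (x - sheet p)).
  by apply: (bdist_pos openO compl0); rewrite dt mulr_gt0.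
rewrite chartP; last first.
  rewrite addrAC (le_lt_trans (ler_enormD _ _))// enormZ (gtr0_norm t0) xp.2.
  by rewrite -ltrBrDl -ltr_pdivlMr.
rewrite mulmxDl -scalemxAl mulmxBl sheetQ.
rewrite horizontalD verticalD horizontalZ verticalZ horizontalD verticalD.
rewrite horizontalN verticalN horizontal_graph vertical_graph.
rewrite pmulr_llt0 ?invr_gt0// subr0 subr_lt0 in Ht.
by rewrite ltNge (ltW Ht).
Qed.

(** * Implicit function argument at a nondegenerate foot *)

Section nondegenerate.
Variables (z : 'rV[R]_n.+1) (p0 : 'rV[R]_n) (k : R).
Hypothesis Oz : Omega z.
Hypothesis zp0 : foot (Omega := Omega) z (sheet p0).
Hypothesis zU : forall y, foot (Omega := Omega) z y -> y = sheet p0.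
Hypothesis p0r : enorm (sheet p0 - y0) < r0.
Hypothesis k0 : 0 < k.
(** Half the hessian at [p0] of the squared distance from [z] to the graph. *)
Let A := first_form phi p0 - height z p0 *: hessian phi p0.
Hypothesis kA : forall w, k * enorm w ^+ 2 <= dot (w *m A) w.

Let A_unit : A \in unitmx.
Proof.
rewrite -row_free_unit; apply/inj_row_free => w wA.
apply/eqP; rewrite -dot_eq0 -enorm_sqr eq_le sqr_ge0 andbT.
by rewrite -(pmulr_rle0 _ k0) (le_trans (kA w))// wA dot0l.
Qed.

Let mulmxA_coord w j : (w *m A) 0 j = w 0 j + dot (grad p0) w * partial phi j p0 -
  height z p0 * dot (gradient (partial phi j) p0) w.
Proof.
rewrite /A /first_form mulmxBr mulmxDr mulmx1 mulmxA -scalemxAr !mxE.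
congr (_ + _ - _ * _).
  rewrite big_ord1 !mxE; congr (_ * _); apply: eq_bigr => i _.
  by rewrite !mxE mulrC.
apply: eq_bigr => i _; rewrite mulrC -[in LHS](hessian_sym p0 phi2) !mxE//.
Qed.

(* The strict derivative at (z, p0) of the critical point equation
   [foot_critical]. As A is invertible, the foot depends differentiably on the
   point near z, as in the implicit function theorem. *)
Definition linearized (u : 'rV[R]_n.+1 * 'rV[R]_n) : 'rV[R]_n :=
  horizontal u.1 + vertical u.1 *: grad p0 - u.2 *m A.

(** Both pairs solve the critical point equation, so its increment between them is 0, and strict
    differentiability at [(z, p0)] bounds the linearization. Strictness is what permits comparing
    two nearby pairs with each other. *)
Lemma critical_strict e : 0 < e -> exists2 r, 0 < r &
  forall x1 x2 p1 p2, enorm (x1 - z) < r -> enorm (x2 - z) < r ->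
    enorm (p1 - p0) < r -> enorm (p2 - p0) < r ->
    foot (Omega := Omega) x1 (sheet p1) -> foot (Omega := Omega) x2 (sheet p2) ->
    enorm (sheet p1 - y0) < r0 -> enorm (sheet p2 - y0) < r0 ->
    enorm (linearized ((x2 - x1) *m Q, p2 - p1)) <=
    e * (enorm (x2 - x1) + enorm (p2 - p1)).
Proof.
move=> e0.
pose G j (u : 'rV[R]_n.+1 * 'rV[R]_n) := (horizontal u.1 0 j - u.2 0 j) +
  (vertical u.1 - phi u.2) * partial phi j u.2.
pose u0 := (z *m Q, p0).
have Gs j : strict_at (G j) u0 (fun u => linearized u 0 j).
  have hs : strict_at (fun u => horizontal u.1 0 j - u.2 0 j) u0
      (fun u : 'rV[R]_n.+1 * 'rV[R]_n => horizontal u.1 0 j - u.2 0 j).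
    apply: strict_at_linear => [u v|]; first by rewrite /= !mxE; ring.
    exists 1 => u; rewrite mul1r (le_trans (ler_normB _ _))// lerD ?coord_enorm//.
    by rewrite mxE coord_enorm.
  have vs : strict_at (fun u => vertical u.1) u0
      (fun u : 'rV[R]_n.+1 * 'rV[R]_n => vertical u.1).
    apply: strict_at_linear => [u v|]; first by rewrite /= verticalD verticalN.
    by exists 1 => u; rewrite mul1r (le_trans (abs_vertical _))// lerDl enorm_ge0.
  have := strict_atD hs (strict_atM (strict_atB vs (strict_at_snd u0 (Ck2W phi2)))
    (strict_at_snd u0 (Ck2_partial j phi2))).
  congr (strict_at _ _ _); apply/funext => u.
  by rewrite /linearized /= [RHS]mxE [X in _ = X + _]mxE [X in _ = _ + X]mxE mulmxA_coord !mxE; ring.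
pose e' := e / n.+1%:R.
have e'0 : 0 < e' by rewrite divr_gt0.
have /choice[r rP] : forall j : 'I_n, exists r : R, 0 < r /\
    forall u v : 'rV[R]_n.+1 * 'rV[R]_n,
    pnorm (u - u0) < r -> pnorm (v - u0) < r ->
    `|G j v - G j u - linearized (v - u) 0 j| <= e' * pnorm (v - u).
  by move=> j; have [_ /(_ _ e'0)[r]] := Gs j; exists r.
pose rm := \big[Num.min/1]_j r j.
have rm0 : 0 < rm by rewrite /rm; apply: lt_bigmin => // j _; exact: (rP j).1.
exists (rm / 2); first by rewrite divr_gt0.
move=> x1 x2 p1 p2 x1r x2r p1r p2r xp1 xp2 pr1 pr2.
pose u := (x1 *m Q, p1); pose v := (x2 *m Q, p2).
have uvE : v - u = ((x2 - x1) *m Q, p2 - p1) by rewrite mulmxBl.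
have pvu : pnorm (v - u) = enorm (x2 - x1) + enorm (p2 - p1).
  by rewrite uvE /pnorm /= (enorm_rot _ QQT).
have G0 j x p : foot (Omega := Omega) x (sheet p) -> enorm (sheet p - y0) < r0 ->
    G j (x *m Q, p) = 0.
  move=> xp pr; have := congr1 (fun w : 'rV[R]_n => w 0 j) (foot_critical xp pr).
  rewrite /G /= !mxE => ->; ring.
rewrite -uvE -pvu (le_trans (enorm_le_sum _))//.
apply: (@le_trans _ _ (\sum_(j < n) e' * pnorm (v - u))); last first.
  rewrite sumr_const card_ord -mulr_natr mulrAC ler_wpM2r ?pnorm_ge0//.
  by rewrite /e' mulrAC ler_pdivrMr// ler_pM2l// ler_nat.
apply: ler_sum => j _; have rmj : rm <= r j by rewrite /rm (bigD1 j)//= ge_min lexx.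
have := (rP j).2 u v.
rewrite !G0// subrr sub0r normrN; apply.
- rewrite /pnorm /= -mulmxBl (enorm_rot _ QQT).
  by apply: lt_le_trans rmj; lra.
- rewrite /pnorm /= -mulmxBl (enorm_rot _ QQT).
  by apply: lt_le_trans rmj; lra.
Qed.

(** Pair the linearized equation with [p2 - p1]: coercivity of [A] contributes the factor [k], of
    which the error term consumes [k / 2]. *)
Lemma foot_param_lipschitz : exists M r, [/\ 0 < M, 0 < r &
  forall x1 x2 p1 p2, enorm (x1 - z) < r -> enorm (x2 - z) < r ->
    enorm (p1 - p0) < r -> enorm (p2 - p0) < r ->
    foot (Omega := Omega) x1 (sheet p1) -> foot (Omega := Omega) x2 (sheet p2) ->
    enorm (sheet p1 - y0) < r0 -> enorm (sheet p2 - y0) < r0 ->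
    enorm (p2 - p1) <= M * enorm (x2 - x1)].
Proof.
have k20 : 0 < k / 2 by rewrite divr_gt0.
have [r r_gt0 rP] := critical_strict k20.
pose M := (1 + enorm (grad p0) + k / 2) / (k / 2).
exists M, r; split=> //.
  by rewrite divr_gt0// ltr_wpDl// addr_ge0// enorm_ge0.
move=> x1 x2 p1 p2 x1r x2r p1r p2r xp1 xp2 pr1 pr2.
have := rP x1 x2 p1 p2 x1r x2r p1r p2r xp1 xp2 pr1 pr2.
rewrite /linearized /=; set dX := (x2 - x1) *m Q; set dp := p2 - p1.
have dXE : enorm dX = enorm (x2 - x1) by rewrite (enorm_rot _ QQT).
set b := horizontal dX + vertical dX *: grad p0.
have bE : enorm b <= (1 + enorm (grad p0)) * enorm (x2 - x1).
  rewrite (le_trans (ler_enormD _ _))// mulrDl mul1r -dXE.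
  rewrite lerD ?enorm_horizontal// enormZ mulrC ler_wpM2l ?enorm_ge0//.
  exact: abs_vertical.
move=> H.
rewrite /M mulrAC ler_pdivlMr// mulrC.
have [->|dp0] := eqVneq dp 0.
  by rewrite enorm0 mulr0 mulr_ge0 ?enorm_ge0// !addr_ge0 ?enorm_ge0// ltW.
have dpp : 0 < enorm dp by rewrite lt_def enorm_eq0 dp0 enorm_ge0.
rewrite -(@ler_pM2r _ (enorm dp))//.
have := kA dp; have := dot_le b dp; have := dot_le (- (b - dp *m A)) dp.
rewrite dotNl dotBl enormN opprB.
have := ler_wpM2r (enorm_ge0 dp) H; have := ler_wpM2r (enorm_ge0 dp) bE.
rewrite !mulrDl expr2.
move: (dot (dp *m A) dp) (dot b dp) (enorm b) (enorm (b - _)) (enorm dp).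
by move=> a1 a2 a3 a4 a5; lra.
Qed.

(** By uniqueness at [z], feet of nearby points stay near the foot of [z]; the Lipschitz bound with
    [x1 = x2] then makes two feet of one point coincide. *)
Lemma nondegenerate_near : exists2 r, 0 < r & forall x y, enorm (x - z) < r ->
  foot (Omega := Omega) x y ->
  [/\ Omega x, y = sheet (hor y), enorm (sheet (hor y) - y0) < r0 &
   forall y', foot (Omega := Omega) x y' -> y' = y].
Proof.
have [M [r1 [M0 r10 r1P]]] := foot_param_lipschitz.
have [r2 r20 r2P] : exists2 r, 0 < r & forall x, enorm (x - z) < r -> Omega x.
  by apply/nbhs_enormP; exact: open_nbhs_nbhs.
have e0 : 0 < Num.min r1 (r0 - enorm (sheet p0 - y0)) by rewrite lt_min r10 subr_gt0.
have [r3 r30 r3P] := foot_close openO compl0 zU e0.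
have H x y : enorm (x - z) < Num.min r1 (Num.min r2 r3) ->
  foot (Omega := Omega) x y ->
  [/\ Omega x, y = sheet (hor y), enorm (sheet (hor y) - y0) < r0 &
    enorm (hor y - p0) < r1].
  rewrite !lt_min => /and3P[xr1 xr2 xr3] xy; have Ox := r2P _ xr2.
  have := r3P _ _ xr3 xy; rewrite lt_min => /andP[yr1 yr0].
  have yr : enorm (y - y0) < r0.
    by rewrite (le_lt_trans (ler_enorm_sub (sheet p0) _ _))// -ltrBrDr.
  have yE := chart_foot Ox xy yr; split=> //; first by rewrite -yE.
  rewrite -[p0]hor_sheet -horizontalN -horizontalD -mulmxBl.
  by rewrite (le_lt_trans (enorm_horizontal _))// (enorm_rot _ QQT).
exists (Num.min r1 (Num.min r2 r3)); first by rewrite !lt_min r10 r20.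
move=> x y xr xy; have [Ox yE yr0 yr1] := H _ _ xr xy; split=> // y' xy'.
have [_ y'E y'r0 y'r1] := H _ _ xr xy'.
have xr1 : enorm (x - z) < r1 by move: xr; rewrite !lt_min => /and3P[].
have := r1P x x (hor y) (hor y') xr1 xr1 yr1 y'r1.
rewrite -yE -y'E subrr enorm0 mulr0 => /(_ xy xy').
rewrite {1}yE {1}y'E => /(_ yr0 y'r0).
rewrite le_eqVlt ltNge enorm_ge0 orbF enorm_eq0 subr_eq0 => /eqP E.
by rewrite y'E E -yE.
Qed.

Lemma nondegenerate_good : good_set Omega z.
Proof.
apply/good_setP => //; have [r r_gt0 rP] := nondegenerate_near.
exists r => // x xr; have [y xy] := foot_exists openO compl0 x.
have [Ox _ _ U] := rP x y xr xy; split=> //; exists y; split=> //.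
Qed.

(** The Lipschitz bound turns the error of [critical_strict] into o(t), and applying [invmx A]
    solves the linearized equation for the velocity of the parameter. *)
Lemma foot_param_derive (P : 'rV[R]_n.+1 -> 'rV[R]_n) v j :
  (\forall x \near z, foot (Omega := Omega) x (sheet (P x))) ->
  is_derive (0 : R) 1 (fun t => P (z + t *: v) 0 j)
    (((hor v + ver v *: grad p0) *m invmx A) 0 j).
Proof.
move=> /nbhs_enormP[rP rP0 PP].
have Pz : P z = p0.
  have /zU : foot (Omega := Omega) z (sheet (P z)) by apply: PP; rewrite subrr enorm0.
  by move=> /(congr1 (fun y => hor y)); rewrite !hor_sheet.
have [M [r1 [M0 r10 r1P]]] := foot_param_lipschitz.
have [r2 r20 r2P] := nondegenerate_near.
have [r3 r30 r3P] := foot_close openO compl0 zU r10.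
set b := hor v + _.
pose C := enorm (row j (invmx A)^T) + 1.
pose V := enorm v + 1.
have C0 : 0 < C by rewrite ltr_wpDl ?enorm_ge0.
have V0 : 0 < V by rewrite ltr_wpDl ?enorm_ge0.
apply/is_derive1_cvgP/cvgrPdist_le => e e0.
pose e' := e / (C * (V + M * V)).
have VM0 : 0 < V + M * V by rewrite addr_gt0// mulr_gt0.
have e'0 : 0 < e' by rewrite divr_gt0// mulr_gt0.
have [r4 r40 r4P] := critical_strict e'0.
have [r5 r50 r5P] := foot_close openO compl0 zU r40.
pose r := Num.min (Num.min rP (Num.min r1 r2)) (Num.min r3 (Num.min r4 r5)).
have r_gt0 : 0 < r by rewrite !lt_min rP0 r10 r20 r30 r40 r50.
near=> t.
have t0 : t != 0 by near: t; exact: near0N0.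
have tr : `|t| < r / V.
  near: t; apply: nbhs_dnbhs; apply/nbhs_normP; exists (r / V) => /=.
    by rewrite divr_gt0.
  by move=> s; rewrite /= sub0r normrN.
pose x := z + t *: v.
have xzE : x - z = t *: v by rewrite /x addrC addKr.
have xV : enorm (x - z) <= `|t| * V by rewrite xzE enormZ ler_wpM2l// lerDl.
have xr : enorm (x - z) < r by rewrite (le_lt_trans xV)// -ltr_pdivlMr.
have := xr; rewrite !lt_min => /andP[/and3P[xrP xr1 xr2] /and3P[xr3 xr4 xr5]].
have xP := PP _ xrP.
have [Ox _ Pr0 _] := r2P _ _ xr2 xP; rewrite hor_sheet in Pr0.
have le_sheet p q : enorm (p - q) <= enorm (sheet p - sheet q).
  rewrite -[p in leLHS]hor_sheet -[q in leLHS]hor_sheet.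
  rewrite -horizontalN -horizontalD -mulmxBl.
  by rewrite (le_trans (enorm_horizontal _))// (enorm_rot _ QQT).
have Pr1 : enorm (P x - p0) < r1 by rewrite (le_lt_trans (le_sheet _ _))// (r3P _ _ xr3).
have Pr4 : enorm (P x - p0) < r4 by rewrite (le_lt_trans (le_sheet _ _))// (r5P _ _ xr5).
have zz r' : 0 < r' -> enorm (z - z) < r' by rewrite subrr enorm0.
have pp r' : 0 < r' -> enorm (p0 - p0) < r' by rewrite subrr enorm0.
have lip := r1P z x p0 (P x) (zz _ r10) xr1 (pp _ r10) Pr1 zp0 xP p0r Pr0.
have lin := r4P z x p0 (P x) (zz _ r40) xr4 (pp _ r40) Pr4 zp0 xP p0r Pr0.
rewrite add0r scale0r addr0 Pz -/x.
have E : linearized ((x - z) *m Q, P x - p0) = t *: b - (P x - p0) *m A.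
  by rewrite /linearized /= xzE -scalemxAl horizontalZ verticalZ -scalerA -scalerDr.
have {}lin : enorm (t *: b - (P x - p0) *m A) <= e' * (`|t| * (V + M * V)).
  rewrite -E (le_trans lin)// ler_wpM2l ?(ltW e'0)// mulrDr lerD//.
  by rewrite (le_trans lip)// mulrCA ler_pM2l.
have D : (b *m invmx A) 0 j - (P x 0 j - p0 0 j) / t =
    t^-1 * dot (t *: b - (P x - p0) *m A) (row j (invmx A)^T).
  have -> : dot (t *: b - (P x - p0) *m A) (row j (invmx A)^T) =
      ((t *: b - (P x - p0) *m A) *m invmx A) 0 j.
    by rewrite [RHS]mxE; apply: eq_bigr => i _; rewrite !mxE.
  rewrite mulmxBl mulmxK// -scalemxAl !mxE.
  by move: (\sum_(_ < n) _) => c; field.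
rewrite D normrM normfV mulrC ler_pdivrMr ?normr_gt0//.
rewrite (le_trans (cauchy_schwarz _ _))//.
apply: (@le_trans _ _ (e' * (`|t| * (V + M * V)) * C)).
  by apply: ler_pM; rewrite ?enorm_ge0// lerDl.
rewrite (_ : _ * C = e' * (C * (V + M * V)) * `|t|); last by ring.
by rewrite divfK// mulf_neq0// gt_eqF.
Unshelve. all: by end_near. Qed.

Lemma foot_derivable (N : 'rV[R]_n.+1 -> 'rV[R]_n.+1) v i :
  (forall x, foot (Omega := Omega) x (N x)) ->
  exists l, is_derive (0 : R) 1 (fun t => N (z + t *: v) 0 i) l.
Proof.
move=> NP; pose P x := hor (N x).
have [r r_gt0 rP] := nondegenerate_near.
have NE x : enorm (x - z) < r -> N x = sheet (P x).
  by move=> xr; have [] := rP _ _ xr (NP x).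
have Pfoot : \forall x \near z, foot (Omega := Omega) x (sheet (P x)).
  by apply/nbhs_enormP; exists r => // x xr; rewrite -NE.
have PD j := foot_param_derive v j Pfoot.
have Pz : P z = p0.
  by rewrite -[RHS]hor_sheet -(zU (NP z)).
pose w := (hor v + ver v *: grad p0) *m invmx A.
(* Chain rule by hand: differentiability of [P] is available along this line only, and strict
   differentiability of [phi] at [p0] compensates. *)
have phiD : is_derive (0 : R) 1 (fun t => phi (P (z + t *: v))) (dot (grad p0) w).
  have slope : (fun t => dot (grad p0) (t^-1 *: (P (z + t *: v) - P z))) @ (0 : R)^' -->
      dot (grad p0) w.
    rewrite /dot; apply: cvg_dnbhs0_sum => j; apply: cvgM; first exact: cvg_cst.
    have /is_derive1_cvgP := PD j; rewrite scale0r addr0.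
    apply: eq_near_cvg; apply: nearW => t.
    by rewrite add0r !mxE mulrC.
  apply/is_derive1_cvgP; rewrite scale0r addr0 Pz.
  have small : exists2 C, 0 < C & \forall t \near (0 : R)^',
      enorm (P (z + t *: v) - p0) <= C * `|t|.
    pose C := \sum_(j < n) (`|w 0 j| + 1) + 1.
    exists C; first by rewrite ltr_wpDl// sumr_ge0// => j _; rewrite addr_ge0.
    have : \forall t \near (0 : R)^', forall j : 'I_n,
        `|(P (z + t *: v) 0 j - p0 0 j) / t| < `|w 0 j| + 1.
      apply: (@filter_forall _ _ (fun j t => `|(P (z + t *: v) 0 j - p0 0 j) / t| < `|w 0 j| + 1)) => j.
      have nl : (fun t => `|(P (z + t *: v) 0 j - p0 0 j) / t|) @ (0 : R)^' --> `|w 0 j|.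
        apply: cvg_norm; have /is_derive1_cvgP := PD j; rewrite scale0r addr0 Pz.
        by under eq_fun do rewrite add0r.
      by apply: (cvgr_lt _ nl); rewrite ltrDl.
    move=> H; near=> t; have t0 : t != 0 by near: t; exact: near0N0.
    have Htj : forall j : 'I_n,
      `|(P (z + t *: v) 0 j - p0 0 j) / t| < `|w 0 j| + 1 by near: t.
    rewrite (le_trans (enorm_le_sum _))// mulrDl mul1r mulr_suml ler_wpDr//.
    apply: ler_sum => j _; have -> : (P (z + t *: v) - p0) 0 j = P (z + t *: v) 0 j - p0 0 j.
      by rewrite mxE; congr (_ + _); rewrite mxE.
    by rewrite -ler_pdivrMr ?normr_gt0// -normfV -normrM ltW.
  have [C C0 HC] := small.
  have zero : (fun t => (phi (P (z + t *: v)) - phi p0 -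
      dot (grad p0) (P (z + t *: v) - p0)) / t) @ (0 : R)^' --> (0 : R).
    apply/cvgrPdist_le => e e0.
    have [s s0 sP] := Ck1_strict p0 (Ck2W phi2) (divr_gt0 e0 C0).
    near=> t; have t0 : t != 0 by near: t; exact: near0N0.
    have Ht : enorm (P (z + t *: v) - p0) <= C * `|t| by near: t.
    have ts : enorm (P (z + t *: v) - p0) < s.
      rewrite (le_lt_trans Ht)// mulrC -ltr_pdivlMr//.
      near: t; apply: nbhs_dnbhs; apply/nbhs_normP; exists (s / C) => /=.
        by rewrite divr_gt0.
      by move=> s'; rewrite /= sub0r normrN.
    rewrite sub0r normrN normrM normfV ler_pdivrMr ?normr_gt0//.
    have := sP p0 (P (z + t *: v)); rewrite subrr enorm0 => /(_ s0 ts) /le_trans; apply.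
    rewrite mulrAC ler_pdivrMr// -mulrA ler_pM2l// mulrC//.
  have := cvgD0 zero slope; rewrite add0r.
  apply: eq_near_cvg; near=> t; have t0 : t != 0 by near: t; exact: near0N0.
  rewrite add0r Pz dotZr; field; exact: t0.
pose g (j : 'I_n.+1) : R := if unlift ord_max j is Some i' then w 0 i' else dot (grad p0) w.
exists (\sum_j g j * Q^T j i).
have SD : is_derive (0 : R) 1 (fun t => sheet (P (z + t *: v)) 0 i)
    (\sum_j g j * Q^T j i).
  have : is_derive (0 : R) 1
      (\sum_(j < n.+1) (fun t : R => Q^T j i * graph_point phi (P (z + t *: v)) 0 j))
      (\sum_j Q^T j i * g j).
    apply: is_derive_sum => j; apply: is_deriveZ.
    rewrite /g; case: unliftP => [i' ->|->].
      have := PD i'; congr (is_derive _ _ _ _); apply/funext => t.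
      by rewrite [RHS]mxE liftK.
    move: phiD; congr (is_derive _ _ _ _); apply/funext => t.
    by rewrite [RHS]mxE unlift_none.
  congr (is_derive _ _ _ _); last by apply: eq_bigr => j _; rewrite mulrC.
  apply/funext => t; rewrite fct_sumE [RHS]mxE.
  by apply: eq_bigr => j _; rewrite mulrC.
apply: near_eq_is_derive SD; near=> t.
rewrite NE// addrAC subrr add0r enormZ.
rewrite (@le_lt_trans _ _ (`|t| * (enorm v + 1)))// ?ler_wpM2l ?lerDl//.
rewrite -ltr_pdivlMr ?ltr_wpDl ?enorm_ge0//.
near: t; apply/nbhs_normP; exists (r / (enorm v + 1)) => /=.
  by rewrite divr_gt0// ltr_wpDl ?enorm_ge0.
by move=> s'; rewrite /= sub0r normrN.
Unshelve. all: by end_near. Qed.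

End nondegenerate.

(** The height at [z] is [s] times the height at [x]. So the form at [z] is [1 - s] times the first
    fundamental form, which dominates the identity, plus [s] times the nonnegative form at [x]. *)
Lemma segment_nondegenerate x p (s : R) : Omega x ->
  foot (Omega := Omega) x (sheet p) -> enorm (sheet p - y0) < r0 -> 0 < s < 1 ->
  let z := sheet p + s *: (x - sheet p) in
  forall w, (1 - s) * enorm w ^+ 2 <=
    dot (w *m (first_form phi p - height z p *: hessian phi p)) w.
Proof.
move=> Ox xp pr /andP[s0 s1] z w.
have hE : height z p = s * height x p.
  rewrite /z mulmxDl -scalemxAl mulmxBl sheetQ verticalD verticalZ verticalD.
  by rewrite verticalN vertical_graph; ring.
have := foot_second_order w xp pr.
rewrite hE mulmxBr dotBl -scalemxAr dotZl /first_form mulmxDr mulmx1 dotDl -enorm_sqr.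
have -> : dot (w *m ((grad p)^T *m grad p)) w = dot (grad p) w ^+ 2.
  rewrite mulmxA (_ : w *m _ = (dot w (grad p))%:M); last first.
    by apply/matrixP => i j; rewrite !ord1 [RHS]mxE eqxx mulr1n dotE.
  by rewrite mul_scalar_mx dotZl (dotC w) expr2.
have : 0 <= (1 - s) * dot (grad p) w ^+ 2 by rewrite mulr_ge0 ?sqr_ge0// subr_ge0 ltW.
move: (dot (w *m _) w) (enorm w ^+ 2) (dot (grad p) w ^+ 2) (height x p) => a b c d.
move=> H1 H2; have := ler_wpM2l (ltW s0) H2; lra.
Qed.

End chart.

(** * The Laplacian of the distance and the mean curvature *)

Section first_form.
Context {R : realType} {n : nat}.
Variables (phi : 'rV[R]_n -> R) (p : 'rV[R]_n).
Local Notation g := (first_form phi p).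

Lemma dot_first_form w : dot (w *m g) w = enorm w ^+ 2 + dot (gradient phi p) w ^+ 2.
Proof.
rewrite /first_form mulmxDr mulmx1 dotDl -enorm_sqr mulmxA.
rewrite (_ : w *m (gradient phi p)^T = (dot w (gradient phi p))%:M); last first.
  by apply/matrixP => i j; rewrite !ord1 [RHS]mxE eqxx mulr1n dotE.
by rewrite mul_scalar_mx dotZl (dotC w) expr2.
Qed.

Lemma first_form_unit : g \in unitmx.
Proof.
rewrite -row_free_unit; apply/inj_row_free => w wg; apply/eqP; rewrite -dot_eq0.
have := dot_first_form w; rewrite wg dot0l -enorm_sqr => E.
rewrite eq_le sqr_ge0 andbT [leRHS]E lerDl sqr_ge0//.
Qed.

Lemma first_form_sym : g^T = g.
Proof. by rewrite /first_form linearD/= trmx1 trmx_mul trmxK. Qed.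

(* The columns of [tangent_mx] span the tangent space of the graph at p. *)
Definition tangent_mx : 'M[R]_(n.+1, n) :=
  \matrix_(k, j) (if unlift ord_max k is Some k' then (k' == j)%:R
                  else gradient phi p 0 j).

Lemma mul_tangent_mx (E : 'rV[R]_n.+1) :
  E *m tangent_mx = horizontal E + vertical E *: gradient phi p.
Proof.
apply/rowP => j; rewrite mxE big_ord_recr [tangent_mx ord_max j]mxE unlift_none.
rewrite [RHS]mxE [X in _ = _ + X]mxE; congr (_ + _).
rewrite (bigD1 j)//= big1 => [|i ij]; rewrite [tangent_mx _ _]mxE.
  rewrite (_ : widen_ord _ j = lift ord_max j) ?liftK ?eqxx ?mulr1 ?addr0 ?mxE//.
  by apply/val_inj; rewrite [RHS]lift_max.
rewrite (_ : widen_ord _ i = lift ord_max i) ?liftK ?(negbTE ij) ?mulr0//.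
by apply/val_inj; rewrite [RHS]lift_max.
Qed.

Lemma tangent_mx_gram : tangent_mx^T *m tangent_mx = g.
Proof.
apply/row_matrixP => j; rewrite row_mul mul_tangent_mx /first_form.
apply/rowP => k; rewrite /vertical !mxE liftK unlift_none big_ord1 !mxE.
by rewrite eq_sym.
Qed.

End first_form.

(** * Second derivatives of the distance on the good set *)

Section laplacian_bound.
Context {R : realType} {n : nat} {Omega : set 'rV[R]_n.+1}.
Hypothesis openO : open Omega.
Hypothesis compl0 : ~` Omega !=set0.
Hypothesis C2O : C2_boundary Omega.
Implicit Types (x y z v : 'rV[R]_n.+1) (p w : 'rV[R]_n).
Local Notation delta := (bdist Omega).
Local Notation foot := (foot (Omega := Omega)).

Lemma foot_chart x y : Omega x -> foot x y -> exists Q phi r0,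
  [/\ graph_chart Omega y Q phi, Q *m Q^T = 1%:M, Ck 2 phi, 0 < r0 &
    (forall x, enorm (x - y) < r0 ->
      (Omega x <-> phi (horizontal (x *m Q)) < vertical (x *m Q)))].
Proof.
move=> Ox xy; have [Q [phi ch]] := C2O (foot_frontier openO compl0 Ox xy).
have [[QQ _] phi2 /nbhs_enormP[r r0 rP]] := ch.
by exists Q, phi, r.
Qed.

(** Used twice: for a good point placed inside a longer segment, it yields a differentiable foot;
    for an arbitrary point of [Omega], it provides good points arbitrarily close by. *)
Lemma segment_good x y (s : R) : Omega x -> foot x y -> 0 < s < 1 ->
  good_set Omega (y + s *: (x - y)) /\
  forall (N : 'rV[R]_n.+1 -> 'rV[R]_n.+1) v i, (forall x, foot x (N x)) ->
    exists l, is_derive (0 : R) 1 (fun t => N (y + s *: (x - y) + t *: v) 0 i) l.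
Proof.
move=> Ox xy s01; have /andP[s0 s1] := s01.
have [Q [phi [r0 [_ QQ phi2 r00 chP]]]] := foot_chart Ox xy.
have yr : enorm (y - y) < r0 by rewrite subrr enorm0.
have yE := chart_foot openO compl0 QQ phi2 chP Ox xy yr.
pose p := horizontal (y *m Q).
have s01' : 0 <= s < 1 by rewrite ltW.
have zU := foot_segment_unique openO compl0 xy s01'.
have [|zy dz] := foot_segment openO compl0 xy (t := s); first by rewrite !ltW.
have Oz : Omega (y + s *: (x - y)).
  apply: (bdist_pos openO compl0).
  by rewrite dz mulr_gt0// (bdist_gt0 openO compl0 Ox).
have nd := segment_nondegenerate openO compl0 QQ phi2 chP Ox (p := p) (s := s).
rewrite -yE in nd; have {}nd := nd xy yr s01.
have k0 : 0 < 1 - s by rewrite subr_gt0.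
rewrite yE -/p in zU zy yr.
split.
  have := nondegenerate_good openO compl0 QQ phi2 chP (z := y + s *: (x - y)) (p0 := p) (k := 1 - s).
  rewrite -yE in zU zy yr *; apply=> //.
move=> N v i NP.
have := foot_derivable openO compl0 QQ phi2 chP (z := y + s *: (x - y)) (p0 := p) (k := 1 - s).
rewrite -yE in zU zy yr *; apply=> //.
Qed.

Lemma good_foot_derivable x (N : 'rV[R]_n.+1 -> 'rV[R]_n.+1) v i :
  good_set Omega x -> (forall x, foot x (N x)) ->
  exists l, is_derive (0 : R) 1 (fun t => N (x + t *: v) 0 i) l.
Proof.
move=> Gx NP; have [z [s [zy s01 xE]]] := foot_extension openO compl0 Gx (NP x).
have Oz : Omega z.
  apply: contrapT => Oz; have := zy.2; rewrite (bdist0 openO compl0 Oz) => /eqP.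
  rewrite enorm_eq0 subr_eq0 => /eqP zN; have := (NP x).1.
  rewrite zN subrr scaler0 addr0 in xE; rewrite -xE.
  by have /(good_setP openO compl0)[r r0 /(_ x)] := Gx; rewrite subrr enorm0 => /(_ r0)[].
by have [_ /(_ N v i NP)] := segment_good Oz zy s01; rewrite -xE.
Qed.

Lemma good_Omega x : good_set Omega x -> Omega x.
Proof.
move=> /(good_setP openO compl0)[r r0 /(_ x)].
by rewrite subrr enorm0 => /(_ r0)[].
Qed.

Lemma good_unique x y : good_set Omega x -> foot x y ->
  forall y', foot x y' -> y' = y.
Proof.
move=> /(good_setP openO compl0)[r r0 /(_ x)].
rewrite subrr enorm0 => /(_ r0)[_ [y0 [_ yU]]] xy y' xy'.
by rewrite (yU _ xy) (yU _ xy').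
Qed.

Lemma good_partial x y i : good_set Omega x -> foot x y ->
  is_derive x (delta_mx 0 i) delta ((x - y) 0 i / delta x).
Proof.
move=> Gx xy; rewrite -dot_delta.
exact: (is_derive_bdist openO compl0 _ (good_Omega Gx) xy (good_unique Gx xy)).
Qed.

Lemma good_partialE x y i : good_set Omega x -> foot x y ->
  partial delta i x = (x - y) 0 i / delta x.
Proof. by move=> Gx xy; have [_ ] := good_partial i Gx xy. Qed.

Lemma good_open x : good_set Omega x -> \forall z \near x, good_set Omega z.
Proof. by move=> Gx; apply: open_nbhs_nbhs; split => //; exact: open_interior. Qed.

(** Near [x] the first derivative is [(z - N z) 0 i / delta z], so differentiability of the foot
    suffices. Second derivatives on the good set are thereby genuine limits. *)
Lemma good_derivable2 x i : good_set Omega x ->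
  exists l, is_derive x (delta_mx 0 i) (partial delta i) l.
Proof.
move=> Gx; have [N NP] := choice (foot_exists openO compl0).
have [l Nl] := good_foot_derivable (delta_mx 0 i) i Gx NP.
have d0 : delta x != 0 by rewrite gt_eqF// (bdist_gt0 openO compl0 (good_Omega Gx)).
have dD : is_derive (0 : R) 1 (fun t => delta (x + t *: delta_mx 0 i))
    ((x - N x) 0 i / delta x).
  have := (is_derive_line delta x (delta_mx 0 i) 0 ((x - N x) 0 i / delta x)).1.
  by rewrite scale0r addr0; apply; exact: good_partial.
have dV : is_derive (0 : R) 1 (fun t => (delta (x + t *: delta_mx 0 i))^-1)
    (- (delta x) ^- 2 *: ((x - N x) 0 i / delta x)).
  have := @is_deriveV R (fun t => delta (x + t *: delta_mx 0 i)) 0 _ 1 _ dD.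
  by rewrite scale0r addr0; apply.
have lD : is_derive (0 : R) 1 (fun t : R => x 0 i + t - N (x + t *: delta_mx 0 i) 0 i)
    (0 + 1 - l).
  by apply: is_deriveB.
have gD := is_deriveM lD dV.
set l' := (X in is_derive _ _ _ X) in gD.
have H := (is_derive_line (fun z => (z 0 i - N z 0 i) / delta z) x (delta_mx 0 i) 0 l').2.
rewrite scale0r addr0 in H.
exists l'; apply: near_eq_is_derive (H _); last first.
  move: gD; congr (is_derive _ _ _ _).
  by apply/funext => t /=; rewrite !mxE !eqxx mulr1.
have := good_open Gx; apply: filterS => z Gz.
by rewrite (good_partialE i Gz (NP z)) !mxE.
Qed.

Lemma good_peano2 x i : good_set Omega x ->
  peano2 (fun t => delta (x + t *: delta_mx 0 i)) (partial delta i x)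
    (partial (partial delta i) i x).
Proof.
move=> Gx; have [l lD] := good_derivable2 i Gx.
have -> : partial (partial delta i) i x = l by have [] := lD.
have := @peano2_derive R (fun t => delta (x + t *: delta_mx 0 i))
  (fun t => partial delta i (x + t *: delta_mx 0 i)) l.
rewrite scale0r addr0; apply; last first.
  have := (is_derive_line (partial delta i) x (delta_mx 0 i) 0 l).1.
  by rewrite scale0r addr0; apply.
have /nbhs_enormP[r r0 rP] := good_open Gx.
apply/nbhs_normP; exists r; first exact: r0.
move=> t; rewrite /ball_/= sub0r normrN => tr.
apply: (is_derive_line delta x (delta_mx 0 i) t _).1.
have Gt : good_set Omega (x + t *: delta_mx 0 i).
  by apply: rP; rewrite addrAC subrr add0r enormZ enorm_delta mulr1.
have [y ty] := foot_exists openO compl0 (x + t *: delta_mx 0 i).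
by rewrite (good_partialE i Gt ty); exact: good_partial.
Qed.

Lemma good_partial_sqr x : good_set Omega x -> \sum_i partial delta i x ^+ 2 = 1.
Proof.
move=> Gx; have [y xy] := foot_exists openO compl0 x.
have d0 := bdist_gt0 openO compl0 (good_Omega Gx).
under eq_bigr do rewrite (good_partialE _ Gx xy) exprMn.
rewrite -mulr_suml (_ : \sum_i _ = delta x ^+ 2).
  by rewrite -exprMn divff ?expr1n// gt_eqF.
by rewrite -xy.2 enorm_sqr; apply: eq_bigr => i _; rewrite expr2.
Qed.

(* While x moves by t e_i, the competitor for the foot moves along the boundary
   by t s times the tangential part of e_i; comparing second order terms and
   summing over i gives one inequality for each s. *)
Lemma laplacian_bdist_le x y Q phi (s : R) : good_set Omega x -> foot x y ->
  graph_chart Omega y Q phi ->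
  delta x * laplacian delta x <= n%:R * (1 - s) ^+ 2 -
    delta x * s ^+ 2 * \tr (shape_operator phi (horizontal (y *m Q))).
Proof.
move=> Gx xy [[QQ _] phi2 /nbhs_enormP[r0 r00 chP]].
have Ox := good_Omega Gx; have d0 := bdist_gt0 openO compl0 Ox.
have yr : enorm (y - y) < r0 by rewrite subrr enorm0.
have yE := chart_foot openO compl0 QQ phi2 chP Ox xy yr.
set p := horizontal (y *m Q) in yE *.
set grad := gradient phi p; set hess := hessian phi p.
set g := first_form phi p; set h := vertical (x *m Q) - phi p.
have gu := first_form_unit phi p; have gs := first_form_sym phi p.
have gis : (invmx g)^T = invmx g by rewrite trmx_inv gs.
have {}xy : foot x (graph_point phi p *m Q^T) by rewrite -yE.
have {}yr : enorm (graph_point phi p *m Q^T - y) < r0 by rewrite -yE.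
have h0 := height_gt0 openO compl0 QQ phi2 chP Ox xy yr.
have hs := height_sqr openO compl0 QQ phi2 chP xy yr.
pose J := Q *m tangent_mx phi p.
pose E i : 'rV[R]_n.+1 := row i Q.
(* [row i J *m invmx g] is the parameter velocity of the orthogonal projection of the i-th basis
   vector to the tangent space. *)
pose w i : 'rV[R]_n := s *: (row i J *m invmx g).
have bE i : row i J = horizontal (E i) + vertical (E i) *: grad.
  by rewrite row_mul mul_tangent_mx.
have QTQ : Q^T *m Q = 1%:M by exact: mulmx1C.
have JJ : J^T *m J = g.
  by rewrite trmx_mul mulmxA -(mulmxA _ Q^T) QTQ mulmx1 tangent_mx_gram.
have E1 i : enorm (E i) = 1.
  by rewrite /E rowE (enorm_rot _ QQ) enorm_delta.
have H i : 2 * partial delta i x ^+ 2 + 2 * delta x * partial (partial delta i) i x <=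
   2 * (1 - 2 * s * dot (row i J *m invmx g) (row i J) +
     s ^+ 2 * dot (row i J *m invmx g) (row i J) -
     h * s ^+ 2 * dot (row i J *m (invmx g *m hess *m invmx g)) (row i J)).
  have touch := sheet_touch openO compl0 QQ phi2 chP (delta_mx 0 i) (w i) xy yr.
  rewrite -rowE in touch.
  have F := peano2_graph_sqdist (X := x *m Q) (E := E i) (p := p) (w := w i) phi2.
  have D := peano2_sqr (good_peano2 (i := i) Gx); rewrite scale0r addr0 in D.
  have [|_] := peano2_le _ touch D F.
    by rewrite !scale0r !addr0 -(sqdist_sheet _ QQ) xy.2.
  rewrite -/grad -/hess -/h.
  move=> /le_trans; apply; rewrite ler_pM2l//.
  have wE : enorm (horizontal (E i) - w i) ^+ 2 + (vertical (E i) - dot grad (w i)) ^+ 2 =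
     1 - 2 * dot (row i J) (w i) + dot (w i *m g) (w i).
    rewrite bE dotDl dotZl dot_first_form -/grad.
    have := E1 i => /(congr1 (fun a => a ^+ 2)); rewrite enorm_hv expr1n.
    rewrite enorm_sqrD enormN dotNr; move: (enorm _ ^+ 2) (enorm (w i) ^+ 2) (dot _ _) (dot _ _).
    by move: (vertical _) => a b c d e; lra.
  rewrite wE; rewrite /w -scalemxAl mulmxKV// !(dotZl, dotZr) -scalemxAl dotZl.
  rewrite -[dot (_ *m hess) _]/(dot _ _) (dotC (row i J) (row i J *m invmx g)).
  rewrite [X in _ - h * X](_ : _ = s ^+ 2 * dot (row i J *m (invmx g *m hess *m invmx g)) (row i J)); last first.
    rewrite mulrA -expr2; congr (_ * _).
    rewrite !dotE !mulmxA; congr (_ 0 0).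
    by rewrite trmx_mul gis !mulmxA.
  by rewrite le_eqVlt; apply/orP; left; apply/eqP; ring.
(* The squared lengths of the tangential parts of an orthonormal basis add up to the dimension of
   the tangent space. *)
have Sa : \sum_i dot (row i J *m invmx g) (row i J) = n%:R.
  by rewrite sum_dot_mulmx JJ mulmxV// mxtrace1.
have Sb : \sum_i dot (row i J *m (invmx g *m hess *m invmx g)) (row i J) =
    \tr (invmx g *m hess).
  by rewrite sum_dot_mulmx JJ !mulmxA mulmxV// mul1mx mxtrace_mulC.
(* [delta x = h * sqrt (1 + |grad|^2)]: the slope factor relating height and distance is the
   normalization in [second_form]. *)
have tE : delta x * \tr (shape_operator phi p) = h * \tr (invmx g *m hess).
  rewrite /shape_operator /second_form -scalemxAr mxtraceZ -/g -/hess mulrA.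
  congr (_ * _); set q := Num.sqrt _.
  have q0 : 0 < q by rewrite sqrtr_gt0 ltr_wpDr// sqr_ge0.
  apply: (mulIf (lt0r_neq0 q0)); rewrite mulfVK ?gt_eqF//.
  rewrite -[LHS]ger0_norm ?(ltW d0)// -sqrtr_sqr hs sqrtrM ?sqr_ge0//.
  by rewrite sqrtr_sqr ger0_norm// ltW.
(* Of the [n.+1] directions, the normal one is cancelled by the 1 of the eikonal equation, which
   leaves [n * (1 - 2 s + s^2)]. *)
have := @ler_sum R 'I_n.+1 (index_enum _) xpredT _ _ (fun i _ => H i).
rewrite big_split/= -!mulr_sumr good_partial_sqr// -/(laplacian delta x).
rewrite sumrB big_split/= sumrB -!mulr_sumr Sa Sb sumr_const card_ord -mulr_natr.
rewrite mul1r -(natr1 n) (mulrAC (delta x)) tE.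
move: (laplacian delta x) (\tr _) (n%:R) => L T m; nra.
Qed.

Lemma laplacian_bdist_mean_curvature (H0 : R) x : (0 < n)%N -> 0 <= H0 ->
  (forall y Q phi, frontier Omega y -> graph_chart Omega y Q phi ->
    H0 <= \tr (shape_operator phi (horizontal (y *m Q)))) ->
  good_set Omega x ->
  2 / n%:R * H0 ^+ 2 <= - laplacian delta x / (2 * delta x).
Proof.
move=> n0 H00 H0P Gx; have Ox := good_Omega Gx.
have d0 := bdist_gt0 openO compl0 Ox.
have [y xy] := foot_exists openO compl0 x.
have [Q [phi [r0 [ch _ _ _ _]]]] := foot_chart Ox xy.
have := H0P _ _ _ (foot_frontier openO compl0 Ox xy) ch.
have K s := laplacian_bdist_le s Gx xy ch.
move: (\tr _) K => T K HT.
pose D := delta x * laplacian delta x.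
have n0' : 0 < n%:R :> R by rewrite ltr0n.
pose q := delta x * H0 / n%:R.
have q0 : 0 <= q by rewrite !mulr_ge0 ?invr_ge0 ?(ltW d0)// ltW.
have qE : delta x * H0 = n%:R * q by rewrite /q [RHS]mulrC divfK// gt_eqF.
have {}K s : D <= n%:R * ((1 - s) ^+ 2 - s ^+ 2 * q).
  rewrite (le_trans (K s))// mulrBr lerD2l lerN2.
  have -> : n%:R * (s ^+ 2 * q) = s ^+ 2 * (delta x * H0) by rewrite qE mulrCA.
  rewrite (mulrAC (delta x)) [leRHS]mulrC ler_wpM2l ?sqr_ge0//.
  by rewrite ler_pM2l.
suff DE : 4 * n%:R * q ^+ 2 <= - D.
  rewrite ler_pdivlMr ?mulr_gt0// -(ler_pM2r d0).
  rewrite mulNr (mulrC (laplacian _ _)) -/D (le_trans _ DE)// /q.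
  by rewrite le_eqVlt; apply/orP; left; apply/eqP; field; rewrite gt_eqF.
have [q1|q1] := ltP q 1.
  have q1' : 0 < 1 - q by rewrite subr_gt0.
  (* The minimizer over [s] of [(1 - s)^2 - s^2 q], with minimum [- q / (1 - q)]. *)
  have := K (1 - q)^-1.
  rewrite (_ : _ - _ = - (q / (1 - q))); last by field; rewrite gt_eqF.
  rewrite mulrN lerNr => /(le_trans _); apply.
  rewrite (mulrC 4) -mulrA ler_pM2l// ler_pdivlMr//.
  (* [q (1 - q) <= 1/4] gives [q / (1 - q) >= 4 q^2]; this 4, halved by the 2 in [2 * delta x], is
     the 2 of the final constant. *)
  by have := sqr_ge0 (1 - 2 * q); nra.
(* For q >= 1 the right-hand side of K is unbounded below in s. *)
have := K ((1 - D / n%:R) / 2 + 1).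
have : 0 <= ((1 - D / n%:R) / 2 + 1) ^+ 2 * (q - 1).
  by rewrite mulr_ge0 ?sqr_ge0// subr_ge0.
set s := _ + 1 => H1 H2.
have : D <= n%:R * (1 - 2 * s).
  by rewrite (le_trans H2)// ler_pM2l//; lra.
rewrite (_ : n%:R * _ = D - 2 * n%:R); last by rewrite /s; field; rewrite gt_eqF.
by rewrite lerDl oppr_ge0 leNgt mulr_gt0.
Qed.

End laplacian_bound.

(** * Reality of the principal curvatures *)

Section generalized_eigenvalues.
Variables (R : rcfType) (n : nat) (g h : 'M[R]_n).
Hypotheses (gsym : g^T = g) (hsym : h^T = h) (gu : g \in unitmx).
Hypothesis gpos : forall w : 'rV[R]_n, w != 0 -> 0 < (w *m g *m w^T) 0 0.
Local Notation C := (complex R).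
Local Notation rc := (real_complex R).
Local Notation Cmx := (map_mx rc).

Let re_mulmx (u : 'rV[C]_n) (M : 'M[R]_n) :
  map_mx (@complex.Re R) (u *m Cmx M) = map_mx (@complex.Re R) u *m M.
Proof.
apply/rowP => j; rewrite !mxE raddf_sum; apply: eq_bigr => k _.
by rewrite !mxE; case: (u 0 k) => a b /=; rewrite mulr0 subr0.
Qed.

Let im_mulmx (u : 'rV[C]_n) (M : 'M[R]_n) :
  map_mx (@complex.Im R) (u *m Cmx M) = map_mx (@complex.Im R) u *m M.
Proof.
apply/rowP => j; rewrite !mxE raddf_sum; apply: eq_bigr => k _.
by rewrite !mxE; case: (u 0 k) => a b /=; rewrite mulr0 add0r.
Qed.

(* [invmx g *m h] is self-adjoint for the inner product defined by g. *)
Lemma generalized_eigenvalue_real (z : C) :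
  eigenvalue (Cmx (invmx g *m h)) z -> z = (complex.Re z)%:C%C.
Proof.
move=> /eigenvalueP[v vE v0].
pose u := v *m Cmx (invmx g).
have uv : u *m Cmx g = v by rewrite -mulmxA -map_mxM mulVmx// map_mx1 mulmx1.
have uh : u *m Cmx h = z *: (u *m Cmx g) by rewrite uv -vE -mulmxA -map_mxM.
pose a := map_mx (@complex.Re R) u; pose b := map_mx (@complex.Im R) u.
have ReE : a *m h = complex.Re z *: (a *m g) - complex.Im z *: (b *m g).
  rewrite -re_mulmx uh; apply/rowP => j.
  rewrite -re_mulmx -im_mulmx !mxE.
  by case: z {vE uh} => x y; case: (\sum_k _) => c d.
have ImE : b *m h = complex.Re z *: (b *m g) + complex.Im z *: (a *m g).
  rewrite -im_mulmx uh; apply/rowP => j.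
  rewrite -re_mulmx -im_mulmx !mxE.
  by case: z {vE uh ReE} => x y; case: (\sum_k _) => c d.
have sym (M : 'M[R]_n) (p q : 'rV[R]_n) : M^T = M -> (p *m M *m q^T) 0 0 = (q *m M *m p^T) 0 0.
  move=> MT; have -> : p *m M *m q^T = (q *m M *m p^T)^T.
    by rewrite !trmx_mul trmxK MT mulmxA.
  by rewrite mxE.
(* Evaluating [a h b^T] in two ways, the terms with [Re z] cancel and [Im z (a g a^T + b g b^T) = 0]
   remains. *)
have := sym h a b hsym; rewrite ReE ImE mulmxBl mulmxDl -!scalemxAl.
have mxB (x y : R) (M N : 'M[R]_1) : (x *: M - y *: N) 0 0 = x * M 0 0 - y * N 0 0.
  by rewrite !mxE.
have mxD (x y : R) (M N : 'M[R]_1) : (x *: M + y *: N) 0 0 = x * M 0 0 + y * N 0 0.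
  by rewrite !mxE.
rewrite mxB mxD (sym g b a gsym) => /(congr1 (fun t => t - complex.Re z * (a *m g *m b^T) 0 0)).
rewrite addrAC subrr add0r addrAC subrr add0r => H.
have nneg (w : 'rV[R]_n) : 0 <= (w *m g *m w^T) 0 0.
  by have [->|/gpos/ltW//] := eqVneq w 0; rewrite !mul0mx mxE.
have I0 : complex.Im z = 0.
  have : complex.Im z * ((a *m g *m a^T) 0 0 + (b *m g *m b^T) 0 0) = 0.
    by rewrite mulrDr -H addNr.
  move=> /eqP; rewrite mulf_eq0 => /orP[/eqP//|].
  rewrite paddr_eq0// => /andP[/eqP a0 /eqP b0].
  have az : a = 0 by apply/eqP; apply: contraT => /gpos; rewrite a0 ltxx.
  have bz : b = 0 by apply/eqP; apply: contraT => /gpos; rewrite b0 ltxx.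
  have u0 : u = 0.
    apply/rowP => j; have := congr1 (fun w : 'rV[R]_n => w 0 j) az.
    have := congr1 (fun w : 'rV[R]_n => w 0 j) bz; rewrite !mxE.
    by move: (\sum_j0 _) => [x y] /= -> ->.
  by move: v0; rewrite -uv u0 mul0mx eqxx.
by case: z I0 {vE uh ReE ImE H} => x y /= ->.
Qed.

(** The characteristic polynomial splits over the complex numbers, its roots are real, and the
    factorization descends because the embedding of polynomials is injective. *)
Lemma char_poly_generalized_split : exists k : 'I_n -> R,
  char_poly (invmx g *m h) = \prod_i ('X - (k i)%:P).
Proof.
set A := invmx g *m h.
have [r rE] := closed_field_poly_normal (char_poly (Cmx A)).
rewrite (monicP (char_poly_monic _)) scale1r in rE.
pose s := map (@complex.Re R) r.
have rs : r = map rc s.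
  rewrite -map_comp -[LHS]map_id; apply/eq_in_map => z zr.
  apply: generalized_eigenvalue_real; rewrite eigenvalue_root_char rE.
  by rewrite root_prod_XsubC.
have sE : char_poly A = \prod_(x <- s) ('X - x%:P).
  apply: (map_poly_inj rc); rewrite map_char_poly rE rs big_map rmorph_prod/=.
  by apply: eq_bigr => x _; rewrite rmorphB/= map_polyX map_polyC.
have ss : size s = n.
  have := size_char_poly A; rewrite sE size_prod_XsubC => -[].
  by [].
exists (fun i => nth 0 s i).
by rewrite sE (big_nth 0) big_mkord ss.
Qed.

End generalized_eigenvalues.

Lemma char_poly_split_trace (R : fieldType) (n : nat) (A : 'M[R]_n) (k : 'I_n -> R) :
  (0 < n)%N -> char_poly A = \prod_i ('X - (k i)%:P) -> \sum_i k i = \tr A.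
Proof.
move=> n0 AE; apply: oppr_inj; rewrite -char_poly_trace// AE.
pose s := [seq k i | i <- enum 'I_n].
have sn : size s = n by rewrite size_map size_enum_ord.
have := @coefPn_prod_XsubC _ s; rewrite sn -lt0n => /(_ n0).
have -> : \sum_(p <- s) p = \sum_i k i by rewrite big_map big_enum.
have -> : \prod_(p <- s) ('X - p%:P) = \prod_i ('X - (k i)%:P).
  by rewrite big_map big_enum.
by move=> ->.
Qed.

Lemma shape_operator_split {R : realType} {n : nat} (phi : 'rV[R]_n -> R) p :
  Ck 2 phi -> exists k : 'I_n -> R,
  char_poly (shape_operator phi p) = \prod_i ('X - (k i)%:P).
Proof.
move=> phi2; apply: char_poly_generalized_split.
- exact: first_form_sym.
- by rewrite linearZ/= hessian_sym.
- exact: first_form_unit.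
- move=> w w0; rewrite -dotE dot_first_form ltr_wpDr ?sqr_ge0//.
  by rewrite enorm_sqr lt_def dot_eq0 w0 dot_ge0.
Qed.

(** A boundary point contributes to the infimum only if its characteristic polynomial splits over
    the reals. The splitting makes the trace in the given chart one of the competitors. *)
Lemma inf_mean_curvature_le {R : realType} {n : nat} (Omega : set 'rV[R]_n.+1) y Q phi :
  (0 < n)%N -> frontier Omega y -> graph_chart Omega y Q phi ->
  (inf_mean_curvature Omega <=
    (\tr (shape_operator phi (horizontal (y *m Q))))%:E)%E.
Proof.
move=> n0 Fy ch; apply: ereal_inf_lbound.
exists (\tr (shape_operator phi (horizontal (y *m Q)))) => //.
have [_ phi2 _] := ch; have [k kE] := shape_operator_split (horizontal (y *m Q)) phi2.
exists y => //; exists k; first by exists Q, phi.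
by rewrite (char_poly_split_trace n0 kE).
Qed.

(** * The Hardy inequality *)

Section translation.
Context {R : realType}.

Lemma measurable_addr (u : R) :
  measurable_fun [set: measurableTypeR R] (fun x : measurableTypeR R => x + u : measurableTypeR R).
Proof. exact: measurable_funD. Qed.

Lemma lebesgue_measure_translation (u : R) (A : set (measurableTypeR R)) :
  measurable A -> lebesgue_measure ((fun x : R => x + u) @^-1` A) = lebesgue_measure A.
Proof.
move=> mA; apply/esym.
pose m := @measure_function_pushforward__canonical__measure_function_Measure _ _ _ _ _
    (@lebesgue_measure R) _ (measurable_addr u).
apply: (@lebesgue_measure_unique R m) => // _ [[a b] _ <-].
rewrite /m /= /pushforward.
rewrite (_ : _ @^-1` _ = [set` `]a - u, b - u]]); last first.
  by apply/seteqP; split => x /=; rewrite !in_itv/= ltrBlDr lerBrDr.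
rewrite !lebesgue_measure_itv/= !lte_fin ltrD2r; case: ifP => // _.
by rewrite -!EFinB; congr (_%:E); ring.
Qed.

Lemma integral_translation (u : R) (f : measurableTypeR R -> \bar R) :
  measurable_fun setT f -> (forall x, 0 <= f x)%E ->
  (\int[lebesgue_measure]_x f (x + u)%R = \int[lebesgue_measure]_x f x)%E.
Proof.
move=> mf f0.
transitivity (\int[pushforward lebesgue_measure (fun x : measurableTypeR R => (x + u)%R : measurableTypeR R)]_x f x)%E.
  by rewrite (ge0_integral_pushforward (measurable_addr u) lebesgue_measure measurableT mf).
apply: eq_measure_integral => [|? A mA _]; first exact: measurable_addr.
exact: lebesgue_measure_translation.
Qed.

Lemma measurable_rV_addr n (u : 'rV[R]_n) :
  measurable_fun [set: 'rV[R]_n] (fun v : 'rV[R]_n => v + u).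
Proof.
apply: measurable_fun_rV => i.
rewrite [X in measurable_fun _ X](_ : _ = (fun x : measurableTypeR R => x + u 0 i : measurableTypeR R) \o (fun v : 'rV[R]_n => v 0 i)).
  by apply: measurableT_comp; [exact: measurable_addr|exact: measurable_coord_rV].
by apply/funext => v /=; rewrite mxE.
Qed.

Lemma rV_consD n (p : measurableTypeR R * 'rV[R]_n) (u : 'rV[R]_n.+1) :
  rV_cons p + u = rV_cons (p.1 + u 0 ord0, p.2 + \row_i u 0 (lift ord0 i)).
Proof.
case: p => x v; apply/rowP => i.
by have [j ->|->] := unliftP ord0 i; rewrite mxE ?rV_consS ?rV_cons0// !mxE.
Qed.

(** Induction over the product: the first coordinate is a translation in the integral of the section
    measures, the others are the induction hypothesis within each section. *)
Lemma lebesgue_rV_translation n (u : 'rV[R]_n) (A : set 'rV[R]_n) :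
  measurable A -> lebesgue_rV R n ((fun v => v + u) @^-1` A) = lebesgue_rV R n A.
Proof.
elim: n u A => [|n IHn] u A mA.
  by congr (lebesgue_rV R 0 _); apply/seteqP; split => v /=; rewrite [u]thinmx0 addr0.
rewrite /= /pushforward.
pose B := @rV_cons R n @^-1` A.
have mB : measurable B by rewrite -[B]setTI; exact: (@measurable_rV_cons R n).
pose u' := \row_i u 0 (lift ord0 i).
rewrite -/B /product_measure1 /=.
pose F := (fun x : measurableTypeR R => lebesgue_rV R n (xsection B x)).
have mF : measurable_fun setT F by exact: measurable_fun_xsection.
rewrite -(@integral_translation (u 0 ord0) F)//.
apply: eq_integral => x _.
rewrite /F /= -(IHn u' (xsection B (x + u 0 ord0))); last exact: measurable_xsection.
congr (lebesgue_rV R n _); apply/seteqP; split => v /=; rewrite /xsection /= !inE /= rV_consD//.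
Qed.

Lemma integral_rV_translation n (u : 'rV[R]_n) (f : 'rV[R]_n -> \bar R) :
  (lebesgue_rV R n).-integrable setT f ->
  (\int[lebesgue_rV R n]_x f (x + u)%R = \int[lebesgue_rV R n]_x f x)%E.
Proof.
move=> intf; have mf := measurable_int _ intf.
have mfu : measurable_fun setT (fun x : 'rV[R]_n => f (x + u)).
  by apply: measurableT_comp => //; exact: measurable_rV_addr.
have pushE : forall g : 'rV[R]_n -> \bar R,
    (\int[pushforward (lebesgue_rV R n) (fun x : 'rV[R]_n => (x + u)%R)]_x g x =
     \int[lebesgue_rV R n]_x g x)%E.
  move=> g; apply: eq_measure_integral => [|? A mA _]; first exact: measurable_rV_addr.
  exact: lebesgue_rV_translation.
rewrite -[RHS]pushE (@integral_pushforward _ _ _ _ R _ (measurable_rV_addr u) (lebesgue_rV R n) setT f mf _ measurableT)//.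
apply/integrableP; split => //.
have /integrableP[_] := intf; rewrite -[X in (X < _)%E -> _]pushE.
rewrite (ge0_integral_pushforward (measurable_rV_addr u) (lebesgue_rV R n) measurableT)//.
exact: measurableT_comp.
Qed.

Lemma lebesgue_rV_bounded n (A : set 'rV[R]_n) : measurable A -> bounded_set A ->
  (lebesgue_rV R n A < +oo)%E.
Proof.
move=> mA [M [_ AM]].
pose c : R := `|M| + 1.
have c0 : 0 <= c by rewrite addr_ge0.
apply: (@le_lt_trans _ _ (lebesgue_rV R n (box (fun=> - c) (fun=> c)))).
  apply: le_measure; rewrite ?inE//; first exact: measurable_box.
  move=> v Av i; rewrite in_itv/= -ler_norml.
  rewrite (le_trans (coord_norm v i))// AM//.
  by rewrite (le_lt_trans (ler_norm M))// ltrDl.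
rewrite lebesgue_rV_box ?ltry// => i.
by rewrite (@le_trans _ _ 0)// oppr_le0.
Qed.

Lemma continuous_measurable_rV n (f : 'rV[R]_n -> R) : continuous f ->
  measurable_fun [set: 'rV[R]_n] (f : 'rV[R]_n -> measurableTypeR R).
Proof.
move=> cf; apply: (measurability _ (RGenOpens.measurableE R)).
move=> _ [_ [a [b ->] <-]]; rewrite setTI; apply: open_measurable_rV.
by apply: open_comp => [x _|]; [exact: cf|exact: interval_open].
Qed.

End translation.

(** * Continuous functions with compact support *)

Section compact_support.
Context {R : realType} {n : nat}.
Implicit Types (f g d : 'rV[R]_n -> R) (K : set 'rV[R]_n).
Local Notation mu := (lebesgue_rV R n).

Lemma compact_measurable_rV K : compact K -> measurable K.
Proof.
move=> /(compact_closed (@norm_hausdorff _ _)) cK; rewrite -(setCK K).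
by apply: measurableC; apply: open_measurable_rV; exact: closed_openC.
Qed.

Lemma compact_support_integrable g K : continuous g -> compact K ->
  (forall x, ~ K x -> g x = 0) -> mu.-integrable setT (EFin \o g).
Proof.
move=> cg cK gK; have mK := compact_measurable_rV cK.
have : mu.-integrable K (EFin \o g).
  apply: measurable_bounded_integrable => //.
  - exact: lebesgue_rV_bounded (compact_bounded cK).
  - by apply: (@measurable_funS _ _ _ _ setT) => //; exact: continuous_measurable_rV.
  - have : bounded_set (g @` K).
      by apply/compact_bounded/continuous_compact => //; exact: continuous_subspaceT.
    move=> [M [Mr MK]]; exists M; split => // x Mx y Ky; apply: MK Mx _ _.
    by exists y.
rewrite integrable_mkcond//; apply: eq_integrable => // x _.
rewrite /patch; case: ifPn => // /negP; rewrite inE => /gK /= ->//.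
Qed.

Lemma continuous_addr (u : 'rV[R]_n) : continuous (fun x : 'rV[R]_n => x + u).
Proof. by move=> x; apply: (@cvgD _ _ _ (nbhs x)); [exact: cvg_id|exact: cvg_cst]. Qed.

Lemma continuous_shift f (u : 'rV[R]_n) : continuous f -> continuous (fun x : 'rV[R]_n => f (x + u)).
Proof. by move=> cf x; apply: continuous_comp; [exact: continuous_addr|exact: cf]. Qed.

Lemma compact_shift K (u : 'rV[R]_n) : compact K -> compact [set x | K (x + u)].
Proof.
move=> cK; rewrite (_ : mkset _ = (fun x => x - u) @` K).
  apply: continuous_compact cK; exact/continuous_subspaceT/continuous_addr.
apply/seteqP; split => [x /= Kx|_ [x Kx <-]] /=; last by rewrite subrK.
by exists (x + u) => //; rewrite addrK.
Qed.

(** Off the closed support the numerator vanishes in a neighbourhood, so the quotient is locally 0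
    even where [d] vanishes. This allows integration over the whole space. *)
Lemma quotient_continuous f d : continuous f -> continuous d ->
  (forall x, closure [set x | f x != 0] x -> d x != 0) ->
  continuous (fun x => f x ^+ 2 / d x).
Proof.
move=> cf cd fd x.
have [Kx|Kx] := pselect (closure [set x | f x != 0] x).
  apply: (@cvgM _ _ (nbhs x)).
    by apply: (@cvgM _ _ (nbhs x)); exact: cf.
  by apply: (@cvgV _ _ (nbhs x)); [exact: fd|exact: cd].
have : \forall y \near x, f y ^+ 2 / d y = 0.
  have : nbhs x (~` closure [set x | f x != 0]).
    by apply: open_nbhs_nbhs; split => //; apply: closed_openC; exact: closed_closure.
  apply: filterS => y Ky; suff -> : f y = 0 by rewrite expr0n mul0r.
  apply/eqP; apply: contraT => fy; exfalso; apply: Ky; exact: subset_closure.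
move=> H; have E := nbhs_singleton H; rewrite /continuous_at E.
apply/(@cvgrPdist_le _ _ _ (nbhs x)) => eps eps0; apply: filterS H => y ->.
by rewrite subrr normr0 ltW.
Qed.

Lemma closure_support0 f x : ~ closure [set x | f x != 0] x -> f x = 0.
Proof.
move=> fx; apply/eqP; apply: contraT => f0; exfalso; apply: fx.
exact: subset_closure.
Qed.

End compact_support.

(** * The discrete ground state inequality *)

Section discrete_hardy.
Context {R : realType} {n : nat}.
Variables (f w : 'rV[R]_n -> R).
Hypotheses (cf : continuous f) (cw : continuous w) (w0 : forall x, 0 <= w x).
Let K := closure [set x | f x != 0].
Hypothesis cK : compact K.
Hypothesis wK : forall x, K x -> w x != 0.
Local Notation mu := (lebesgue_rV R n).

(* If wa, wb > 0, the difference of the two sides is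
   wa wb (fa / wa - fb / wb)^2. *)
Lemma ground_state_le (fa fb wa wb : R) : 0 <= wa -> 0 <= wb ->
  (wa = 0 -> fa = 0) -> (wb = 0 -> fb = 0) ->
  (wa - wb) * (fa ^+ 2 / wa - fb ^+ 2 / wb) <= (fa - fb) ^+ 2.
Proof.
rewrite le_eqVlt => /predU1P[<-|wa0] + fa0 fb0.
  rewrite fa0// !sub0r expr0n mul0r sub0r sqrrN mulrNN.
  rewrite le_eqVlt => /predU1P[wb0|wb0].
    by rewrite -wb0 fb0// expr0n mul0r.
  by rewrite mulrC divfK// gt_eqF.
rewrite le_eqVlt => /predU1P[wb0|wb0].
  rewrite fb0// -wb0 !subr0 expr0n mul0r subr0 mulrC divfK// gt_eqF//.
rewrite -subr_ge0.
rewrite (_ : _ - _ = wa * wb * (fa / wa - fb / wb) ^+ 2); last first.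
  by field; rewrite !gt_eqF.
by rewrite mulr_ge0 ?sqr_ge0// mulr_ge0// ltW.
Qed.

(** Summation by parts: the integrand on the left is [b - a], and translating [b] by [e] produces
    the left-hand side of [ground_state_le] for the points [x + e] and [x]. *)
Lemma discrete_hardy (e : 'rV[R]_n) :
  (\int[mu]_x (f x ^+ 2 / w x * (2 * w x - w (x + e)%R - w (x - e)%R))%:E <=
   \int[mu]_x ((f (x + e)%R - f x) ^+ 2)%:E)%E.
Proof.
pose q x := f x ^+ 2 / w x.
have cq : continuous q by exact: quotient_continuous.
have q0 x : ~ K x -> q x = 0.
  by move=> /closure_support0 fx; rewrite /q fx expr0n mul0r.
pose a x := (w (x + e) - w x) * q x.
pose b x := (w x - w (x - e)) * q x.
have ca : continuous a.
  move=> x; apply: (@cvgM _ _ (nbhs x)); last exact: cq.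
  by apply: (@cvgB _ _ _ (nbhs x)); [exact: continuous_shift|exact: cw].
have cb : continuous b.
  move=> x; apply: (@cvgM _ _ (nbhs x)); last exact: cq.
  by apply: (@cvgB _ _ _ (nbhs x)); [exact: cw|exact: continuous_shift].
have ia : mu.-integrable setT (EFin \o a).
  by apply: compact_support_integrable cK _ => // x /q0; rewrite /a => ->; rewrite mulr0.
have ib : mu.-integrable setT (EFin \o b).
  by apply: compact_support_integrable cK _ => // x /q0; rewrite /b => ->; rewrite mulr0.
have ibe : mu.-integrable setT (EFin \o (fun x => b (x + e))).
  apply: compact_support_integrable (compact_shift (u := e) cK) _; first exact: continuous_shift.
  by move=> x /q0; rewrite /b => ->; rewrite mulr0.
have ic : mu.-integrable setT (EFin \o (fun x => (f (x + e) - f x) ^+ 2)).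
  have cKe : compact (K `|` [set x | K (x + e)]) by apply: compactU => //; exact: compact_shift.
  apply: compact_support_integrable cKe _.
    by move=> x; apply: (@cvgM _ _ (nbhs x)); apply: (@cvgB _ _ _ (nbhs x));
      [exact: continuous_shift|exact: cf|exact: continuous_shift|exact: cf].
  move=> x Kx; rewrite !(@closure_support0 _ _ f) ?subrr ?expr0n//.
    by move=> /= Kf; apply: Kx; left.
  by move=> Kf; apply: Kx; right.
rewrite [leLHS](_ : _ = \int[mu]_x ((b x)%:E - (a x)%:E))%E; last first.
  by apply: eq_integral => x _; rewrite -EFinB; congr (_%:E); rewrite /a /b /q; ring.
rewrite integralB_EFin//.
rewrite -(integral_rV_translation e ib).
rewrite -[leLHS]integralB_EFin//.
apply: le_integral => //; first exact: integrableB.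
move=> x _; rewrite -EFinB lee_fin /a /b addrK -mulrBr.
apply: ground_state_le => // wx; apply: closure_support0 => Kx.
  by move: (wK Kx); rewrite wx eqxx.
by move: (wK Kx); rewrite wx eqxx.
Qed.

End discrete_hardy.

Lemma cvg_harmonic_dnbhs {R : realType} :
  (fun k : nat => k.+1%:R^-1 : R) @ \oo --> (0 : R)^'.
Proof.
move=> A /= /nbhs_normP[r /= r0 rA].
have := near_infty_natSinv_lt (PosNum r0); apply: filterS => k kr.
by apply: rA => /=; rewrite ?invr_eq0 ?pnatr_eq0// sub0r normrN gtr0_norm ?invr_gt0.
Qed.

(** * Second differences of the square root of the distance *)

Section hardy.
Context {R : realType} {n : nat} {Omega : set 'rV[R]_n.+1}.
Hypothesis openO : open Omega.
Hypothesis compl0 : ~` Omega !=set0.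
Hypothesis C2O : C2_boundary Omega.
Implicit Types (x y z v : 'rV[R]_n.+1).
Local Notation delta := (bdist Omega).
Local Notation foot := (foot (Omega := Omega)).
Local Notation w x := (Num.sqrt (bdist Omega x)).
Local Notation ei i := (delta_mx 0 i : 'rV[R]_n.+1).
Local Notation mu := (lebesgue_rV R n.+1).

Lemma sqrt_tangent_le (a b : R) : 0 < a -> 0 <= b ->
  Num.sqrt b <= Num.sqrt a + (b - a) / (2 * Num.sqrt a).
Proof.
move=> a0 b0; have s0 : 0 < Num.sqrt a by rewrite sqrtr_gt0.
rewrite -lerBlDl ler_pdivlMr ?mulr_gt0//.
have := sqr_ge0 (Num.sqrt b - Num.sqrt a).
have := sqr_sqrtr b0; have := sqr_sqrtr (ltW a0).
move: (Num.sqrt a) (Num.sqrt b) => s t <- <-; nra.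
Qed.

(** Concavity of the square root combined with semiconcavity of the distance. For [v = t *: ei i],
    division by [t ^+ 2] leaves a bound independent of [t], as dominated convergence requires. *)
Lemma sqrt_bdist_second_difference_ge x v : Omega x ->
  - (enorm v ^+ 2 / (2 * delta x ^+ 2)) <=
  (2 * w x - w (x + v) - w (x - v)) / w x.
Proof.
move=> Ox; have d0 := bdist_gt0 openO compl0 Ox.
have s0 : 0 < w x by rewrite sqrtr_gt0.
rewrite ler_pdivlMr//.
have := bdist_second_difference_le openO compl0 v Ox.
have := sqrt_tangent_le d0 (bdist_ge0 openO compl0 (x + v)).
have := sqrt_tangent_le d0 (bdist_ge0 openO compl0 (x - v)).
rewrite (_ : - (enorm v ^+ 2 / (2 * delta x ^+ 2)) * w x =
  - (enorm v ^+ 2 / delta x / (2 * w x))); last first.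
  have := sqr_sqrtr (ltW d0); move: (w x) s0 => s s0 <-.
  by field; rewrite gt_eqF.
move=> H1 H2 H3.
have : (delta (x + v) - delta x) / (2 * w x) + (delta (x - v) - delta x) / (2 * w x)
    <= enorm v ^+ 2 / delta x / (2 * w x).
  rewrite -mulrDl ler_pM2r ?invr_gt0 ?mulr_gt0//.
  by move: H3; move: (_ / delta x) => c; lra.
move: H1 H2; move: (_ / (2 * w x)) (_ / (2 * w x)) (_ / (2 * w x)) => a b c; lra.
Qed.

(* The graph of delta translated along the segment towards the foot touches
   delta from above at x, and delta is twice differentiable at the translated
   point. *)
Lemma sqrt_bdist_laplacian_ge (l e : R) x : 0 <= l ->
  (forall z, good_set Omega z -> l <= - laplacian delta z / (2 * delta z)) ->
  Omega x -> 0 < e ->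
  \forall t \near (0 : R)^', (4 * delta x ^+ 2)^-1 + l - e <
    \sum_i (2 * w x - w (x + t *: ei i) - w (x - t *: ei i)) / w x / t ^+ 2.
Proof.
move=> l0 lP Ox e0; have d0 := bdist_gt0 openO compl0 Ox.
have s0 : 0 < w x by rewrite sqrtr_gt0.
have sE := sqr_sqrtr (ltW d0).
have [y xy] := foot_exists openO compl0 x.
(* Midpoint of [l / (l + e / 2)] and 1. At [z] the hypothesis involves [delta z = s * delta x], so
   [l] degrades to [l * s], which must stay above [l - e / 2]. *)
pose s := l / (l + e / 2) / 2 + 1 / 2.
have le0 : 0 < l + e / 2 by rewrite ltr_wpDl// divr_gt0.
have q1 : l / (l + e / 2) < 1 by rewrite ltr_pdivrMr// mul1r ltrDl divr_gt0.
have q0 : 0 <= l / (l + e / 2) by rewrite divr_ge0// ltW.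
have s01 : 0 < s < 1 by rewrite /s; apply/andP; split; lra.
have ls : l - e / 2 <= l * s.
  have : l / (l + e / 2) * (l + e / 2) = l by rewrite divfK// gt_eqF.
  rewrite /s; move: (l / (l + e / 2)) q0 q1 => q q0 q1 qE.
  nra.
have [Gz _] := segment_good openO compl0 C2O Ox xy s01.
have [|_ dz] := foot_segment openO compl0 xy (t := s).
  by move/andP: s01 => [? ?]; rewrite !ltW.
set z := y + s *: (x - y) in Gz dz.
pose tau := delta x - delta z.
have xzE : x - z = (1 - s) *: (x - y) by rewrite /z opprD addrA scalerBl scale1r.
have xz : enorm (x - z) = tau.
  rewrite xzE enormZ xy.2 /tau dz ger0_norm; first by ring.
  by move/andP: s01 => [_ ?]; rewrite subr_ge0 ltW.
pose b i t := delta (z + t *: ei i) + tau.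
have b0 i : b i 0 = delta x by rewrite /b scale0r addr0 /tau addrC subrK.
have bP i : peano2 (b i) (partial delta i z) (partial (partial delta i) i z).
  have := peano2D (good_peano2 openO compl0 C2O (i := i) Gz) (peano2_cst tau).
  by rewrite !addr0.
have wb i t : w (x + t *: ei i) <= Num.sqrt (b i t).
  rewrite ler_wsqrtr// /b.
  have := bdist_lipschitz openO compl0 (x + t *: ei i) (z + t *: ei i).
  by rewrite opprD addrACA subrr addr0 xz.
have sb i : (fun t => (Num.sqrt (b i t) + Num.sqrt (b i (- t)) - 2 * Num.sqrt (b i 0)) / t ^+ 2)
    @ (0 : R)^' --> partial (partial delta i) i z / (2 * w x) -
      partial delta i z ^+ 2 / (4 * w x ^+ 3).
  rewrite -(b0 i); apply: peano2_second_difference; apply: peano2_sqrt (bP i).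
  by rewrite b0.
have lim := cvg_dnbhs0_sum sb.
set S := \sum_i _ in lim.
have SE : S = laplacian delta z / (2 * w x) - (4 * w x ^+ 3)^-1.
  by rewrite /S sumrB -!mulr_suml (good_partial_sqr openO compl0 Gz) mul1r.
have Slt : S < - w x * ((4 * delta x ^+ 2)^-1 + l - e).
  rewrite SE.
  have dz0 : 0 < delta z by rewrite dz mulr_gt0//; case/andP: s01.
  have := lP z Gz; rewrite ler_pdivlMr ?mulr_gt0// dz => Hl.
  have H1 : laplacian delta z / (2 * w x) <= - (l * s * w x).
    rewrite ler_pdivrMr ?mulr_gt0//.
    rewrite (_ : - _ * _ = - (l * (2 * (s * delta x)))); first by rewrite lerNr.
    by move: sE; move: (w x) => q <-; ring.
  rewrite (_ : (4 * delta x ^+ 2)^-1 = (4 * w x ^+ 3)^-1 / w x); last first.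
    by move: sE; move: (w x) s0 => q q0' <-; field; rewrite gt_eqF.
  rewrite (_ : - w x * _ = - (4 * w x ^+ 3)^-1 - w x * (l - e)); last first.
    by field; rewrite gt_eqF.
  rewrite -[X in _ < X]addrC ltr_leD// (le_lt_trans H1)// ltrN2 (mulrC _ (w x)) ltr_pM2l//.
  by rewrite (lt_le_trans _ ls)// ltrD2l ltrN2 ltr_pdivrMr// ltr_pMr// ltr1n.
have : \forall t \near (0 : R)^',
    \sum_i (Num.sqrt (b i t) + Num.sqrt (b i (- t)) - 2 * Num.sqrt (b i 0)) / t ^+ 2
    < - w x * ((4 * delta x ^+ 2)^-1 + l - e).
  exact: (cvgr_lt S).
apply: filterS => t Ht.
rewrite -(@ltr_nM2l _ (- w x)) ?oppr_lt0//; apply: le_lt_trans Ht.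
rewrite mulr_sumr; apply: ler_sum => i _.
rewrite mulrA ler_wpM2r ?invr_ge0 ?sqr_ge0// mulNr mulrC divfK ?gt_eqF// b0.
have arith (A B C D E : R) : A <= C -> B <= D -> - (2 * E - A - B) <= C + D - 2 * E.
  lra.
by apply: arith; rewrite // -scaleNr.
Qed.

End hardy.

(** * Convergence of the difference quotients of the test function *)

Section support.
Context {R : realType} {n : nat}.
Variable f : 'rV[R]_n -> R.
Let K := closure [set x | f x != 0].
Local Notation mu := (lebesgue_rV R n).
Local Notation ei i := (delta_mx 0 i : 'rV[R]_n).

Lemma integral_supportE (D : set 'rV[R]_n) (g : 'rV[R]_n -> \bar R) :
  (forall x, ~ D x -> g x = 0%E) -> (\int[mu]_(x in D) g x = \int[mu]_x g x)%E.
Proof.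
move=> gD; rewrite integral_mkcond; apply: eq_integral => x _.
by rewrite /patch; case: ifPn => // /negP; rewrite inE => /gD ->.
Qed.

Lemma partial_support0 i x : ~ K x -> partial f i x = 0.
Proof.
move=> Kx; rewrite -(@derive_cst R 'rV[R]_n R (0 : R) x (ei i)); apply: near_eq_derive.
have : nbhs x (~` K).
  by apply: open_nbhs_nbhs; split => //; apply: closed_openC; exact: closed_closure.
by apply: filterS => z Kz; rewrite (closure_support0 Kz).
Qed.

Hypothesis f1 : Ck 1 f.
Hypothesis cK : compact K.

Lemma partial_continuous i : continuous (partial f i).
Proof. by have [_ /(_ i)[]] := f1. Qed.

Lemma partial_bounded i : exists2 M, 0 <= M & forall x, `|partial f i x| <= M.
Proof.
have : bounded_set (partial f i @` K).
  apply/compact_bounded/continuous_compact => //.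
  exact/continuous_subspaceT/partial_continuous.
move=> [M [_ MK]]; exists (`|M| + 1); first by rewrite addr_ge0.
move=> x; have [Kx|Kx] := pselect (K x).
  by apply: MK; [rewrite (le_lt_trans (ler_norm M))// ltrDl|exists x].
by rewrite partial_support0// normr0 addr_ge0.
Qed.

Lemma partial_quotient_le i (M h : R) (x : 'rV[R]_n) : h != 0 -> (forall z, `|partial f i z| <= M) ->
  `|(f (x + h *: ei i) - f x) / h| <= M.
Proof.
move=> h0 fM.
have [s _] : exists2 s, `|s| <= `|h| &
    f (x + h *: ei i) - f (x + 0 *: ei i) = partial f i (x + s *: ei i) * h.
  apply: (@is_derive_mvt _ (fun s => f (x + s *: ei i))
    (fun s => partial f i (x + s *: ei i))) => s _.
  by apply: (is_derive_line f x (ei i) s _).1; exact: Ck1_is_derive.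
by rewrite scale0r addr0 => ->; rewrite mulfK.
Qed.

(** Dominated convergence: by the mean value theorem the quotients are bounded by the supremum [M]
    of the partial derivative, and they all vanish outside one ball. *)
Lemma dirichlet_cvg i :
  (\int[mu]_x (((f (x + (k.+1%:R^-1 : R) *: ei i)%R - f x) / k.+1%:R^-1) ^+ 2)%:E)%E
     @[k --> \oo] --> (\int[mu]_x (partial f i x ^+ 2)%:E)%E.
Proof.
have [M M0 fM] := partial_bounded i.
have [c [_ cP]] := compact_bounded cK.
(* The factor [n] compares the Euclidean norm with the sup norm in which [K] is bounded; the final 1
   accommodates shifts by steps of length at most 1. *)
pose B := [set x : 'rV[R]_n | enorm (x - 0) <= n%:R * (`|c| + 1) + 1].
have KB x : K x -> enorm x <= n%:R * (`|c| + 1).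
  move=> Kx; apply: le_trans (enorm_le_norm _) _; rewrite ler_wpM2l ?ler0n//.
  by apply: cP => //; rewrite (le_lt_trans (ler_norm c))// ltrDl.
have mB : measurable B by apply: compact_measurable_rV; exact: compact_eball.
have h01 (k : nat) : 0 < (k.+1%:R^-1 : R) <= 1.
  by rewrite invr_gt0 ltr0n/= invf_le1 ?ltr0n// ler1n.
have h0 (k : nat) : (k.+1%:R^-1 : R) != 0 by rewrite invr_eq0 pnatr_eq0.
have B0 x : ~ B x -> f x = 0.
  move=> Bx; apply: (@closure_support0 _ _ f) => Kx; apply: Bx.
  by rewrite /B /= subr0 (le_trans (KB _ Kx))// lerDl.
have B0h (k : nat) x : ~ B x -> f (x + (k.+1%:R^-1 : R) *: ei i) = 0.
  move=> Bx; apply: (@closure_support0 _ _ f) => Kx; apply: Bx.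
  rewrite /B /= subr0.
  rewrite -[x](addrK ((k.+1%:R^-1 : R) *: ei i)) (le_trans (ler_enormD _ _))// lerD//.
    exact: KB.
  case/andP: (h01 k) => p0 p1.
  by rewrite enormN enormZ enorm_delta mulr1 ger0_norm// ltW.
under eq_fun => k.
  rewrite -(@integral_supportE B); last first.
    by move=> x Bx; rewrite (B0 x)// B0h// subrr mul0r expr0n.
  over.
rewrite -(@integral_supportE B); last first.
  move=> x Bx; rewrite partial_support0 ?expr0n// => Kx; apply: Bx.
  by rewrite /B /= subr0 (le_trans (KB _ Kx))// lerDl.
have cf : continuous f by case: f1.
have [] // := @dominated_convergence _ _ R mu B mB
  (fun k x => (((f (x + (k.+1%:R^-1 : R) *: ei i)%R - f x) / k.+1%:R^-1) ^+ 2)%:E)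
  (fun x => (partial f i x ^+ 2)%:E) (fun=> (M ^+ 2)%:E).
- move=> k; apply/measurable_EFinP; apply: (@measurable_funS _ _ _ _ setT) => //.
  apply: continuous_measurable_rV => x.
  suff C : continuous (fun x : 'rV[R]_n => (f (x + (k.+1%:R^-1 : R) *: ei i) - f x) / k.+1%:R^-1).
    by apply: (@cvgM _ _ (nbhs x)); exact: C.
  move=> z; apply: (@cvgM _ _ (nbhs z)); last exact: cvg_cst.
  by apply: (@cvgB _ _ _ (nbhs z)); [exact: continuous_shift|exact: cf].
- apply/measurable_EFinP; apply: (@measurable_funS _ _ _ _ setT) => //.
  apply: continuous_measurable_rV => x.
  by apply: (@cvgM _ _ (nbhs x)); exact: partial_continuous.
- apply: aeW => x _; apply/cvg_EFin; first exact: nearW.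
  have : is_derive x (ei i) f (partial f i x) by exact: Ck1_is_derive.
  move=> /is_derive_cvgP D.
  have {}D : (fun k : nat => (f (x + (k.+1%:R^-1 : R) *: ei i) - f x) / k.+1%:R^-1)
      @ \oo --> partial f i x.
    rewrite (_ : (fun k : nat => _) = (fun h : R => h^-1 * (f (h *: ei i + x) - f x)) \o
        (fun k : nat => (k.+1%:R^-1 : R))).
      exact: cvg_comp (@cvg_harmonic_dnbhs R) D.
    by apply/funext => k /=; rewrite mulrC (addrC x).
  by apply: (@cvgM _ _ (\oo : set_system nat)); exact: D.
- apply: (@measurable_bounded_integrable _ _ _ mu (fun=> M ^+ 2)) => //.
    by apply: (lebesgue_rV_bounded mB); apply: compact_bounded; exact: compact_eball.
  exists (M ^+ 2); split; first exact: num_real.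
  by move=> y My z _ /=; rewrite ger0_norm ?sqr_ge0// ltW.
- apply: aeW => x k _; rewrite abse_EFin lee_fin ger0_norm ?sqr_ge0//.
  by rewrite -[leLHS]real_normK ?num_real// ler_sqr ?nnegrE// partial_quotient_le.
Qed.

End support.

Lemma gradient_sqr {R : realType} {n : nat} (f : 'rV[R]_n -> R) x :
  enorm (gradient f x) ^+ 2 = \sum_i partial f i x ^+ 2.
Proof. by rewrite enorm_sqr; apply: eq_bigr => i _; rewrite !mxE expr2. Qed.

Section discrete_hardy_scaled.
Context {R : realType} {n : nat}.
Variables (f w : 'rV[R]_n -> R).
Hypotheses (cf : continuous f) (cw : continuous w) (w0 : forall x, 0 <= w x).
Let K := closure [set x | f x != 0].
Hypothesis cK : compact K.
Hypothesis wK : forall x, K x -> w x != 0.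
Local Notation mu := (lebesgue_rV R n).

Lemma ground_quotient_continuous (v : 'rV[R]_n) :
  continuous (fun x => f x ^+ 2 / w x * (2 * w x - w (x + v) - w (x - v))).
Proof.
move=> x; apply: (@cvgM _ _ (nbhs x)); first exact: quotient_continuous.
apply: (@cvgB _ _ _ (nbhs x)); last exact: continuous_shift.
apply: (@cvgB _ _ _ (nbhs x)); last exact: continuous_shift.
by apply: (@cvgM _ _ (nbhs x)); [exact: cvg_cst|exact: cw].
Qed.

Lemma ground_quotient_integrable (v : 'rV[R]_n) (c : R) : mu.-integrable setT
  (fun x => (f x ^+ 2 / w x * (2 * w x - w (x + v)%R - w (x - v)%R) / c)%:E).
Proof.
apply: compact_support_integrable cK _.
  move=> x; apply: (@cvgM _ _ (nbhs x)); last exact: cvg_cst.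
  exact: ground_quotient_continuous.
by move=> x /closure_support0 ->; rewrite expr0n !mul0r.
Qed.

Lemma discrete_hardy_scaled (e : 'rV[R]_n) (h : R) : h != 0 ->
  (\int[mu]_x (f x ^+ 2 / w x * (2 * w x - w (x + h *: e)%R - w (x - h *: e)%R) / h ^+ 2)%:E <=
   \int[mu]_x (((f (x + h *: e)%R - f x) / h) ^+ 2)%:E)%E.
Proof.
move=> h0.
have c0 : 0 <= (h ^+ 2)^-1 by rewrite invr_ge0 sqr_ge0.
under eq_integral do rewrite mulrC EFinM.
rewrite integralZl//; last first.
  have := ground_quotient_integrable (h *: e) 1.
  by under eq_fun do rewrite divr1.
under [leRHS]eq_integral do rewrite expr_div_n mulrC EFinM.
rewrite ge0_integralZl//.
- by rewrite lee_pmul2l ?discrete_hardy// lte_fin invr_gt0 exprn_even_gt0.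
- apply/measurable_EFinP; apply: continuous_measurable_rV => x.
  by apply: (@cvgM _ _ (nbhs x)); apply: (@cvgB _ _ _ (nbhs x));
    [exact: continuous_shift|exact: cf|exact: continuous_shift|exact: cf].
- by move=> x _; rewrite lee_fin sqr_ge0.
Qed.

End discrete_hardy_scaled.

(** * Passage to the limit *)

Section hardy_inequality.
Context {R : realType} {n : nat} {Omega : set 'rV[R]_n.+1}.
Hypothesis openO : open Omega.
Hypothesis compl0 : ~` Omega !=set0.
Hypothesis C2O : C2_boundary Omega.
Variables (f : 'rV[R]_n.+1 -> R) (l : R).
Let K := closure [set x | f x != 0].
Hypotheses (f1 : Ck 1 f) (cK : compact K) (KO : K `<=` Omega).
Hypothesis l0 : 0 <= l.
Hypothesis lP : forall z, good_set Omega z ->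
  l <= - laplacian (bdist Omega) z / (2 * bdist Omega z).
Implicit Types (x y z v : 'rV[R]_n.+1).
Local Notation delta := (bdist Omega).
Local Notation w x := (Num.sqrt (bdist Omega x)).
Local Notation ei i := (delta_mx 0 i : 'rV[R]_n.+1).
Local Notation mu := (lebesgue_rV R n.+1).

Let cf : continuous f. Proof. by case: f1. Qed.

Let f0 x : ~ K x -> f x = 0. Proof. exact: closure_support0. Qed.

Let cdelta : continuous delta := bdist_continuous openO compl0.

Let Kdelta x : K x -> 0 < delta x.
Proof. by move=> /KO; exact: bdist_gt0. Qed.

Let cw : continuous (fun x => w x).
Proof. by move=> x; apply: continuous_comp; [exact: cdelta|exact: sqrt_continuous]. Qed.

Let Kw x : K x -> w x != 0.
Proof. by move=> /Kdelta; rewrite -sqrtr_gt0 => /gt_eqF ->. Qed.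

Lemma sqr_bdist_quotient_continuous (c : R) : c != 0 ->
  continuous (fun x => f x ^+ 2 / (c * delta x ^+ 2)).
Proof.
move=> c0; apply: quotient_continuous => //.
  move=> x; apply: (@cvgM _ _ (nbhs x)); first exact: cvg_cst.
  by apply: (@cvgM _ _ (nbhs x)); exact: cdelta.
by move=> x /Kdelta d0; rewrite mulf_neq0// expf_neq0// gt_eqF.
Qed.

Let hardy_weight x := f x ^+ 2 / (4 * delta x ^+ 2) + l * f x ^+ 2.

Let ground (h : R) x :=
  \sum_i f x ^+ 2 / w x * (2 * w x - w (x + h *: ei i) - w (x - h *: ei i)) / h ^+ 2.

Let groundE (h : R) x : ground h x =
  f x ^+ 2 * \sum_i (2 * w x - w (x + h *: ei i) - w (x - h *: ei i)) / w x / h ^+ 2.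
Proof.
have arith (a b c d : R) : a / b * c / d = a * (c / b / d).
  by rewrite -!mulrA (mulrCA b^-1).
by rewrite mulr_sumr; apply: eq_bigr => i _; exact: arith.
Qed.

Let groundG := fun x => n.+1%:R * (f x ^+ 2 / (2 * delta x ^+ 2)).

Let ground_ge (h : R) x : h != 0 -> - groundG x <= ground h x.
Proof.
move=> h0; rewrite groundE /groundG.
have [/KO Ox|/f0 ->] := pselect (K x); last by rewrite expr0n !mul0r mulr0 oppr0.
rewrite mulrCA -mulrN ler_wpM2l ?sqr_ge0//.
rewrite (_ : - _ = \sum_(i < n.+1) - (2 * delta x ^+ 2)^-1); last first.
  by rewrite sumr_const card_ord mulNrn; congr (- _); exact: mulr_natl.
apply: ler_sum => i _; rewrite ler_pdivlMr ?exprn_even_gt0//.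
have := sqrt_bdist_second_difference_ge openO compl0 (h *: ei i) Ox.
apply: le_trans; rewrite enormZ enorm_delta mulr1 real_normK ?num_real//.
by rewrite mulNr mulrC.
Qed.

Let weight_ge0 x : 0 <= hardy_weight x.
Proof.
rewrite /hardy_weight addr_ge0//; last by rewrite mulr_ge0// sqr_ge0.
by rewrite divr_ge0 ?sqr_ge0// mulr_ge0// sqr_ge0.
Qed.

Let groundG_ge0 x : 0 <= groundG x.
Proof. by rewrite /groundG mulr_ge0// divr_ge0 ?sqr_ge0// mulr_ge0// sqr_ge0. Qed.

Let weight_continuous : continuous hardy_weight.
Proof.
move=> x; apply: (@cvgD _ _ _ (nbhs x)); first exact: sqr_bdist_quotient_continuous.
apply: (@cvgM _ _ (nbhs x)); first exact: cvg_cst.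
by apply: (@cvgM _ _ (nbhs x)); exact: cf.
Qed.

Let weight_integrable : mu.-integrable setT (EFin \o hardy_weight).
Proof.
apply: compact_support_integrable cK _ => // x /f0.
by rewrite /hardy_weight => ->; rewrite expr0n mul0r mulr0 addr0.
Qed.

Let groundG_integrable : mu.-integrable setT (EFin \o groundG).
Proof.
apply: compact_support_integrable cK _ => [|x /f0].
  move=> x; apply: (@cvgM _ _ (nbhs x)); first exact: cvg_cst.
  exact: sqr_bdist_quotient_continuous.
by rewrite /groundG => ->; rewrite expr0n mul0r mulr0.
Qed.

Let ground_continuous (h : R) : continuous (ground h).
Proof.
apply: continuous_big => [|i _ x]; first exact: add_continuous.
apply: (@cvgM _ _ (nbhs x)); last exact: cvg_cst.
by apply: ground_quotient_continuous => //; exact: Kw.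
Qed.

Let step (k : nat) : R := k.+1%:R^-1.

Let step0 k : step k != 0. Proof. by rewrite invr_eq0 pnatr_eq0. Qed.

(* The truncation makes dominated convergence applicable from above. *)
Let truncated k x := Num.min (ground (step k) x) (hardy_weight x).

Let truncated_abs k x : `|truncated k x| <= groundG x + hardy_weight x.
Proof.
have := ground_ge x (step0 k); have := weight_ge0 x; have := groundG_ge0 x.
rewrite /truncated ler_norml le_min ge_min.
move: (ground _ _) (hardy_weight x) (groundG x) => a b c b0 c0 ca.
by apply/andP; split; [apply/andP; split; lra|apply/orP; right; lra].
Qed.

Let truncated_cvg x : truncated^~ x @ \oo --> hardy_weight x.
Proof.
have [/KO Ox|/f0 fx] := pselect (K x); last first.
  rewrite /truncated (_ : (fun k => _) = cst (hardy_weight x)); first exact: cvg_cst.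
  apply/funext => k /=; rewrite groundE /hardy_weight fx expr0n !mul0r mulr0 addr0.
  by rewrite minxx.
apply/cvgrPdist_le => eps eps0.
(* Scaled so that [f x ^+ 2 * e <= eps]; the added 1 covers [f x = 0]. *)
pose e := eps / (f x ^+ 2 + 1).
have D0 : 0 < f x ^+ 2 + 1 by rewrite ltr_wpDl// sqr_ge0.
have e0 : 0 < e by rewrite divr_gt0.
have fe : f x ^+ 2 * e <= eps.
  rewrite /e mulrCA -[leRHS]mulr1 ler_pM2l// ler_pdivrMr// mul1r lerDl ler01//.
have := sqrt_bdist_laplacian_ge openO compl0 C2O l0 lP Ox e0.
move=> /(@cvg_harmonic_dnbhs R) H.
have {H} : \forall k \near \oo, (4 * delta x ^+ 2)^-1 + l - e <
    \sum_i (2 * w x - w (x + step k *: ei i) - w (x - step k *: ei i)) / w x / step k ^+ 2.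
  exact: H.
apply: filterS => k kP.
(* The truncation never exceeds its limit, so a lower estimate suffices. *)
rewrite /truncated ger0_norm; last by rewrite subr_ge0 ge_min lexx orbT.
rewrite lerBlDr -lerBlDl le_min; apply/andP; split; last first.
  by rewrite lerBlDr lerDl ltW.
rewrite groundE; apply: le_trans (ler_wpM2l (sqr_ge0 _) (ltW kP)).
rewrite /hardy_weight mulrBr mulrDr invfM (mulrC l) lerB//.
Qed.

(** At each step size the truncation is below [ground], whose integral splits into directions, each
    bounded by the discrete inequality; both outer integrals converge as the step tends to 0. *)
Lemma ground_integral_le :
  (\int[mu]_x (hardy_weight x)%:E <= \int[mu]_x (enorm (gradient f x) ^+ 2)%:E)%E.
Proof.
have lhs : (\int[mu]_x (truncated k x)%:E)%E @[k --> \oo] -->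
    (\int[mu]_x (hardy_weight x)%:E)%E.
  have [] // := @dominated_convergence _ _ R mu setT measurableT
    (fun k x => (truncated k x)%:E) (fun x => (hardy_weight x)%:E)
    (fun x => (groundG x)%:E + (hardy_weight x)%:E)%E.
  - move=> k; apply/measurable_EFinP; apply: measurable_minr.
      by apply: continuous_measurable_rV; exact: ground_continuous.
    exact: continuous_measurable_rV.
  - by apply/measurable_EFinP; exact: continuous_measurable_rV.
  - apply: aeW => x _; apply/cvg_EFin; first exact: nearW.
    exact: truncated_cvg.
  - exact: integrableD.
  - by apply: aeW => x k _; rewrite abse_EFin -EFinD lee_fin.
have ipart i : mu.-integrable setT (fun x => (partial f i x ^+ 2)%:E).
  apply: compact_support_integrable cK _.
    by move=> x; apply: (@cvgM _ _ (nbhs x)); exact: partial_continuous.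
  by move=> x Kx; rewrite partial_support0// expr0n.
have rhs : (\sum_i \int[mu]_x (((f (x + step k *: ei i)%R - f x) / step k) ^+ 2)%:E)%E
     @[k --> \oo] --> (\int[mu]_x (enorm (gradient f x) ^+ 2)%:E)%E.
  under eq_integral do rewrite gradient_sqr -sumEFin.
  rewrite integral_sum//.
  apply: cvg_nnesum => i _; last exact: dirichlet_cvg.
  by apply: nearW => k; apply: integral_ge0 => x _; rewrite lee_fin sqr_ge0.
apply: lee_cvg_to lhs rhs _; apply: nearW => k.
have ig i : mu.-integrable setT (fun x => (f x ^+ 2 / w x *
    (2 * w x - w (x + step k *: ei i)%R - w (x - step k *: ei i)%R) / step k ^+ 2)%:E).
  by apply: ground_quotient_integrable => //; exact: Kw.
apply: (@le_trans _ _ (\int[mu]_x (ground (step k) x)%:E)%E).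
  apply: le_integral => //.
  - have : mu.-integrable setT (fun x => (groundG x)%:E + (hardy_weight x)%:E)%E.
      exact: integrableD.
    apply: le_integrable => //.
      apply/measurable_EFinP; apply: measurable_minr.
        by apply: continuous_measurable_rV; exact: ground_continuous.
      exact: continuous_measurable_rV.
    move=> x _; rewrite -EFinD !abse_EFin lee_fin [leRHS]ger0_norm//.
    exact: addr_ge0 (groundG_ge0 x) (weight_ge0 x).
  - have := @integrable_sum _ _ _ mu setT measurableT _ (index_enum 'I_n.+1) xpredT _
      (fun i _ => ig i).
    by under eq_fun do rewrite sumEFin.
  - by move=> x _; rewrite lee_fin ge_min lexx.
under eq_integral do rewrite -sumEFin.
rewrite integral_sum//; apply: lee_sum => i _.
by apply: discrete_hardy_scaled => // [z|z /Kw//]; rewrite sqrtr_ge0.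
Qed.

Lemma hardy_le :
  ((1 / 4)%:E * \int[mu]_(x in Omega) (`|f x| ^+ 2 / delta x ^+ 2)%:E +
   l%:E * \int[mu]_(x in Omega) (`|f x| ^+ 2)%:E <=
   \int[mu]_(x in Omega) (enorm (gradient f x) ^+ 2)%:E)%E.
Proof.
have Of x : ~ Omega x -> f x = 0 by move=> Ox; apply: f0 => /KO.
have fn x : `|f x| ^+ 2 = f x ^+ 2 by rewrite real_normK ?num_real.
have cf2 : continuous (fun x => f x ^+ 2).
  by move=> x; apply: (@cvgM _ _ (nbhs x)); exact: cf.
have cq : continuous (fun x => f x ^+ 2 / delta x ^+ 2).
  by have := @sqr_bdist_quotient_continuous 1 (oner_neq0 _); under eq_fun do rewrite mul1r.
rewrite (@integral_supportE _ _ Omega (fun x => (`|f x| ^+ 2 / delta x ^+ 2)%:E)); last first.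
  by move=> x /Of fx; rewrite fn fx expr0n mul0r.
rewrite (@integral_supportE _ _ Omega (fun x => (`|f x| ^+ 2)%:E)); last first.
  by move=> x /Of fx; rewrite fn fx expr0n.
rewrite (@integral_supportE _ _ Omega (fun x => (enorm (gradient f x) ^+ 2)%:E)); last first.
  move=> x Ox; rewrite gradient_sqr big1// => i _.
  by rewrite partial_support0 ?expr0n// => /KO.
apply: le_trans ground_integral_le.
have q0 x : (0 <= (`|f x| ^+ 2 / delta x ^+ 2)%:E)%E by rewrite lee_fin divr_ge0 ?sqr_ge0.
have s0 x : (0 <= (`|f x| ^+ 2)%:E)%E by rewrite lee_fin sqr_ge0.
have mq : measurable_fun setT (fun x => (`|f x| ^+ 2 / delta x ^+ 2)%:E).
  apply/measurable_EFinP; apply: continuous_measurable_rV.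
  by under eq_fun do rewrite fn.
have ms : measurable_fun setT (fun x => (`|f x| ^+ 2)%:E).
  apply/measurable_EFinP; apply: continuous_measurable_rV.
  by under eq_fun do rewrite fn.
rewrite -ge0_integralZl_EFin// -ge0_integralZl_EFin//.
rewrite -ge0_integralD//; last 4 first.
- by move=> x _; rewrite mule_ge0// lee_fin.
- exact: measurable_funeM.
- by move=> x _; rewrite mule_ge0// lee_fin.
- exact: measurable_funeM.
rewrite le_eqVlt; apply/orP; left; apply/eqP; apply: eq_integral => x _.
have arith (a b c : R) : 1 / 4 * (a / b) + c = a / (4 * b) + c.
  by rewrite div1r invfM mulrCA.
by rewrite -!EFinM -EFinD fn arith.
Qed.

End hardy_inequality.

Theorem theorem1p3 (R : realType) (n : nat) (Omega : set 'rV[R]_n.+1)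
    (n_ge1 : (1 <= n)%N)
    (Omega_domain : domain Omega)
    (frontier_nonempty : frontier Omega !=set0)
    (Omega_C2 : C2_boundary Omega)
    (Omega_mean_convex : (0 <= inf_mean_curvature Omega)%E) :
  ((2 / n%:R)%:E * inf_mean_curvature Omega ^+ 2 <= hardy_lambda Omega)%E /\
  forall f : 'rV[R]_n.+1 -> R, test_function Omega f ->
    (\int[lebesgue_rV R n.+1]_(x in Omega) (enorm (gradient f x) ^+ 2)%:E >=
     (1 / 4)%:E * \int[lebesgue_rV R n.+1]_(x in Omega)
                     (`|f x| ^+ 2 / bdist Omega x ^+ 2)%:E
     + hardy_lambda Omega * \int[lebesgue_rV R n.+1]_(x in Omega)
                     (`|f x| ^+ 2)%:E)%E.
Proof.
have [openO _] := Omega_domain.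
have [y Fy] := frontier_nonempty.
have [clOy nOy] := (frontierP openO y).1 Fy.
have compl0 : ~` Omega !=set0 by exists y.
have [Q [phi ch]] := Omega_C2 y Fy.
(* Finite because the trace at one boundary point bounds the infimum from above. *)
have H_fin : inf_mean_curvature Omega \is a fin_num.
  rewrite ge0_fin_numE//.
  exact: le_lt_trans (inf_mean_curvature_le n_ge1 Fy ch) (ltry _).
have HE := fineK H_fin; move: (fine _) HE => H0 HE.
have H00 : 0 <= H0 by rewrite -lee_fin HE.
have bound z : good_set Omega z ->
    2 / n%:R * H0 ^+ 2 <= - laplacian (bdist Omega) z / (2 * bdist Omega z).
  apply: laplacian_bdist_mean_curvature => // y' Q' phi' Fy' ch'.
  by rewrite -lee_fin HE; exact: inf_mean_curvature_le.
have lower : ((2 / n%:R * H0 ^+ 2)%:E <= hardy_lambda Omega)%E.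
  by apply/ereal_infP => _ [z Gz <-]; rewrite lee_fin bound.
split; first by rewrite -HE -EFin_expe -EFinM.
have lam_lb z : good_set Omega z ->
    (hardy_lambda Omega <= (- laplacian (bdist Omega) z / (2 * bdist Omega z))%:E)%E.
  by move=> Gz; apply: ereal_inf_lbound; exists z.
(* A frontier point is in the closure, so [Omega] has a point. The midpoint between it and a foot is
   good, hence [hardy_lambda] is an infimum over a nonempty set and below [+oo]. *)
have [x [Ox _]] : Omega `&` setT !=set0.
  by have [x []] := clOy setT filterT; exists x.
have [y' xy'] := foot_exists openO compl0 x.
have s01 : 0 < (1 / 2 : R) < 1 by apply/andP; split; lra.
have [Gz _] := segment_good openO compl0 Omega_C2 Ox xy' s01.
have lam0 : (0 <= hardy_lambda Omega)%E.
  by rewrite (le_trans _ lower)// lee_fin mulr_ge0 ?sqr_ge0// divr_ge0.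
have lam_fin : hardy_lambda Omega \is a fin_num.
  by rewrite ge0_fin_numE// (le_lt_trans (lam_lb _ Gz))// ltry.
move=> f [f_smooth cK KO]; rewrite -(fineK lam_fin).
apply: hardy_le => //.
- exact: fine_ge0.
- by move=> z /lam_lb; rewrite -lee_fin fineK.
Qed.
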